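(* Let $\gamma:S^1\to\mathbb{R}^2$ be a closed $C^1$ curve. For $0<\varepsilon\le 1$ let $\gamma_\varepsilon(t)=(\gamma(t),\varepsilon\cos t,\varepsilon\sin t)\in\mathbb{R}^4$, and let $u_\varepsilon:\overline{D^2}\to\mathbb{R}^4$ be a Douglas minimizer spanning $\gamma_\varepsilon$, the family $\{u_\varepsilon\}$ being normalized by the three-point condition. Let $\varepsilon_j\downarrow0$ be a sequence and $u_0:\overline{D^2}\to\mathbb{R}^4$ a continuous map such that $u_{\varepsilon_j}\to u_0$ uniformly on $\overline{D^2}$, and put $g_0^*=u_0|_{\partial D^2}$. Then $u_0$ minimizes area among all Lipschitz maps $v:\overline{D^2}\to\mathbb{R}^4$ with $v|_{\partial D^2}=g_0^*$; that is, $\operatorname{Area}(u_0)\le\operatorname{Area}(v)$ for every such $v$.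
   Context: $D^2$ is the unit disk in $\mathbb{R}^2$, $\partial D^2=S^1$, and $S^1=\{(\cos t,\sin t):t\in[0,2\pi)\}$ is parametrized by the angle $t$. For every $\varepsilon>0$ the lifted curve $\gamma_\varepsilon$ is injective on $S^1$, hence a Jordan curve in $\mathbb{R}^4$. Area: $\operatorname{Area}(v)=\int_{D^2}J_v(x)\,d\mathcal{H}^2(x)$ with $J_v=\sqrt{\det(Dv^TDv)}$. Spanning and Douglas minimizers: a map $u:\overline{D^2}\to\mathbb{R}^4$, continuous on $\overline{D^2}$ and in $W^{1,2}(D^2)$, spans the Jordan curve given by $\gamma_\varepsilon$ if $u|_{\partial D^2}=\gamma_\varepsilon\circ\phi$ for some continuous, surjective, weakly monotone map $\phi:S^1\to S^1$. A Douglas minimizer spanning it is a spanning map $u$ that is harmonic and (weakly) conformal in $D^2$ and minimizes area among all spanning maps; equivalently it minimizes the Dirichlet energy $\mathscr{E}(u)=\frac12\int_{D^2}|\nabla u|^2$ among them. Three-point condition: three distinct points $e^{i\theta_1},e^{i\theta_2},e^{i\theta_3}\in\partial D^2$ and three distinct points $p_1,p_2,p_3\in S^1$ (in the same cyclic order) with $\gamma(p_1),\gamma(p_2),\gamma(p_3)$ distinct are fixed independently of $\varepsilon$, and $u_\varepsilon(e^{i\theta_k})=\gamma_\varepsilon(p_k)$ for $k=1,2,3$ and all $0<\varepsilon\le1$. *)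

(* Defs.v *)
From HB Require Import structures.
From mathcomp Require Import all_boot all_order all_algebra.
From mathcomp Require Import all_classical all_reals all_analysis.

Set Implicit Arguments.
Unset Strict Implicit.
Unset Printing Implicit Defensive.

Import Order.TTheory GRing.Theory Num.Theory.
Import numFieldTopology.Exports numFieldNormedType.Exports.

Local Open Scope classical_set_scope.
Local Open Scope ring_scope.

Section Disk.
Context {R : realType}.

Definition disk : set (R * R) := [set x | x.1 ^+ 2 + x.2 ^+ 2 < 1].
Definition cdisk : set (R * R) := [set x | x.1 ^+ 2 + x.2 ^+ 2 <= 1].
Definition circle : set (R * R) := [set x | x.1 ^+ 2 + x.2 ^+ 2 = 1].

Definition cis (t : R) : R * R := (cos t, sin t).

(* Two-dimensional Hausdorff measure on the plane is Lebesgue measure. *)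
Definition leb2 :=
  (@lebesgue_measure R \x @lebesgue_measure R)%E : {measure set _ -> \bar R}.

Definition dir (j : 'I_2) : R * R := if j == ord0 then (1, 0) else (0, 1).

Definition component n (u : R * R -> 'rV[R]_n) (i : 'I_n) : R * R -> R :=
  fun x => u x ord0 i.

Fixpoint Ck (k : nat) (U : set (R * R)) (f : R * R -> R) : Prop :=
  match k with
  | 0%N => forall x, U x -> {for x, continuous f}
  | k'.+1 => (forall x, U x -> {for x, continuous f}) /\
      forall j : 'I_2, (forall x, U x -> derivable f x (dir j)) /\
                       Ck k' U ('D_(dir j) f)
  end.

Definition test_function (h : R * R -> R) : Prop :=
  (forall k, Ck k setT h) /\
  exists K : set (R * R),
    [/\ compact K, K `<=` disk & forall x, ~ K x -> h x = 0].

Definition loc_integrable (f : R * R -> R) : Prop :=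
  @measurable_fun _ _ (measurableTypeR R * measurableTypeR R)%type R disk f /\
  forall K, compact K -> K `<=` disk -> leb2.-integrable K (EFin \o f).

Definition square_integrable (f : R * R -> R) : Prop :=
  @measurable_fun _ _ (measurableTypeR R * measurableTypeR R)%type R disk f /\
  (\int[leb2]_(x in disk) (f x ^+ 2)%:E < +oo)%E.

Definition weak_partial (j : 'I_2) (f g : R * R -> R) : Prop :=
  [/\ loc_integrable f, loc_integrable g &
    forall h, test_function h ->
      \int[leb2]_(x in disk) (f x * 'D_(dir j) h x) =
      - \int[leb2]_(x in disk) (g x * h x)].

Definition weak_differential (u : R * R -> 'rV[R]_4)
    (Du : R * R -> 'M[R]_(4, 2)) : Prop :=
  forall i j, weak_partial j (component u i) (fun x => Du x i j).

Definition W12 (u : R * R -> 'rV[R]_4) : Prop :=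
  (forall i, square_integrable (component u i)) /\
  exists2 Du, weak_differential u Du &
    forall i j, square_integrable (fun x => Du x i j).

Definition jacobian (A : 'M[R]_(4, 2)) : R := Num.sqrt (\det (A^T *m A)).

(* [Dv] is the weak differential; it is unique up to a null set, so the choice
   made by [get] is immaterial. Maps without one get area [+oo]. *)
Definition area (v : R * R -> 'rV[R]_4) : \bar R :=
  if `[< exists Dv, weak_differential v Dv >] then
    (\int[leb2]_(x in disk) (jacobian (get (weak_differential v) x))%:E)%E
  else +oo%E.

Definition harmonic (u : R * R -> 'rV[R]_4) : Prop :=
  forall i, Ck 2 disk (component u i) /\
    forall x, disk x ->
      \sum_(j < 2) 'D_(dir j) ('D_(dir j) (component u i)) x = 0.

Definition weakly_conformal (u : R * R -> 'rV[R]_4) : Prop :=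
  forall x, disk x ->
    let du j i := 'D_(dir j) (component u i) x in
    \sum_(i < 4) du ord0 i ^+ 2 = \sum_(i < 4) du ord_max i ^+ 2 /\
    \sum_(i < 4) du ord0 i * du ord_max i = 0.

(* [h] is a lift of [phi] to the angle coordinate: [cis (h t)] runs once
   around the circle without ever turning back; both orientations are allowed. *)
Definition weakly_monotone (phi : R * R -> R * R) : Prop :=
  exists h : R -> R,
    [/\ continuous h, forall t, phi (cis t) = cis (h t) &
      ({homo h : s t / s <= t} /\ forall t, h (t + 2 * pi) = h t + 2 * pi) \/
      ({homo h : s t / s <= t >-> t <= s} /\
       forall t, h (t + 2 * pi) = h t - 2 * pi)].

Definition spans (g u : R * R -> 'rV[R]_4) : Prop :=
  [/\ {within cdisk, continuous u}, W12 u &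
    exists phi : R * R -> R * R,
      [/\ {within circle, continuous phi}, phi @` circle = circle,
          weakly_monotone phi & forall x, circle x -> u x = g (phi x)]].

Definition douglas_minimizer (g u : R * R -> 'rV[R]_4) : Prop :=
  [/\ spans g u, harmonic u, weakly_conformal u &
    forall v, spans g v -> (area u <= area v)%E].

(* Curves on the circle are differentiated in the angle [t], as 2 pi-periodic
   functions on the line; only their values on [circle] matter. *)
Definition C1_closed_curve (g : R * R -> 'rV[R]_2) : Prop :=
  (forall t, derivable (g \o cis) t 1) /\ continuous (derive1 (g \o cis)).

(* In terms of [p = (cos t, sin t)], the lifted curve
   [(gamma t, eps cos t, eps sin t)] is [(gamma p, eps p.1, eps p.2)]. *)
Definition lift_curve (g : R * R -> 'rV[R]_2) (eps : R) (p : R * R) :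
    'rV[R]_4 :=
  row_mx (g p) (\row_(j < 2) (eps * if j == ord0 then p.1 else p.2)).

(* [a], [b], [c] are pairwise distinct points of [circle], met in this order when
   running around it counterclockwise. *)
Definition ccw (a b c : R * R) : Prop :=
  exists r s t : R,
    [/\ r < s, s < t, t < r + 2 * pi &
      [/\ a = cis r, b = cis s & c = cis t]].

Definition same_cyclic_order (a b c a' b' c' : R * R) : Prop :=
  (ccw a b c /\ ccw a' b' c') \/ (ccw a c b /\ ccw a' c' b').

End Disk.

(* Main.v *)
From HB Require Import structures.
Require Import Defs.
From mathcomp Require Import all_boot all_order all_algebra.
From mathcomp Require Import all_classical all_reals all_analysis.
From mathcomp Require Import measurable_realfun ring lra.
Import Order.TTheory GRing.Theory Num.Theory.
Import numFieldTopology.Exports numFieldNormedType.Exports.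

(** The limit is compared with a Lipschitz map [v] of the same boundary values by
    perturbing the minimizers [u_j = u (e j)] in the interior only, so that the
    boundary curves of different [j] never have to be compared with each other.

    Let [d] be small and [lam] a smooth cutoff equal to 1 near the circle, equal to 0
    in the core of the disk, and passing from 1 to 0 in a layer of thickness [d]. The
    glued map [lam u_j + (1 - lam) v] agrees with [u_j] near the circle, hence spans
    the same curve as [u_j] with the same boundary parametrization, and has at least
    the area of [u_j]. It agrees with [v] in the core, and J is at most half the
    squared norm of the differential, so that [layer_comparison] gives

      area of u_j over the core <= area v
        + C * integral over the layer of (|Dv|^2 + |Du_j|^2 + |u_j - v|^2 / d^2).

    First [j] tends to infinity with [d] fixed. The [u_j] are harmonic and converge
    uniformly; an interior gradient estimate ([gradient_bound]), proved with the
    maximum principle and an explicit barrier, shows that their differentials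
    converge pointwise and stay bounded on compact subsets of the disk. The limit is
    the weak differential of [u0] ([weak_partial_limit]), and the inequality passes to
    [u0] by dominated convergence.

    Then [d] tends to zero, and each of the three error terms vanishes.
    - [|Dv|] is bounded by the Lipschitz constant, and the layer shrinks to nothing.
    - [|Du0|^2] is integrable over the disk. For a conformal map the integral of the
      squared differential is twice the area. Multiplying the last two coordinates of
      [u 1] by [eps] produces a map that spans the curve of [u eps], so that the
      energies of all the [u eps] are at most that of [u 1] ([energy_le]); Fatou's lemma
      carries the bound to the limit.
    - [u0 - v] vanishes on the circle, so that integrating along lines that end on the
      circle bounds the integral of [|u0 - v|^2] over the layer by [d^2] times the
      integral of [|Du0|^2 + L^2] near the circle ([hardy_layer]); after
      division by [d^2] the integral of an integrable function over a shrinking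
      neighbourhood of the circle remains.

    The area is defined through an arbitrary weak differential. The fundamental lemma
    of the calculus of variations ([test_ae_le0], [test_ae_eq0]) makes this choice
    immaterial, and also shows that weak derivatives of a Lipschitz function are
    bounded by its Lipschitz constant. A map without a weak differential has infinite
    area, and there is nothing to prove for it. *)

Set Implicit Arguments.
Unset Strict Implicit.
Unset Printing Implicit Defensive.

Local Open Scope classical_set_scope.
Local Open Scope ring_scope.

Local Notation jac := Defs.jacobian.
Local Notation plane R := (measurableTypeR R * measurableTypeR R)%type.

(** * Measurability on the plane and the depth below the circle *)

Section Plane.
Context {R : realType}.
Implicit Types (A B D : set (R * R)) (f g : R * R -> R).

Lemma open_plane_measurable A : open A -> @measurable _ (plane R) A.
Proof.
move=> oA.
pose box (q : rat * rat * rat) : set (R * R) :=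
  [set x | ratr q.1.1 - ratr q.2 < x.1 < ratr q.1.1 + ratr q.2 /\
           ratr q.1.2 - ratr q.2 < x.2 < ratr q.1.2 + ratr q.2 ].
have mbox q : @measurable _ (plane R) (box q).
  rewrite (_ : box q = `]ratr q.1.1 - ratr q.2, ratr q.1.1 + ratr q.2[%classic `*`
    `]ratr q.1.2 - ratr q.2, ratr q.1.2 + ratr q.2[%classic); last first.
    by apply/seteqP; split => x; rewrite /box /= !in_itv /=.
  by apply: measurableX; exact: measurable_itv.
rewrite (_ : A = \bigcup_(q in [set q | box q `<=` A]) box q); last first.
  apply/seteqP; split => [x Ax|x [q /= qA]]; last exact: qA.
  have /nbhs_ballP[e /= e0 eA] : nbhs x A by exact: open_nbhs_nbhs.
  have e4 : (0 < e / 4) by rewrite divr_gt0.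
  have [r] : exists r, ratr r \in `]e / 4, e / 2[ by apply: rat_in_itvoo; lra.
  rewrite in_itv /= => /andP[r1 r2].
  have [p] : exists r, ratr r \in `]x.1 - e / 4, x.1 + e / 4[ by apply: rat_in_itvoo; lra.
  rewrite in_itv /= => /andP[p1 p2].
  have [q] : exists r, ratr r \in `]x.2 - e / 4, x.2 + e / 4[ by apply: rat_in_itvoo; lra.
  rewrite in_itv /= => /andP[q1 q2].
  exists (p, q, r) => /=; last by split => /=; lra.
  move=> y [/= y1 y2]; apply: eA; split; rewrite /ball /= ltr_norml; lra.
by rewrite bigcup_mkcond; apply: countable_bigcupT_measurable => // q; case: ifP.
Qed.

Lemma closed_plane_measurable A : closed A -> @measurable _ (plane R) A.
Proof.
by move=> cA; rewrite -[A]setCK; apply: measurableC; apply: open_plane_measurable;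
  exact: closed_openC.
Qed.

Lemma open_continuous_plane_measurable D f : open D ->
  (forall x, D x -> {for x, continuous f}) ->
  @measurable_fun _ _ (plane R) R D f.
Proof.
move=> oD cf; apply: (measurability _ (RGenOpens.measurableE R)).
move=> _ [_ [a [b ->] <-]]; apply: open_plane_measurable.
rewrite openE => x [Dx fx] /=.
apply: filterI; first exact: open_nbhs_nbhs.
by apply: (cf x Dx); apply: open_nbhs_nbhs; split => //; exact: interval_open.
Qed.

Lemma continuous_plane_measurable D f : continuous f ->
  @measurable _ (plane R) D -> @measurable_fun _ _ (plane R) R D f.
Proof.
move=> cf mD; apply: (@measurable_funS _ _ (plane R) _ setT) => //.
apply: (@open_continuous_plane_measurable setT); [exact: openT|by move=> x _; exact: cf].
Qed.

Lemma continuous_fst2 : continuous (fun x : R * R => x.1).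
Proof. by move=> x; exact: cvg_fst. Qed.

Lemma continuous_snd2 : continuous (fun x : R * R => x.2).
Proof. by move=> x; exact: cvg_snd. Qed.

(** A polynomial substitute for the distance to the circle, to which it is
    comparable: its sublevel sets serve as boundary layers. *)
Definition depth (x : R * R) : R := 1 - (x.1 ^+ 2 + x.2 ^+ 2).

Lemma continuous_depth : continuous depth.
Proof.
move=> x; rewrite /depth; apply: cvgB; first exact: cvg_cst.
by rewrite !expr2; apply: cvgD; apply: cvgM;
  do ?[exact: continuous_fst2|exact: continuous_snd2].
Qed.

Lemma diskE x : disk x <-> 0 < depth x.
Proof. by rewrite /disk /depth /= subr_gt0. Qed.

Lemma cdiskE x : cdisk x <-> 0 <= depth x.
Proof. by rewrite /cdisk /depth /= subr_ge0. Qed.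

Lemma circleE x : circle x <-> depth x = 0.
Proof.
rewrite /circle /depth /=; split => [->|/eqP]; first by rewrite subrr.
by rewrite subr_eq0 => /eqP ->.
Qed.

Lemma open_disk : open (disk : set (R * R)).
Proof.
rewrite (_ : disk = depth @^-1` [set x | 0 < x]); last first.
  by apply/seteqP; split => x /=; rewrite -/(disk x) => /diskE.
by apply: open_comp; [move=> x _; exact: continuous_depth|exact: open_gt].
Qed.

Lemma closed_depth_ge a : closed [set x | a <= depth x].
Proof.
rewrite (_ : [set _ | _] = depth @^-1` [set x | a <= x]) //.
by apply: closed_comp; [move=> x _; exact: continuous_depth|exact: closed_ge].
Qed.

Lemma measurable_disk : @measurable _ (plane R) disk.
Proof. by apply: open_plane_measurable; exact: open_disk. Qed.

Lemma measurable_depth D : @measurable _ (plane R) D ->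
  @measurable_fun _ _ (plane R) R D depth.
Proof. by move=> mD; apply: continuous_plane_measurable => //; exact: continuous_depth. Qed.

Lemma measurable_depth_ge a : @measurable _ (plane R) [set x | a <= depth x].
Proof. by apply: closed_plane_measurable; exact: closed_depth_ge. Qed.

Lemma depth_bounded x : 0 <= depth x -> `|x.1| <= 1 /\ `|x.2| <= 1.
Proof.
move=> /cdiskE xD; have := sqr_ge0 x.1; have := sqr_ge0 x.2.
rewrite /cdisk /= in xD => h1 h2.
split; rewrite -(@ler_pXn2r _ 2) ?nnegrE // ?real_normK ?num_real // expr1n; lra.
Qed.

Lemma leb2X (I J : set (measurableTypeR R)) : measurable I -> measurable J ->
  leb2 (I `*` J) = (lebesgue_measure I * lebesgue_measure J :> \bar R)%E.
Proof. by move=> mI mJ; exact: product_measure1E. Qed.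

Lemma leb2_cdisk_lty D : @measurable _ (plane R) D -> D `<=` cdisk ->
  (leb2 D < +oo :> \bar R)%E.
Proof.
move=> mD sD; apply: (@le_lt_trans _ _ (leb2 (`[-1, 1]%classic `*` `[-1, 1]%classic))).
  apply: le_measure; rewrite ?inE //.
    by apply: measurableX; exact: measurable_itv.
  move=> x /sD /cdiskE /depth_bounded[].
  by rewrite !ler_norml => h1 h2; split; rewrite /= in_itv.
rewrite leb2X; [|exact: measurable_itv|exact: measurable_itv].
by rewrite /= !lebesgue_measure_itv /= !lte_fin (_ : -1 < 1) -?EFinD -?EFinM ?ltry //; lra.
Qed.

Lemma bounded_integrable_plane D f M : @measurable _ (plane R) D -> D `<=` cdisk ->
  @measurable_fun _ _ (plane R) R D f -> (forall x, D x -> `|f x| <= M) ->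
  leb2.-integrable D (EFin \o f).
Proof.
move=> mD sD mf fM; apply: measurable_bounded_integrable => //.
  exact: leb2_cdisk_lty.
exists M; split; first exact: num_real.
by move=> y My x Dx; apply: le_trans (ltW My); exact: fM.
Qed.

Lemma compact_depth_ge a : 0 <= a -> compact [set x | a <= depth x].
Proof.
move=> a0; have cI : compact (`[-1, 1]%classic `*` `[-1, 1]%classic : set (R * R)).
  by apply: compact_setX; exact: segment_compact.
apply: (subclosed_compact _ cI).
- exact: closed_depth_ge.
- move=> x /= ax; have /depth_bounded[] := le_trans a0 ax.
  by rewrite !ler_norml => h1 h2; split; rewrite /= in_itv.
Qed.

(** The sets of given depth exhaust the disk by compact sets. *)
Lemma compact_sub_depth (K : set (R * R)) : compact K -> K `<=` disk ->
  exists2 a, 0 < a <= 1 & K `<=` [set x | a <= depth x].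
Proof.
move=> cK sK; have [->|/set0P K0] := eqVneq K set0.
  by exists 1 => //; rewrite ltr01 lexx.
have [c Kc cmin] : exists2 c, c \in K & forall t, t \in K -> depth c <= depth t.
  apply: compact_EVT_min => //.
  by apply: continuous_subspaceT; exact: continuous_depth.
exists (depth c); last by move=> x Kx /=; apply: cmin; rewrite inE.
rewrite inE in Kc; have /diskE -> /= := sK _ Kc.
by rewrite /depth lerBlDl lerDr addr_ge0 ?sqr_ge0.
Qed.

Lemma compact_plane_measurable (K : set (R * R)) : compact K ->
  @measurable _ (plane R) K.
Proof.
move=> cK; apply: closed_plane_measurable; exact: compact_closed.
Qed.

Lemma continuous_loc_integrable f :
  (forall x, disk x -> {for x, continuous f}) -> loc_integrable f.
Proof.
move=> cf; have mf : @measurable_fun _ _ (plane R) R disk f.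
  by apply: open_continuous_plane_measurable => //; exact: open_disk.
split => // K cK sK; have mK := compact_plane_measurable cK.
have : compact (f @` K).
  apply: (@continuous_compact _ _ f K) => //.
  by apply: continuous_in_subspaceT => x; rewrite inE => /sK /cf.
move=> /compact_bounded [M [_ /(_ (M + 1))]]; rewrite ltrDl ltr01 => /(_ isT) fM.
apply: (@bounded_integrable_plane _ _ (M + 1)) => //.
- by move=> x /sK; rewrite /disk /cdisk /=; exact: ltW.
- by apply: measurable_funS mf => //; exact: measurable_disk.
- by move=> x Kx; apply: fM; exists x.
Qed.

Definition shift2 (a : R * R) (x : R * R) : R * R := (x.1 + a.1, x.2 + a.2).

Lemma measurable_shift2 a : @measurable_fun _ _ (plane R) (plane R) setT (shift2 a).
Proof.
apply/measurable_fun_pairP; split.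
  rewrite (_ : _ \o _ = (fun x : plane R => x.1 + a.1)); last by apply/funext.
  exact: measurable_funD.
rewrite (_ : _ \o _ = (fun x : plane R => x.2 + a.2)); last by apply/funext.
exact: measurable_funD.
Qed.

Let lebesgue_shift (a : R) (A : set (measurableTypeR R)) : measurable A ->
  pushforward lebesgue_measure ((fun x => x + a) : measurableTypeR R -> measurableTypeR R) A = lebesgue_measure A.
Proof.
move=> mA; apply/esym/lebesgue_measure_unique => //.
  exact: measurable_funD.
move=> ? _ [[c d]] /= _ <-.
rewrite /pushforward (_ : _ @^-1` _ = `]c - a, d - a]%classic).
  rewrite !lebesgue_measure_itv /= !lte_fin ltrD2r; case: ifP => // _.
  by rewrite -!EFinD; congr EFin; lra.
by apply/seteqP; split => x /=; rewrite !in_itv /=; lra.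
Qed.

Lemma leb2_shift a (A : set (R * R)) : @measurable _ (plane R) A ->
  pushforward leb2 (shift2 a : plane R -> plane R) A = leb2 A.
Proof.
move=> mA; have ms := measurable_shift2 a; apply/esym/product_measure_unique => // B C mB mC.
transitivity (leb2 ([set x | B (x + a.1)] `*` [set x | C (x + a.2)])); first by [].
rewrite leb2X.
- by congr (_ * _)%E; exact: lebesgue_shift.
- rewrite -[X in measurable X]setTI. 
  have : @measurable_fun _ _ (measurableTypeR R) (measurableTypeR R) setT (fun x => x + a.1) by exact: measurable_funD.
  by apply.
- rewrite -[X in measurable X]setTI. 
  have : @measurable_fun _ _ (measurableTypeR R) (measurableTypeR R) setT (fun x => x + a.2) by exact: measurable_funD.
  by apply.
Qed.

Lemma integral_shift2 a (f : R * R -> \bar R) :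
  @measurable_fun _ _ (plane R) _ setT f -> 
  leb2.-integrable setT (f \o shift2 a) ->
  (\int[leb2]_x f (shift2 a x) = \int[leb2]_x f x)%E.
Proof.
move=> mf If.
have := @integral_pushforward _ _ (plane R) (plane R) R _ (measurable_shift2 a) leb2 setT f mf If measurableT.
rewrite preimage_setT => <-.
apply: eq_measure_integral => [|ms A mA _]; first exact: measurable_shift2.
exact: leb2_shift.
Qed.

End Plane.

(** * Directional derivatives and flat functions *)

Section Directional.
Context {R : realType}.
Implicit Types (f q : R * R -> R) (x v : R * R).

(** Directional derivatives are one-variable derivatives along a line, where the
    chain rule and the mean value theorem for functions of one variable apply. *)
Lemma is_derive_line f x v (t d : R) : is_derive (t *: v + x) v f d ->
  is_derive t 1 (fun h => f (h *: v + x)) d.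
Proof.
have E : (fun h => h^-1 *: ((f \o shift (t *: v + x)) (h *: v) - f (t *: v + x))) =
    (fun h => h^-1 *: (((fun h => f (h *: v + x)) \o shift t) (h *: 1) - f (t *: v + x))).
  apply/funext => h /=; congr (_ *: (f _ - _)).
  by rewrite addrA -scalerDl [h *: 1]mulr1.
move=> [fd fE]; split; first by move: fd; rewrite /derivable E.
by move: fE; rewrite /derive E.
Qed.

Lemma is_derive_line0 f x v (d : R) : is_derive (0 : R) 1 (fun h => f (h *: v + x)) d ->
  is_derive x v f d.
Proof.
have E : (fun h => h^-1 *: ((f \o shift x) (h *: v) - f x)) =
    (fun h => h^-1 *: (((fun h => f (h *: v + x)) \o shift 0) (h *: 1) - f (0 *: v + x))).
  apply/funext => h /=; congr (_ *: (f _ - f _)).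
    by rewrite addr0 [h *: 1]mulr1.
  by rewrite scale0r add0r.
move=> [fd fE]; split; first by move: fd; rewrite /derivable E.
by move: fE; rewrite /derive E.
Qed.

Lemma is_derive_comp1 (e : R -> R) q x v (d d' : R) :
  is_derive x v q d -> is_derive (q x) 1 e d' -> is_derive x v (e \o q) (d' * d).
Proof.
move=> qd ed; apply: is_derive_line0.
apply: (@is_derive1_comp _ e (fun h => q (h *: v + x))) => /=.
  by rewrite scale0r add0r.
by apply: is_derive_line; rewrite scale0r add0r.
Qed.

Lemma Ck_pred k (U : set (R * R)) f : Ck k.+1 U f -> Ck k U f.
Proof.
elim: k f => [f [] //|k IH f [cf df]]; split => // j.
by have [dj Cj] := df j; split => //; exact: IH.
Qed.

Definition smooth f := forall k, Ck k setT f.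

Lemma smooth_continuous f : smooth f -> continuous f.
Proof. by move=> /(_ 0%N) cf x; exact: cf. Qed.

Lemma smooth_derivable f x j : smooth f -> derivable f x (dir j).
Proof. by move=> /(_ 1%N)[_ /(_ j)[+ _]]; exact. Qed.

Lemma smooth_is_derive f x j : smooth f -> is_derive x (dir j) f ('D_(dir j) f x).
Proof. by move=> /smooth_derivable sf; exact/derivableP. Qed.

Lemma smooth_derive f j : smooth f -> smooth ('D_(dir j) f).
Proof. by move=> sf k; have /(_ j)[] := (sf k.+1).2. Qed.

Lemma Ck_cst k (c : R) : Ck k setT (cst c : R * R -> R).
Proof.
elim: k c => [|k IH] c /=; first by move=> x _; exact: cst_continuous.
split => [x _|j]; first exact: cst_continuous.
split => [x _|]; first exact: derivable_cst.
rewrite (_ : 'D_(dir j) _ = cst 0); first exact: IH.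
by apply/funext => x; exact: derive_cst.
Qed.

Lemma Ck_add k f g : Ck k setT f -> Ck k setT g -> Ck k setT (f \+ g).
Proof.
elim: k f g => [|k IH] f g /=.
  by move=> cf cg x _; apply: continuousD; [exact: cf|exact: cg].
move=> [cf df] [cg dg]; split => [x _|j].
  by apply: continuousD; [exact: cf|exact: cg].
have [dfj Cf] := df j; have [dgj Cg] := dg j.
split => [x _|]; first by apply: derivableD; [exact: dfj|exact: dgj].
rewrite (_ : 'D_(dir j) _ = 'D_(dir j) f \+ 'D_(dir j) g); first exact: IH.
by apply/funext => x; apply: deriveD; [exact: dfj|exact: dgj].
Qed.

Lemma Ck_mul k f g : Ck k setT f -> Ck k setT g -> Ck k setT (f \* g).
Proof.
elim: k f g => [|k IH] f g /=.
  by move=> cf cg x _; apply: continuousM; [exact: cf|exact: cg].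
move=> [cf df] [cg dg]; split => [x _|j].
  by apply: continuousM; [exact: cf|exact: cg].
have [dfj Cf] := df j; have [dgj Cg] := dg j.
split => [x _|]; first by apply: derivableM; [exact: dfj|exact: dgj].
rewrite (_ : 'D_(dir j) _ = (f \* 'D_(dir j) g) \+ (g \* 'D_(dir j) f)).
  by apply: Ck_add; apply: IH => //; apply: Ck_pred; split.
by apply/funext => x; apply: deriveM; [exact: dfj|exact: dgj].
Qed.

Lemma smooth_cst (c : R) : smooth (cst c). Proof. by move=> k; exact: Ck_cst. Qed.

Lemma smoothD f g : smooth f -> smooth g -> smooth (f \+ g).
Proof. by move=> sf sg k; exact: Ck_add. Qed.

Lemma smoothM f g : smooth f -> smooth g -> smooth (f \* g).
Proof. by move=> sf sg k; exact: Ck_mul. Qed.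

Lemma smoothN f : smooth f -> smooth (\- f).
Proof.
move=> sf; rewrite (_ : \- f = cst (-1) \* f); last by apply/funext => x /=; rewrite mulN1r.
by apply: smoothM => //; exact: smooth_cst.
Qed.

Lemma smoothX f n : smooth f -> smooth (fun x => f x ^+ n).
Proof.
move=> sf; elim: n => [|n IH]; first exact: (smooth_cst 1).
rewrite (_ : (fun _ => _) = f \* (fun x => f x ^+ n)); first exact: smoothM.
by apply/funext => x; rewrite exprS.
Qed.

(** Needed to normalize cutoffs: the derivative of an inverse is again a product of
    inverses and derivatives of the function, and induction on the order applies. *)
Lemma smoothV f : (forall x, f x != 0) -> smooth f -> smooth (fun x => (f x)^-1).
Proof.
move=> f0 sf; have cV : continuous (fun x => (f x)^-1).
  by move=> x; apply: cvgV => //; exact: smooth_continuous.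
elim=> [|k IH] /=; first by move=> x _; exact: cV.
split => [x _|j]; first exact: cV.
split => [x _|]; first by apply: derivableV => //; exact: smooth_derivable.
rewrite (_ : 'D_(dir j) _ = \- 'D_(dir j) f \* ((fun x => (f x)^-1) \* (fun x => (f x)^-1))).
  by apply: Ck_mul; [exact/smoothN/smooth_derive|exact: Ck_mul].
apply/funext => x /=; rewrite deriveV //; last exact: smooth_derivable.
by rewrite scaleNr mulNr mulrC; congr (- (_ * _)); rewrite expr2 invfM.
Qed.

Lemma is_derive_fst x v : is_derive x v (fst : R * R -> R) v.1.
Proof.
apply: is_derive_line0.
rewrite (_ : (fun _ => _) = (fun h => v.1 * h + x.1)); last first.
  by apply/funext => h /=; rewrite mulrC.
by apply: is_derive_eq; rewrite /= addr0 [v.1 *: _]mulr1.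
Qed.

Lemma is_derive_snd x v : is_derive x v (snd : R * R -> R) v.2.
Proof.
apply: is_derive_line0.
rewrite (_ : (fun _ => _) = (fun h => v.2 * h + x.2)); last first.
  by apply/funext => h /=; rewrite mulrC.
by apply: is_derive_eq; rewrite /= addr0 [v.2 *: _]mulr1.
Qed.

Lemma smooth_fst : smooth fst.
Proof.
case=> [|k] /=; first by move=> x _; exact: continuous_fst2.
split => [x _|j]; first exact: continuous_fst2.
split => [x _|]; first by have [] := is_derive_fst x (dir j).
rewrite (_ : 'D_(dir j) _ = cst (dir j).1); first exact: Ck_cst.
by apply/funext => x; have [] := is_derive_fst x (dir j).
Qed.

Lemma smooth_snd : smooth snd.
Proof.
case=> [|k] /=; first by move=> x _; exact: continuous_snd2.
split => [x _|j]; first exact: continuous_snd2.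
split => [x _|]; first by have [] := is_derive_snd x (dir j).
rewrite (_ : 'D_(dir j) _ = cst (dir j).2); first exact: Ck_cst.
by apply/funext => x; have [] := is_derive_snd x (dir j).
Qed.

Lemma smooth_depth : smooth depth.
Proof.
rewrite (_ : depth = cst 1 \+ \- ((fun x => x.1 ^+ 2) \+ (fun x => x.2 ^+ 2))) //.
apply: smoothD; first exact: smooth_cst.
by apply/smoothN/smoothD; apply: smoothX; [exact: smooth_fst|exact: smooth_snd].
Qed.

End Directional.

Section Flat.
Context {R : realType}.
Implicit Types (p : {poly R}) (x : R).

(** The functions p(1/x) exp(-1/x), extended by zero to the left: a family closed
    under differentiation, which makes all of them smooth at once. *)
Definition flat p x := if 0 < x then p.[x^-1] * expR (- x^-1) else 0.

Definition flat_deriv p := (p - p^`()) * 'X^2.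

(** The exponential beats every power; with one power of [y] to spare this makes
    [flat p] vanish to first order at 0. *)
Let horner_expN_bounded p n : exists C : R, forall y : R, 0 < y ->
  y ^+ n * `|p.[y]| * expR (- y) <= C.
Proof.
elim/poly_ind: p n => [|p c IH] n.
  by exists 0 => y y0; rewrite horner0 normr0 mulr0 mul0r.
have [C hC] := IH n.+1.
have mono m : exists D : R, forall y : R, 0 < y -> y ^+ m * expR (- y) <= D.
  exists (m`!%:R) => y y0; rewrite expRN ler_pdivrMr ?expR_gt0 //.
  case: m => [|m]; first by rewrite fact0 mul1r expr0 ltW // expR_gt1.
  rewrite mulrC -ler_pdivrMr ?ltr0n ?fact_gt0 //.
  by apply: le_trans (expR_ge1Dxn m (ltW y0)); rewrite lerDr.
have [D hD] := mono n.
exists (C + `|c| * D) => y y0.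
have h1 := hC y y0; have h2 := hD y y0.
rewrite !hornerE.
apply: (@le_trans _ _ (y ^+ n.+1 * `|p.[y]| * expR (- y) + `|c| * (y ^+ n * expR (- y)))).
  rewrite (_ : _ + _ = y ^+ n * (`|p.[y]| * y + `|c|) * expR (- y)); last by rewrite exprS; ring.
  apply: ler_wpM2r; first exact: expR_ge0.
  apply: ler_wpM2l; first by rewrite exprn_ge0 // ltW.
  by apply: (le_trans (ler_normD _ _)); rewrite normrM (gtr0_norm y0).
by apply: lerD => //; apply: ler_wpM2l.
Qed.

Let flat_le p : exists2 C, 0 < C & forall x, `|flat p x| <= C * `|x|.
Proof.
have [C hC] := horner_expN_bounded p 1.
exists (`|C| + 1) => [|x]; first by rewrite ltr_wpDl.
rewrite /flat; case: ifPn => x0; last by rewrite normr0 mulr_ge0 // addr_ge0.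
rewrite normrM (gtr0_norm (expR_gt0 _)) (gtr0_norm x0).
have x1 : 0 < x^-1 by rewrite invr_gt0.
have := hC _ x1; rewrite expr1 -mulrA -ler_pdivlMl // invrK => /le_trans; apply.
rewrite mulrC; apply: ler_wpM2r; first exact: ltW.
by apply: (le_trans (ler_norm _)); rewrite lerDl.
Qed.

Lemma is_derive_flat p x : is_derive x 1 (flat p) (flat (flat_deriv p) x).
Proof.
have [x0|x0|->] := ltgtP x 0.
- rewrite {2}/flat ltNge (ltW x0) /=.
  have D0 : is_derive x 1 (cst 0 : R -> R) (0 : R) by exact: is_derive_cst.
  apply: (near_eq_is_derive _ D0).
  have : \forall y \near x, y < 0 by exact: lt_nbhsl.
  apply: filterS => y y0; rewrite /flat ltNge (ltW y0) //.
- rewrite {2}/flat x0.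
  have xn0 : x != 0 by rewrite gt_eqF.
  have dV : is_derive x 1 (fun y : R => y^-1) (- x ^- 2).
    split; first by apply: derivableV => //; exact: derivable_id.
    by rewrite deriveV // derive_id [_ *: 1]mulr1.
  have d1 : is_derive x 1 (fun y => p.[y^-1]) (p^`().[x^-1] * - x ^- 2).
    apply: (@is_derive1_comp _ (horner p) (fun y => y^-1)).
  have d2 : is_derive x 1 (fun y => expR (- y^-1)) (expR (- x^-1) * x ^- 2).
    apply: (@is_derive1_comp _ expR (fun y => - y^-1)).
    by apply: is_derive_eq; rewrite opprK.
  have D0 : is_derive x 1 (fun y => p.[y^-1] * expR (- y^-1))
      ((flat_deriv p).[x^-1] * expR (- x^-1)).
    apply: is_derive_eq; rewrite /flat_deriv.
    rewrite !hornerE /= -[_ *: (expR _ * _)]/(_ * _) -[_ *: (_ * - _)]/(_ * _).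
    by field.
  apply: (near_eq_is_derive _ D0).
  have : \forall y \near x, 0 < y by exact: lt_nbhsr.
  by apply: filterS => y y0; rewrite /flat y0.
- rewrite {2}/flat ltxx.
  (* The difference quotient of [flat p] at 0 is [flat (p * 'X)], which is O(x). *)
  have [C C0 hC] := flat_le (p * 'X).
  have L : (fun h : R => h^-1 *: ((flat p \o shift 0) (h *: 1) - flat p 0)) @ 0^' --> (0 : R).
    rewrite (_ : (fun _ => _) = flat (p * 'X)); last first.
      apply/funext => h /=; rewrite addr0 [h *: 1]mulr1 {2}/flat ltxx subr0 /flat.
      case: ifP => _; rewrite ?scaler0 // hornerMX.
      by rewrite -[LHS]/(_ * _) mulrC mulrAC.
    apply/cvgr0Pnorm_le => e e0 /=.
    have : \forall h \near (0 : R)^', `|h| < e / C.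
      by apply: dnbhs0_lt; rewrite divr_gt0.
    apply: filterS => h he; apply: (le_trans (hC h)).
    by rewrite mulrC -ler_pdivlMr // ltW.
  split; first by apply/cvg_ex; exists 0.
  exact: cvg_lim.
Qed.

Lemma flat_continuous p : continuous (flat p).
Proof.
move=> x; have [+ _] := is_derive_flat p x.
by move/derivable1_diffP/differentiable_continuous.
Qed.

Lemma smooth_flat p (q : R * R -> R) : smooth q -> smooth (flat p \o q).
Proof.
move=> sq k; elim: k p => [|k IH] p /=.
  by move=> x _; apply: continuous_comp; [exact: smooth_continuous|exact: flat_continuous].
split => [x _|j].
  by apply: continuous_comp; [exact: smooth_continuous|exact: flat_continuous].
have D (z : R * R) : is_derive z (dir j) (flat p \o q) (flat (flat_deriv p) (q z) * 'D_(dir j) q z).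
  by apply: is_derive_comp1; [exact: smooth_is_derive|exact: is_derive_flat].
split => [x _|]; first by have [] := D x.
rewrite (_ : 'D_(dir j) _ = (flat (flat_deriv p) \o q) \* 'D_(dir j) q).
  by apply: Ck_mul; [exact: IH|exact: smooth_derive].
by apply/funext => x; have [] := D x.
Qed.

Definition flat1 := flat 1.

Lemma flat1_gt0 x : (0 < flat1 x) = (0 < x).
Proof. by rewrite /flat1 /flat; case: ifP; rewrite ?ltxx // hornerE mul1r expR_gt0. Qed.

Lemma flat1_le0 x : x <= 0 -> flat1 x = 0.
Proof. by rewrite /flat1 /flat leNgt => /negbTE ->. Qed.

Lemma flat1_ge0 x : 0 <= flat1 x.
Proof. by rewrite /flat1 /flat; case: ifP => // _; rewrite hornerE mul1r expR_ge0. Qed.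

Lemma flat1_lt1 x : flat1 x < 1.
Proof.
rewrite /flat1 /flat; case: ifP => // x0; rewrite hornerE mul1r expR_lt1.
by rewrite oppr_lt0 invr_gt0.
Qed.

End Flat.

(** * Fundamental lemma of the calculus of variations *)

Section Line.
Context {R : realType}.
Local Notation mu := (@lebesgue_measure R).

Lemma rat_between (a b : R) : a < b -> exists q : rat, a < ratr q < b.
Proof. by move=> /rat_in_itvoo[q]; rewrite in_itv /= => h; exists q. Qed.

(** Lebesgue points see intervals with rational endpoints; there are only countably
    many of these, which is what an argument by almost every slice needs. *)
Lemma ae_le0_rat_intervals (g : R -> R) : locally_integrable setT g ->
  (forall p q : rat, (\int[mu]_(x in `]ratr p, ratr q[) (g x)%:E <= 0)%E) ->
  {ae mu, forall x, g x <= 0}.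
Proof.
move=> lg gle; have := lebesgue_differentiation lg.
apply: filter_app; first exact: (ae_filter_ringOfSetsType mu).
apply: aeW => /= x gx.
have hp (y : R) (n : nat) : exists p : rat, y - n.+1%:R^-1 < ratr p < y - n.+1%:R^-1 / 2.
  apply: rat_between; rewrite ltrD2l ltrN2 ltr_pdivrMr // ltr_pMr ?invr_gt0 //.
  by rewrite ltr1n.
have hq (y : R) (n : nat) : exists p : rat, y + n.+1%:R^-1 / 2 < ratr p < y + n.+1%:R^-1.
  apply: rat_between; rewrite ltrD2l ltr_pdivrMr // ltr_pMr ?invr_gt0 //.
  by rewrite ltr1n.
pose P y n := sval (cid (hp y n)); pose Q y n := sval (cid (hq y n)).
have PE (y : R) n : y - n.+1%:R^-1 < ratr (P y n) < y - n.+1%:R^-1 / 2.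
  by rewrite /P; case: cid.
have QE (y : R) n : y + n.+1%:R^-1 / 2 < ratr (Q y n) < y + n.+1%:R^-1.
  by rewrite /Q; case: cid.
pose E (y : R) (n : nat) : set R := `]ratr (P y n), ratr (Q y n)[%classic.
have hE y : nicely_shrinking y (E y).
  split => [n|]; first exact: measurable_itv.
  exists (2, fun n => n.+1%:R^-1%:pos%R); split => //=.
  - exact: cvg_harmonic.
  - move=> n z; rewrite /E /= in_itv /= /ball /= => /andP[z1 z2].
    have /andP[p1 p2] := PE y n; have /andP[q1 q2] := QE y n.
    by rewrite ltr_distlC (lt_trans p1 z1) (lt_trans z2 q2).
  - move=> n; rewrite lebesgue_measure_ball ?invr_ge0 // /E lebesgue_measure_itv /=.
    have /andP[p1 p2] := PE y n; have /andP[q1 q2] := QE y n.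
    have n0 : 0 < n.+1%:R^-1 :> R by rewrite invr_gt0.
    move: (ratr _ : R) (ratr _ : R) (n.+1%:R^-1 : R) p1 p2 q1 q2 n0 => p q e p1 p2 q1 q2 e0.
    rewrite lte_fin ifT; last by lra.
    by rewrite -EFinD -EFinM lee_fin; lra.
have := nice_lebesgue_differentiation hE lg gx.
rewrite -lee_fin => /(cvg_lim (@ereal_hausdorff R)) <-.
apply: lime_le.
  by apply/cvg_ex; exists (g x)%:E; exact: (nice_lebesgue_differentiation hE lg gx).
apply: nearW => n; apply: mule_ge0_le0; first by rewrite inve_ge0.
exact: gle.
Qed.

End Line.

Section FundamentalLemma.
Context {R : realType}.
Local Notation mu := (@lebesgue_measure R).

Definition obox (a b c d : R) : set (R * R) := `]a, b[%classic `*` `]c, d[%classic.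
Definition cbox (a b c d : R) : set (R * R) := `[a, b]%classic `*` `[c, d]%classic.

Lemma measurable_obox a b c d : @measurable _ (plane R) (obox a b c d).
Proof. by apply: measurableX; exact: measurable_itv. Qed.

Lemma measurable_cbox a b c d : @measurable _ (plane R) (cbox a b c d).
Proof. by apply: measurableX; exact: measurable_itv. Qed.

Lemma compact_cbox a b c d : compact (cbox a b c d).
Proof. by apply: compact_setX; exact: segment_compact. Qed.

Lemma sub_obox_cbox a b c d : obox a b c d `<=` cbox a b c d.
Proof.
move=> x [/=]; rewrite !in_itv /= => /andP[h1 h2] /andP[h3 h4].
by split; rewrite /= in_itv /=; apply/andP; split; exact: ltW.
Qed.

Definition bump (a b c d : R) (x : R * R) : R :=
  flat1 (x.1 - a) * flat1 (b - x.1) * (flat1 (x.2 - c) * flat1 (d - x.2)).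

(** The powers of [1 - bump] tend to zero exactly where the bump is positive; hence
    these test functions tend to the indicator of the open box. *)
Definition box_test (a b c d : R) (n : nat) (x : R * R) : R :=
  1 - (1 - bump a b c d x) ^+ n.

Lemma bump_bounds a b c d x : 0 <= bump a b c d x < 1.
Proof.
have h z := @flat1_ge0 R z; have k z := @flat1_lt1 R z.
by rewrite !mulr_ge0 //= !mulr_ilt1 // mulr_ge0.
Qed.

Lemma bump_gt0 a b c d x : obox a b c d x -> 0 < bump a b c d x.
Proof.
move=> [/=]; rewrite !in_itv /= => /andP[h1 h2] /andP[h3 h4].
by rewrite /bump !mulr_gt0 // flat1_gt0 subr_gt0.
Qed.

Lemma bump_eq0 a b c d x : ~ obox a b c d x -> bump a b c d x = 0.
Proof.
move=> xO; rewrite /bump.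
have [h1|h1] := leP x.1 a; first by rewrite flat1_le0 ?subr_le0 // !mul0r.
have [h2|h2] := leP b x.1; first by rewrite (@flat1_le0 _ (b - _)) ?subr_le0 // mulr0 mul0r.
have [h3|h3] := leP x.2 c; first by rewrite (@flat1_le0 _ (x.2 - _)) ?subr_le0 // mul0r mulr0.
have [h4|h4] := leP d x.2; first by rewrite (@flat1_le0 _ (d - _)) ?subr_le0 // !mulr0.
by exfalso; apply: xO; split; rewrite /= in_itv /=; apply/andP.
Qed.

Lemma smooth_bump a b c d : smooth (bump a b c d).
Proof.
have s1 (t : R) : smooth (fun x : R * R => flat1 (x.1 - t)).
  by apply: smooth_flat; apply: smoothD; [exact: smooth_fst|exact: smooth_cst].
have s2 (t : R) : smooth (fun x : R * R => flat1 (t - x.1)).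
  by apply: smooth_flat; apply: smoothD; [exact: smooth_cst|exact/smoothN/smooth_fst].
have s3 (t : R) : smooth (fun x : R * R => flat1 (x.2 - t)).
  by apply: smooth_flat; apply: smoothD; [exact: smooth_snd|exact: smooth_cst].
have s4 (t : R) : smooth (fun x : R * R => flat1 (t - x.2)).
  by apply: smooth_flat; apply: smoothD; [exact: smooth_cst|exact/smoothN/smooth_snd].
by apply: smoothM; apply: smoothM.
Qed.

Lemma box_test_bounds a b c d n x : 0 <= box_test a b c d n x <= 1.
Proof.
have /andP[h1 h2] := bump_bounds a b c d x.
rewrite /box_test subr_ge0 lerBlDr lerDl exprn_ge0 ?exprn_ile1 //; lra.
Qed.

Lemma box_test_eq0 a b c d n x : ~ obox a b c d x -> box_test a b c d n x = 0.
Proof. by move=> /bump_eq0; rewrite /box_test => ->; rewrite subr0 expr1n subrr. Qed.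

Lemma box_test_cvg a b c d x :
  box_test a b c d n x @[n --> \oo] --> (\1_(obox a b c d) x : R).
Proof.
rewrite indicE; have [|xO] := boolP (x \in obox a b c d).
  rewrite inE => /bump_gt0 h1; have /andP[_ h2] := bump_bounds a b c d x.
  rewrite /box_test -[X in _ --> X]subr0; apply: cvgB; first exact: cvg_cst.
  by apply: cvg_expr; rewrite ger0_norm; lra.
rewrite (_ : (fun n => _) = cst 0); first exact: cvg_cst.
by apply/funext => n; apply: box_test_eq0; move: xO; rewrite notin_setE.
Qed.

Lemma test_box_test a b c d n : cbox a b c d `<=` disk ->
  test_function (box_test a b c d n).
Proof.
move=> sD; split.
  apply: smoothD; first exact: smooth_cst.
  apply/smoothN/smoothX/smoothD; first exact: smooth_cst.
  exact/smoothN/smooth_bump.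
exists (cbox a b c d); split => //; first exact: compact_cbox.
move=> x xC; apply: box_test_eq0; apply: contra_not xC; exact: sub_obox_cbox.
Qed.

End FundamentalLemma.

Section TestFunctions.
Context {R : realType}.
Local Notation mu := (@lebesgue_measure R).
Implicit Types F : R * R -> R.

Lemma ae_imp2 d (T : measurableType d) (m : {measure set T -> \bar R}) (P Q S : T -> Prop) :
  (forall x, P x -> Q x -> S x) ->
  {ae m, forall x, P x} -> {ae m, forall x, Q x} -> {ae m, forall x, S x}.
Proof. by move=> PQS; apply: filterS2. Qed.

Lemma ae_imp d (T : measurableType d) (m : {measure set T -> \bar R}) (P S : T -> Prop) :
  (forall x, P x -> S x) -> {ae m, forall x, P x} -> {ae m, forall x, S x}.
Proof. by move=> PS; apply: filterS. Qed.

Lemma integral_support d (T : measurableType d) (m : {measure set T -> \bar R})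
  (D E : set T) (f : T -> \bar R) : E `<=` D -> (forall x, D x -> ~ E x -> f x = 0%E) ->
  (\int[m]_(x in D) f x = \int[m]_(x in E) f x)%E.
Proof.
move=> ED f0; rewrite integral_mkcond [RHS]integral_mkcond.
apply: eq_integral => x _; rewrite !patchE.
have [xE|xE] := boolP (x \in E); first by rewrite mem_set //; apply: ED; rewrite inE in xE.
by case: ifPn => // xD; apply: f0; [rewrite inE in xD|rewrite notin_setE in xE].
Qed.

Lemma integrable_mul_bounded d (T : measurableType d) (m : {measure set T -> \bar R})
  (D : set T) (f g : T -> R) (M : R) : measurable D -> m.-integrable D (EFin \o f) ->
  measurable_fun D g -> (forall x, D x -> `|g x| <= M) ->
  m.-integrable D (EFin \o (fun x => f x * g x)).
Proof.
move=> mD If mg gM.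
have mf : measurable_fun D f by apply/measurable_EFinP; exact: measurable_int If.
apply: (@le_integrable _ _ _ m D mD _ (fun x => M%:E * (f x)%:E)%E).
- by apply/measurable_EFinP; exact: measurable_funM.
- move=> x Dx; rewrite /= lee_fin !normrM mulrC ler_wpM2r //.
  by apply: (le_trans (gM x Dx)); exact: ler_norm.
- exact: integrableZl.
Qed.

Lemma test_continuous h : test_function h -> continuous (h : R * R -> R).
Proof. by move=> [/smooth_continuous]. Qed.

Lemma test_bounded h : test_function h -> exists M : R, forall x : R * R, `|h x| <= M.
Proof.
move=> th; have [_ [K [cK _ h0]]] := th.
have : compact (h @` K).
  apply: (@continuous_compact _ _ h K) => //.
  by apply: continuous_subspaceT; exact: test_continuous.
move=> /compact_bounded [M [_ /(_ (M + 1))]]; rewrite ltrDl ltr01 => /(_ isT) hM.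
exists `|M + 1| => x; have [Kx|Kx] := pselect (K x).
  by apply: le_trans (ler_norm _); apply: hM; exists x.
by rewrite h0 // normr0.
Qed.

Lemma test_measurable h D : test_function h -> @measurable _ (plane R) D ->
  @measurable_fun _ _ (plane R) R D h.
Proof. by move=> /test_continuous ch; exact: continuous_plane_measurable. Qed.

Lemma loc_integrable_test F h : loc_integrable F -> test_function h ->
  leb2.-integrable disk (EFin \o (fun x => F x * h x)).
Proof.
move=> [mF lF] th; have [M hM] := test_bounded th.
have [_ [K [cK Kd h0]]] := th.
have mK := compact_plane_measurable cK.
have IK : leb2.-integrable K (EFin \o (fun x => F x * h x)).
  apply: (@integrable_mul_bounded _ (plane R) leb2 K F h M) => //; first exact: lF.
  exact: test_measurable.
have m1 : @measurable_fun _ _ (plane R) _ disk (EFin \o (fun x => F x * h x)).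
  apply/measurable_EFinP; apply: measurable_funM => //.
  by apply: test_measurable => //; exact: measurable_disk.
apply/integrableP; split => //.
move/integrableP: IK => [_]; congr (_ < _)%E; apply/esym.
by apply: integral_support => // x _ /h0 /= ->; rewrite mulr0 normr0.
Qed.

Lemma test_box_le0 F a b c d : loc_integrable F ->
  (forall h, test_function h -> (forall x, 0 <= h x) ->
     \int[leb2]_(x in disk) (F x * h x) <= 0) ->
  cbox a b c d `<=` disk ->
  (\int[leb2]_(x in obox a b c d) (F x)%:E <= 0)%E.
Proof.
move=> lF Fh sD; have [mF IF] := lF.
have IK := IF _ (@compact_cbox _ a b c d) sD.
have mK := @measurable_cbox R a b c d.
pose h := @box_test R a b c d.
have th n : test_function (h n) by exact: test_box_test.
have mFK : @measurable_fun _ _ (plane R) R (cbox a b c d) F.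
  by apply/measurable_EFinP; exact: measurable_int IK.
have -> : (\int[leb2]_(x in obox a b c d) (F x)%:E =
    \int[leb2]_(x in cbox a b c d) (F x * \1_(obox a b c d) x)%:E)%E.
  apply/esym; rewrite (@integral_support _ (plane R) leb2 _ (obox a b c d)).
  - by apply: eq_integral => x xO; rewrite indicE xO mulr1.
  - exact: sub_obox_cbox.
  - by move=> x _ xO; rewrite indicE memNset // mulr0.
have m1 n : @measurable_fun _ _ (plane R) _ (cbox a b c d) (fun x => (F x * h n x)%:E).
  by apply/measurable_EFinP; apply: measurable_funM => //; exact: test_measurable.
have m2 : @measurable_fun _ _ (plane R) _ (cbox a b c d) (fun x => (F x * \1_(obox a b c d) x)%:E).
  apply/measurable_EFinP; apply: measurable_funM => //.
  by apply: measurable_indic; exact: measurable_obox.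
have cvF : {ae leb2, forall x, cbox a b c d x ->
    (F x * h n x)%:E @[n --> \oo] --> (F x * \1_(obox a b c d) x)%:E}.
  apply: aeW => x _; apply/cvg_EFin; first exact: nearW.
  by apply: cvgM; [exact: cvg_cst|exact: box_test_cvg].
have Fdom : {ae leb2, forall x n, cbox a b c d x -> (`|(F x * h n x)%:E| <= `|(F x)%:E|)%E}.
  apply: aeW => x n _; rewrite lee_fin normrM ler_piMr //.
  by have /andP[h0 h1] := box_test_bounds a b c d n x; rewrite ger0_norm.
have [_ _ cv] := @dominated_convergence _ (plane R) R leb2 (cbox a b c d) mK
  _ _ _ m1 m2 cvF (integrable_abse IK) Fdom.
have Hn n : (\int[leb2]_(x in cbox a b c d) (F x * h n x)%:E <= 0)%E.
  have := Fh _ (th n) (fun x => (andP (box_test_bounds a b c d n x)).1).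
  rewrite /Rintegral (@integral_support _ (plane R) leb2 _ (cbox a b c d)) //; last first.
    move=> x _ xC; rewrite /h box_test_eq0 ?mulr0 //.
    by apply: contra_not xC; exact: sub_obox_cbox.
  rewrite -lee_fin fineK //; apply: integrable_fin_num => //.
  apply: integrableS (loc_integrable_test lF (th n)) => //; exact: measurable_disk.
rewrite -(cvg_lim (@ereal_hausdorff R) cv).
by apply: lime_le; [apply/cvg_ex; eexists; exact: cv|exact: nearW].
Qed.

Lemma ae_forall_countable d (T : measurableType d) (m : {measure set T -> \bar R})
  (I : countType) (P : I -> T -> Prop) :
  (forall i, {ae m, forall x, P i x}) -> {ae m, forall x, forall i, P i x}.
Proof.
move=> aeP; have : {ae m, forall x, forall n : nat, if unpickle n is Some i then P i x else True}.
  apply: ae_foralln => n; case: (unpickle n) => [i|]; first exact: aeP.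
  exact: aeW.
by apply: filterS => x Px i; have := Px (pickle i); rewrite pickleK.
Qed.

(** For almost every [x] the integrals of [f (x, -)] over all rational intervals are
    nonpositive: apply the one-dimensional statement to the partial integrals of [f].
    Then apply it once more, on each such slice. *)
Lemma ae_le0_rat_boxes (f : R * R -> R) : leb2.-integrable setT (EFin \o f) ->
  (forall p q r s : rat,
    (\int[leb2]_(x in obox (ratr p) (ratr q) (ratr r) (ratr s)) (f x)%:E <= 0)%E) ->
  {ae leb2, forall x, f x <= 0}.
Proof.
move=> If fle.
have mf : @measurable_fun _ _ (plane R) R setT f.
  by apply/measurable_EFinP; exact: measurable_int If.
pose Phi (r s : rat) (x : R) : \bar R := (\int[mu]_(y in `]ratr r, ratr s[) (f (x, y))%:E)%E.
pose strip (r s : rat) : set (R * R) := setT `*` `]ratr r, ratr s[%classic.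
have mstrip r s : @measurable _ (plane R) (strip r s).
  by apply: measurableX => //; exact: measurable_itv.
have PhiE r s : Phi r s = fubini_F mu ((EFin \o f) \_ (strip r s)).
  apply/funext => x; rewrite /Phi /fubini_F [LHS]integral_mkcond.
  by apply: eq_integral => y _; rewrite !patchE /strip in_setX in_setT.
have Istrip r s : leb2.-integrable setT ((EFin \o f) \_ (strip r s)).
  apply/integrable_restrict => //; rewrite setTI.
  exact: integrableS If.
have IPhi r s : mu.-integrable setT (Phi r s).
  by rewrite PhiE; exact: integrable_fubini_F.
have IfinePhi r s : mu.-integrable setT (EFin \o (fine \o Phi r s)).
  have := IPhi r s; apply: le_integrable => //.
    apply/measurable_EFinP; apply: measurableT_comp => //.
    exact: measurable_int (IPhi r s).
  by move=> x _ /=; case: (Phi r s x) => [u||] //=; rewrite ?normr0 ?leey.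
have finPhi r s : {ae mu, forall x, Phi r s x \is a fin_num}.
  have := integrable_ae measurableT (IPhi r s).
  by apply: filterS => x; apply.
have Phi_le r s : {ae mu, forall x, fine (Phi r s x) <= 0}.
  apply: ae_le0_rat_intervals.
    by apply: open_integrable_locally; [exact: openT|exact: IfinePhi].
  move=> p q.
  have mI : measurable (`]ratr p, ratr q[%classic : set (measurableTypeR R)).
    exact: measurable_itv.
  have -> : (\int[mu]_(x in `]ratr p, ratr q[) ((fine \o Phi r s) x)%:E =
      \int[mu]_(x in `]ratr p, ratr q[) Phi r s x)%E.
    apply: ae_eq_integral => //.
    - by apply: measurable_funS (measurable_int _ (IfinePhi r s)).
    - by apply: measurable_funS (measurable_int _ (IPhi r s)).
    - have := finPhi r s; apply: filter_app; first exact: (ae_filter_ringOfSetsType mu).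
      by apply: aeW => x fx _ /=; rewrite fineK.
  - have := fle p q r s; congr (_ <= _)%E; apply/esym.
    rewrite integral_mkcond.
    transitivity (\int[mu]_x fubini_F mu ((EFin \o f) \_ (obox (ratr p) (ratr q) (ratr r) (ratr s))) x)%E.
      apply: eq_integral => x _; rewrite /fubini_F patchE.
      case: ifPn => xI.
        rewrite PhiE; apply: eq_integral => y _; rewrite !patchE /strip /obox !in_setX.
        by rewrite in_setT xI.
      by rewrite integral0_eq // => y _; rewrite patchE /obox in_setX (negbTE xI).
    rewrite integral12_prod_meas1; last first.
      apply/integrable_restrict; rewrite ?setTI //; first exact: measurable_obox.
      by apply: integrableS If => //; exact: measurable_obox.
    by rewrite [RHS]integral_mkcond.
have all_le : {ae mu, forall x, forall rs : rat * rat, fine (Phi rs.1 rs.2 x) <= 0}.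
  by apply: ae_forall_countable => rs; exact: Phi_le.
have mN : @measurable _ (plane R) [set x | 0 < f x].
  rewrite -[X in measurable X]setTI; have := mf measurableT `]0, +oo[%classic (measurable_itv _).
  by rewrite preimage_itvoy.
suff N0 : leb2 [set x | 0 < f x] = 0%E.
  exists [set x | 0 < f x]; split => // x /= /negP; rewrite -ltNge //.
rewrite /leb2 /=.
transitivity (\int[mu]_x (mu \o xsection [set x | (0 < f x)%R]) x)%E; first by [].
rewrite -[RHS](@integral0 _ _ _ mu setT).
apply: ae_eq_integral => //; first exact: measurable_fun_xsection.
have := ae_integrable1 If; move: all_le.
apply: filter_app2; first exact: (ae_filter_ringOfSetsType mu).
apply: aeW => x hx Ix _ /=.
have mx : measurable (xsection [set x | 0 < f x] x) by exact: measurable_xsection.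
apply: measure_negligible => //.
have : {ae mu, forall y, f (x, y) <= 0}.
  apply: ae_le0_rat_intervals; first by apply: open_integrable_locally => //; exact: openT.
  move=> r s; have Irs : mu.-integrable `]ratr r, ratr s[ (EFin \o (fun y => f (x, y))).
    by apply: integrableS Ix => //; exact: measurable_itv.
  have := hx (r, s); rewrite -lee_fin /= fineK //.
  by apply: integrable_fin_num => //; exact: measurable_itv.
move=> [N [mN' N0 sN]]; exists N; split => // y; rewrite /xsection /= => fy.
by apply: sN; apply/negP; rewrite -ltNge; move: fy; rewrite inE.
Qed.

(** Fundamental lemma of the calculus of variations, one-sided: the indicators of
    boxes are limits of test functions, and two applications of the
    differentiation theorem, one on each axis, pass from boxes to points. *)
Lemma test_ae_le0 F : loc_integrable F ->
  (forall h, test_function h -> (forall x, 0 <= h x) ->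
     \int[leb2]_(x in disk) (F x * h x) <= 0) ->
  {ae leb2, forall x, disk x -> F x <= 0}.
Proof.
move=> lF Fh; have [mF IF] := lF.
pose O (q : rat * rat * rat * rat) : set (R * R) :=
  obox (ratr q.1.1.1) (ratr q.1.1.2) (ratr q.1.2) (ratr q.2).
pose C (q : rat * rat * rat * rat) : set (R * R) :=
  cbox (ratr q.1.1.1) (ratr q.1.1.2) (ratr q.1.2) (ratr q.2).
(* The function is integrable on compact boxes only; countably many rational ones cover
   the disk. *)
suff : {ae leb2, forall x, forall q, C q `<=` disk -> O q x -> F x <= 0}.
  apply: ae_imp => x hx Dx.
  have /nbhs_ballP[e /= e0 eD] : nbhs x (disk : set (R * R)).
    by apply: open_nbhs_nbhs; split => //; exact: open_disk.
  have bet (t : R) : exists pq : rat * rat, t - e < ratr pq.1 < t /\ t < ratr pq.2 < t + e.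
    have [p hp] : exists q : rat, t - e < ratr q < t by apply: rat_between; lra.
    have [q hq] : exists q : rat, t < ratr q < t + e by apply: rat_between; lra.
    by exists (p, q).
  have [[p q] [/= /andP[p1 p2] /andP[q1 q2]]] := bet x.1.
  have [[r s] [/= /andP[r1 r2] /andP[s1 s2]]] := bet x.2.
  apply: (hx (p, q, r, s)); last first.
    by split; rewrite /= in_itv /=; apply/andP.
  move=> y [/=]; rewrite !in_itv /= => /andP[a1 a2] /andP[b1 b2]; apply: eD.
  split; rewrite /ball /= ltr_distlC.
    by rewrite (lt_le_trans p1 a1) (le_lt_trans a2 q2).
  by rewrite (lt_le_trans r1 b1) (le_lt_trans b2 s2).
apply: ae_forall_countable => -[[[a b] c] d].
have [Cd|Cd] := pselect (C (a, b, c, d) `<=` disk); last by apply: aeW.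
have mO : @measurable _ (plane R) (O (a, b, c, d)) by exact: measurable_obox.
have IO : leb2.-integrable (O (a, b, c, d)) (EFin \o F).
  apply: integrableS (IF _ (@compact_cbox _ _ _ _ _) Cd) => //.
    exact: measurable_cbox.
  exact: sub_obox_cbox.
have : {ae leb2, forall x, (F \_ (O (a, b, c, d))) x <= 0}.
  apply: ae_le0_rat_boxes.
    by rewrite -restrict_EFin; apply/integrable_restrict => //; rewrite setTI.
  move=> p q r s.
  have -> : (\int[leb2]_(x in obox (ratr p) (ratr q) (ratr r) (ratr s))
     ((F \_ (O (a, b, c, d))) x)%:E =
    \int[leb2]_(x in obox (Num.max (ratr a) (ratr p)) (Num.min (ratr b) (ratr q))
      (Num.max (ratr c) (ratr r)) (Num.min (ratr d) (ratr s))) (F x)%:E)%E.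
    rewrite integral_mkcond [RHS]integral_mkcond; apply: eq_integral => x _.
    rewrite !patchE /O /obox /= !in_setX !mem_setE !in_itv /= !gt_max !lt_min.
    by do 8 case: (_ < _).
  apply: test_box_le0 => // x [/=]; rewrite !in_itv /= !ge_max !le_min.
  move=> /andP[/andP[x1 _] /andP[x2 _]] /andP[/andP[x3 _] /andP[x4 _]].
  by apply: Cd; split; rewrite /= in_itv /=; apply/andP.
apply: ae_imp => x; rewrite patchE => hx _ Ox.
by move: hx; rewrite mem_set.
Qed.

Lemma test_ae_eq0 F : loc_integrable F ->
  (forall h, test_function h -> \int[leb2]_(x in disk) (F x * h x) = 0) ->
  {ae leb2, forall x, disk x -> F x = 0}.
Proof.
move=> lF Fh; have [mF IF] := lF.
have lN : loc_integrable (\- F).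
  split; first exact: measurable_funN.
  by move=> K cK Kd; have := integrableN (IF K cK Kd).
have h1 : {ae leb2, forall x, disk x -> F x <= 0}.
  by apply: test_ae_le0 => // h th _; rewrite Fh.
have h2 : {ae leb2, forall x, disk x -> - F x <= 0}.
  apply: (test_ae_le0 lN) => h th _.
  rewrite (_ : (fun x => _) = (fun x => F x * (-1 * h x))); last first.
    by apply/funext => x; rewrite mulN1r mulNr mulrN.
  rewrite Fh //; split; first by apply: smoothM; [exact: smooth_cst|case: th].
  by have [_ [K [cK Kd h0]]] := th; exists K; split => // x /h0 ->; rewrite mulr0.
move: h1 h2; apply: ae_imp2 => x h1 h2 Dx.
by apply/eqP; rewrite eq_le h1 //= -oppr_le0 h2.
Qed.

End TestFunctions.

(** * Difference quotients *)

Section Weak.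
Context {R : realType}.
Implicit Types f g h P p F : R * R -> R.

Lemma norm_dir j (t : R) : `|t *: dir j| = `|t| :> R.
Proof.
rewrite /dir; case: ifP => _; rewrite prod_normE /= [t *: 1]mulr1 [t *: 0]mulr0 normr0.
  by rewrite max_l.
by rewrite max_r.
Qed.

Lemma bounded_supp_integrable f (M : R) : @measurable_fun _ _ (plane R) R setT f ->
  (forall x, `|f x| <= M) -> (forall x, ~ cbox (-2) 2 (-2) 2 x -> f x = 0) ->
  leb2.-integrable setT (EFin \o f).
Proof.
move=> mf fM f0.
have mC := @measurable_cbox R (-2) 2 (-2) 2.
have I1 : leb2.-integrable (cbox (-2) 2 (-2) 2) (EFin \o f).
  apply: measurable_bounded_integrable => //.
  - rewrite /cbox leb2X; [|exact: measurable_itv|exact: measurable_itv].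
    by rewrite !lebesgue_measure_itv /= lte_fin (_ : -2 < 2) -?EFinD -?EFinM ?ltry //; lra.
  - exact: measurable_funS mf.
  - exists M; split; first exact: num_real.
    by move=> y My x Dx; apply: le_trans (ltW My); exact: fM.
apply/integrableP; split; first exact/measurable_EFinP.
move/integrableP: I1 => [_]; congr (_ < _)%E; apply/esym.
by apply: integral_support => // x _ /f0 /= ->; rewrite normr0.
Qed.

(** Both the bound on weak derivatives of Lipschitz functions and the weak
    differentiability of C1 functions are discrete integrations by parts with these
    quotients, followed by a limit. *)
Definition diffq P j (t : R) (x : R * R) : R := t^-1 * (P (t *: dir j + x) - P x).

Lemma diffq_cvg P p j x : is_derive x (dir j) P (p x) ->
  diffq P j n.+1%:R^-1 x @[n --> \oo] --> p x.
Proof.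
move=> [dP dE].
have : (fun h : R => h^-1 *: (P (h *: dir j + x) - P x)) @ 0^' --> p x.
  by rewrite -dE; exact: dP.
move=> /cvgr_dnbhsP /(_ (fun n => n.+1%:R^-1)); apply; split => [n|].
  by rewrite invr_eq0.
exact: cvg_harmonic.
Qed.

Lemma diffq_bound P p j (M t : R) x : 0 < t -> (forall x, is_derive x (dir j) P (p x)) ->
  (forall x, `|p x| <= M) -> `|diffq P j t x| <= M.
Proof.
move=> t0 dP pM.
have [s _ E] : exists2 s, s \in `]0, t[%R & P (t *: dir j + x) - P (0 *: dir j + x) = p (s *: dir j + x) * (t - 0).
  apply: (@MVT R (fun z : R => P (z *: dir j + x)) (fun s => p (s *: dir j + x)) 0 t t0) => //.
    by move=> s _; exact: is_derive_line.
  apply: derivable_within_continuous => s _.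
  by have [] := @is_derive_line _ P x (dir j) s _ (dP (s *: dir j + x)).
rewrite /diffq; move: E; rewrite scale0r add0r subr0 => ->.
by rewrite mulrC mulfK ?gt_eqF.
Qed.

Lemma shift2E j (t : R) x : t *: dir j + x = shift2 (t *: dir j) x.
Proof. by rewrite addrC. Qed.

Lemma diffq_measurable P j t : @measurable_fun _ _ (plane R) R setT P ->
  @measurable_fun _ _ (plane R) R setT (diffq P j t).
Proof.
move=> mP; apply: measurable_funM => //; apply: measurable_funB => //.
rewrite (_ : (fun x => _) = P \o shift2 (t *: dir j)); last first.
  by apply/funext => x /=; rewrite shift2E.
by apply: measurableT_comp => //; exact: measurable_shift2.
Qed.

Lemma disk_sub_cbox x : disk x -> cbox (-1 : R) 1 (-1) 1 x.
Proof.
move=> /diskE /ltW /depth_bounded[]; rewrite !ler_norml => h1 h2.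
by split; rewrite /= in_itv.
Qed.

Lemma diffq_supp P j t x : (forall x, ~ disk x -> P x = 0) -> `|t| <= 1 ->
  ~ cbox (-2) 2 (-2) 2 x -> diffq P j t x = 0.
Proof.
move=> P0 t1 xC; rewrite /diffq !P0 ?subrr ?mulr0 //.
  move=> /disk_sub_cbox[/=]; rewrite !in_itv /= => h1 h2; apply: xC.
  by split; rewrite /= in_itv /=; lra.
move=> /disk_sub_cbox[/=]; rewrite !in_itv /= => h1 h2; apply: xC.
move: t1 h1 h2; rewrite ler_norml /dir => t1.
by case: ifP => _ /=; rewrite ?[t *: 1]mulr1 ?[t *: 0]mulr0 => h1 h2;
  split; rewrite /= in_itv /=; lra.
Qed.

(** The mean value theorem bounds the quotients uniformly, and for steps of length
    at most 1 they live in the box of half side 2: dominated convergence applies. *)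
Lemma diffq_integral_cvg P p F j (M N : R) :
  (forall x, is_derive x (dir j) P (p x)) -> (forall x, `|p x| <= M) ->
  (forall x, ~ disk x -> P x = 0) ->
  @measurable_fun _ _ (plane R) R setT P -> @measurable_fun _ _ (plane R) R setT p ->
  @measurable_fun _ _ (plane R) R setT F -> (forall x, `|F x| <= N) ->
  (\int[leb2]_x (F x * diffq P j n.+1%:R^-1 x)%:E @[n --> \oo] --> \int[leb2]_x (F x * p x)%:E)%E.
Proof.
move=> dP pM P0 mP mp mF FN.
pose B := cbox (-2 : R) 2 (-2) 2.
have mB : @measurable _ (plane R) B by exact: measurable_cbox.
have n1 (n : nat) : 0 < n.+1%:R^-1 :> R by [].
have n2 (n : nat) : `|n.+1%:R^-1| <= 1 :> R.
  by rewrite gtr0_norm // invf_le1 // ler1n.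
have q0 n x : ~ B x -> diffq P j n.+1%:R^-1 x = 0 by move=> xB; exact: diffq_supp.
have p0 x : ~ B x -> p x = 0.
  move=> xB; have := @diffq_cvg P p j x (dP x).
  rewrite (_ : (fun n => _) = cst 0); last by apply/funext => n; exact: q0.
  move=> h; have := cvg_unique (@norm_hausdorff _ _) h (cvg_cst _); apply.
have m1 n : @measurable_fun _ _ (plane R) _ setT (fun x => (F x * diffq P j n.+1%:R^-1 x)%:E).
  by apply/measurable_EFinP; apply: measurable_funM => //; exact: diffq_measurable.
have m2 : @measurable_fun _ _ (plane R) _ setT (fun x => (F x * p x)%:E).
  by apply/measurable_EFinP; exact: measurable_funM.
have cvF : {ae leb2, forall x, setT x ->
    (F x * diffq P j n.+1%:R^-1 x)%:E @[n --> \oo] --> (F x * p x)%:E}.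
  apply: aeW => x _; apply/cvg_EFin; first exact: nearW.
  by apply: cvgM; [exact: cvg_cst|exact: diffq_cvg].
have ID : leb2.-integrable setT (EFin \o (fun x => (N * M) * \1_B x)).
  apply: (@bounded_supp_integrable _ `|N * M|).
  + by apply: measurable_funM => //; exact: measurable_indic.
  + by move=> x; rewrite normrM ler_piMr // ger0_norm // indicE; case: (_ \in _).
  + by move=> x xB; rewrite indicE memNset // mulr0.
have dom : {ae leb2, forall x n, setT x ->
    (`|(F x * diffq P j n.+1%:R^-1 x)%:E| <= ((N * M) * \1_B x)%:E)%E}.
  apply: aeW => x n _; rewrite lee_fin.
  have [xB|xB] := pselect (B x).
    rewrite indicE mem_set // mulr1 normrM; apply: ler_pM => //.
    exact: diffq_bound.
  by rewrite q0 // mulr0 normr0 indicE memNset // mulr0.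
by have [_ _] := @dominated_convergence _ (plane R) R leb2 setT measurableT
  _ _ _ m1 m2 cvF ID dom.
Qed.

End Weak.

(** * Algebra of weak partial derivatives *)

Section WeakAlgebra.
Context {R : realType}.
Implicit Types f g h F G phi : R * R -> R.

Lemma loc_integrableD F G : loc_integrable F -> loc_integrable G ->
  loc_integrable (F \+ G).
Proof.
move=> [mF IF] [mG IG]; split; first exact: measurable_funD.
move=> K cK Kd; have mK := compact_plane_measurable cK.
exact: (integrableD mK (IF K cK Kd) (IG K cK Kd)).
Qed.

Lemma loc_integrableM F phi : loc_integrable F -> continuous phi ->
  loc_integrable (F \* phi).
Proof.
move=> [mF IF] cphi; have mphi := continuous_plane_measurable cphi.
split; first by apply: measurable_funM => //; apply: mphi; exact: measurable_disk.
move=> K cK Kd; have mK := compact_plane_measurable cK.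
have : compact (phi @` K).
  by apply: (@continuous_compact _ _ phi K) => //; exact: continuous_subspaceT.
move=> /compact_bounded [M [_ /(_ (M + 1))]]; rewrite ltrDl ltr01 => /(_ isT) hM.
apply: (@integrable_mul_bounded R _ (plane R) leb2 K F phi (M + 1)) => //.
- exact: IF.
- exact: mphi.
- by move=> x Kx; apply: hM; exists x.
Qed.

Lemma loc_integrable_cst (c : R) : loc_integrable (cst c : R * R -> R).
Proof. by apply: continuous_loc_integrable => x _; exact: cst_continuous. Qed.

Lemma loc_integrableZ (c : R) F : loc_integrable F -> loc_integrable (fun x => c * F x).
Proof.
move=> lF; rewrite (_ : (fun x => _) = F \* cst c); last by apply/funext => x; rewrite mulrC.
by apply: loc_integrableM => // x; exact: cst_continuous.
Qed.

Lemma integral_testD F G h : loc_integrable F -> loc_integrable G -> test_function h ->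
  \int[leb2]_(x in disk) ((F x + G x) * h x) =
  \int[leb2]_(x in disk) (F x * h x) + \int[leb2]_(x in disk) (G x * h x).
Proof.
move=> lF lG th; rewrite -RintegralD //.
- by apply: eq_Rintegral => x _; rewrite mulrDl.
- exact: measurable_disk.
- exact: loc_integrable_test.
- exact: loc_integrable_test.
Qed.

Lemma integral_testZ (c : R) F h : loc_integrable F -> test_function h ->
  \int[leb2]_(x in disk) (c * F x * h x) = c * \int[leb2]_(x in disk) (F x * h x).
Proof.
move=> lF th; rewrite -RintegralZl //.
- by apply: eq_Rintegral => x _; rewrite mulrA.
- exact: measurable_disk.
- exact: loc_integrable_test.
Qed.

Lemma smooth_test phi h : smooth phi -> test_function h -> test_function (phi \* h).
Proof.
move=> sphi [sh [K [cK Kd h0]]]; split; first exact: smoothM.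
by exists K; split => // x /h0 /= ->; rewrite mulr0.
Qed.

Lemma test_derive j h : test_function h -> test_function ('D_(dir j) h).
Proof.
move=> [sh [K [cK Kd h0]]]; split; first exact: smooth_derive.
exists K; split => // x xK.
have : \forall y \near x, cst 0 y = h y.
  have : nbhs x (~` K).
    apply: open_nbhs_nbhs; split => //; apply: closed_openC; exact: compact_closed.
  by apply: filterS => y /h0.
by move=> /near_eq_derive <-; exact: derive_cst.
Qed.

Lemma weak_partialD j f f' g g' : weak_partial j f g -> weak_partial j f' g' ->
  weak_partial j (f \+ f') (g \+ g').
Proof.
move=> [lf lg fg] [lf' lg' fg']; split; [exact: loc_integrableD|exact: loc_integrableD|].
move=> h th; rewrite integral_testD //; last exact: test_derive.
by rewrite integral_testD // fg // fg' // opprD.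
Qed.

Lemma weak_partialZ j (c : R) f g : weak_partial j f g ->
  weak_partial j (fun x => c * f x) (fun x => c * g x).
Proof.
move=> [lf lg fg]; split; [exact: loc_integrableZ|exact: loc_integrableZ|].
move=> h th; rewrite integral_testZ //; last exact: test_derive.
by rewrite integral_testZ // fg // mulrN.
Qed.

(** Test [f] with [phi * h], which is again a test function. *)
Lemma weak_partialM j phi f g : smooth phi -> weak_partial j f g ->
  weak_partial j (f \* phi) ((g \* phi) \+ (f \* 'D_(dir j) phi)).
Proof.
move=> sphi [lf lg fg].
have cp := smooth_continuous sphi.
have cdp := smooth_continuous (@smooth_derive _ _ j sphi).
have l1 := loc_integrableM lf cp; have l2 := loc_integrableM lg cp.
have l3 := loc_integrableM lf cdp.
split => //; first exact: loc_integrableD.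
move=> h th.
have := fg _ (smooth_test sphi th).
have -> : \int[leb2]_(x in disk) (f x * 'D_(dir j) (phi \* h) x) =
    \int[leb2]_(x in disk) (((f \* phi) x) * 'D_(dir j) h x) +
    \int[leb2]_(x in disk) ((f \* 'D_(dir j) phi) x * h x).
  rewrite -RintegralD.
  - apply: eq_Rintegral => x _ /=.
    have -> : 'D_(dir j) (phi \* h) x = phi x * 'D_(dir j) h x + h x * 'D_(dir j) phi x.
      by apply: deriveM; apply: smooth_derivable => //; case: th.
    by rewrite mulrDr; congr (_ + _); ring.
  - exact: measurable_disk.
  - by apply: loc_integrable_test => //; exact: test_derive.
  - exact: loc_integrable_test.
have -> : \int[leb2]_(x in disk) (g x * (phi \* h) x) =
          \int[leb2]_(x in disk) ((g \* phi) x * h x).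
  by apply: eq_Rintegral => x _ /=; rewrite mulrA.
by rewrite integral_testD // => E; rewrite opprD -E addrK.
Qed.

Lemma weak_partial_unique j f g g' : weak_partial j f g -> weak_partial j f g' ->
  {ae leb2, forall x, disk x -> g x = g' x}.
Proof.
move=> [lf lg fg] [_ lg' fg'].
have lN : loc_integrable (fun x => -1 * g' x) by exact: loc_integrableZ.
have := @test_ae_eq0 _ (g \+ (fun x => -1 * g' x)) (loc_integrableD lg lN).
move=> H; have {}H : {ae leb2, forall x, disk x -> (g \+ (fun x => -1 * g' x)) x = 0}.
  apply: H => h th; rewrite integral_testD // integral_testZ //.
  by rewrite mulN1r -[X in _ + X](fg' h th) (fg h th) subrr.
move: H; apply: ae_imp => x /= H Dx; apply/eqP; rewrite -subr_eq0.
by rewrite -(H Dx) mulN1r.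
Qed.

End WeakAlgebra.

(** * Weak derivatives of Lipschitz and of C1 functions *)

Section WeakClassical.
Context {R : realType}.
Implicit Types f g h F G phi P p : R * R -> R.

Lemma restrict_disk_bounded f (N : R) : (forall x, disk x -> `|f x| <= N) -> 0 <= N ->
  forall x, `|(f \_ disk) x| <= N.
Proof.
by move=> fN N0 x; rewrite patchE; case: ifPn => [|_]; rewrite ?normr0 // inE => /fN.
Qed.

Lemma depth_shift j (t a : R) x : 0 < a <= 1 -> a <= depth x -> 0 <= t <= a / 4 ->
  disk (x - t *: dir j).
Proof.
move=> /andP[a0 a1] ax /andP[t0 t1]; apply/diskE.
have /depth_bounded[] := le_trans (ltW a0) ax; rewrite !ler_norml => h1 h2.
move: ax; rewrite /depth /dir.
by case: ifP => _ /=; rewrite ?[t *: 1]mulr1 ?[t *: 0]mulr0 ?subr0 => ax; nra.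
Qed.

(** Moving the difference quotient from the test function to f costs at most the
    Lipschitz constant. *)
Lemma lipschitz_test_bound f j (L N : R) h : 0 <= L ->
  @measurable_fun _ _ (plane R) R disk f -> (forall x, disk x -> `|f x| <= N) ->
  (forall x y, disk x -> disk y -> `|f x - f y| <= L * `|x - y|) -> test_function h ->
  `|\int[leb2]_(x in disk) (f x * 'D_(dir j) h x)| <= L * \int[leb2]_(x in disk) `|h x|.
Proof.
move=> L0 mf fN fL th; have [sh [K [cK Kd h0]]] := th.
have [a a01 Ka] := compact_sub_depth cK Kd.
pose F := f \_ disk.
have N0 : 0 <= N.
  by apply: le_trans (fN (0, 0) _); rewrite // /disk /= expr0n /= addr0.
have FN x : `|F x| <= N by exact: restrict_disk_bounded.
have md := @measurable_disk R.
have mF : @measurable_fun _ _ (plane R) R setT F by apply/(measurable_restrictT _ md).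
have mh : @measurable_fun _ _ (plane R) R setT h by exact: test_measurable.
have [H hH] := test_bounded th.
have H0 : 0 <= H by apply: le_trans (hH (0, 0)).
have [M hM] := test_bounded (test_derive j th).
have hd0 x : ~ disk x -> h x = 0 by move=> xD; apply: h0; apply: contra_not xD; exact: Kd.
have hc0 x : ~ cbox (-2) 2 (-2) 2 x -> h x = 0.
  move=> xC; apply: hd0; apply: contra_not xC => /disk_sub_cbox[/=].
  by rewrite !in_itv /= => h1 h2; split; rewrite /= in_itv /=; lra.
have cvF := @diffq_integral_cvg _ h _ F j M N (fun x => smooth_is_derive x j sh) hM hd0 mh
  (test_measurable (test_derive j th) measurableT) mF FN.
have Ih : leb2.-integrable setT (EFin \o (fun x => L * `|h x|)).
  apply: (@bounded_supp_integrable _ _ (L * H)).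
  - by apply: measurable_funM => //; exact: measurableT_comp.
  - by move=> x; rewrite normrM ger0_norm // normr_id ler_wpM2l.
  - by move=> x /hc0 ->; rewrite normr0 mulr0.
have key : \forall n \near \oo,
    (`|\int[leb2]_x (F x * diffq h j n.+1%:R^-1 x)%:E| <= \int[leb2]_x (L * `|h x|)%:E)%E.
  have ta : \forall n \near \oo, n.+1%:R^-1 < a / 4.
    have a4 : 0 < a / 4 by case/andP: a01 => a0 _; rewrite divr_gt0.
    have := @cvg_harmonic R; move=> /cvgrPdist_lt /(_ _ a4).
    by apply: filterS => n /=; rewrite sub0r normrN gtr0_norm.
  apply: filterS ta => n; set t := n.+1%:R^-1 => ta.
  have t0 : 0 < t by rewrite /t.
  have t1 : `|t| <= 1 by rewrite gtr0_norm //; case/andP: a01 => a0 a1; lra.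
  pose psi y := t^-1 * (F (shift2 (- t *: dir j) y) - F y) * h y.
  pose phi1 y := t^-1 * (F (shift2 (- t *: dir j) y) * h y).
  pose phi2 y := t^-1 * (F y * h y).
  have mFs : @measurable_fun _ _ (plane R) R setT (fun y => F (shift2 (- t *: dir j) y)).
    by apply: measurableT_comp => //; exact: measurable_shift2.
  have mpsi1 : @measurable_fun _ _ (plane R) R setT
      (fun y => t^-1 * (F (shift2 (- t *: dir j) y) * h y)).
    by apply: measurable_funM => //; exact: measurable_funM.
  have I1 : leb2.-integrable setT (EFin \o (fun y => t^-1 * (F (shift2 (- t *: dir j) y) * h y))).
    apply: (@bounded_supp_integrable _ _ (t^-1 * (N * H))) => //.
    - by move=> x; rewrite !normrM gtr0_norm ?invr_gt0 // ler_pM2l ?invr_gt0 // ler_pM.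
    - by move=> x /hc0 ->; rewrite !mulr0.
  have I2 : leb2.-integrable setT (EFin \o (fun y => t^-1 * (F y * h y))).
    apply: (@bounded_supp_integrable _ _ (t^-1 * (N * H))) => //.
    - by apply: measurable_funM => //; exact: measurable_funM.
    - by move=> x; rewrite !normrM gtr0_norm ?invr_gt0 // ler_pM2l ?invr_gt0 // ler_pM.
    - by move=> x /hc0 ->; rewrite !mulr0.
  have I3 : leb2.-integrable setT
      ((EFin \o (fun y => t^-1 * (F (shift2 (- t *: dir j) y) * h y))) \o shift2 (t *: dir j)).
    apply: (@bounded_supp_integrable _ (fun x => _) (t^-1 * (N * H))) => //.
    - by apply: (measurableT_comp mpsi1); exact: measurable_shift2.
    - by move=> x; rewrite !normrM gtr0_norm ?invr_gt0 // ler_pM2l ?invr_gt0 // ler_pM.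
    - move=> x xC.
      have := @diffq_supp _ h j t x hd0 t1 xC.
      rewrite /diffq (hc0 x xC) subr0 => /eqP; rewrite mulf_eq0 invr_eq0 gt_eqF //= => /eqP; rewrite shift2E => ->.
      by rewrite !mulr0.
  have -> : (\int[leb2]_x (F x * diffq h j t x)%:E = \int[leb2]_x (psi x)%:E)%E.
    have E1 : (\int[leb2]_x (F x * diffq h j t x)%:E =
       \int[leb2]_x ((EFin \o phi1) (shift2 (t *: dir j) x) - (phi2 x)%:E))%E.
      apply: eq_integral => x _ /=; rewrite -EFinB; congr EFin; rewrite /diffq shift2E /phi1 /phi2.
      rewrite (_ : shift2 (- t *: dir j) _ = x); first by ring.
      rewrite /shift2 scaleNr /=; case: x => x1 x2 /=.
      by congr pair; lra.
    rewrite {}E1 (@integralB _ (plane R) R leb2 setT measurableT _ (EFin \o phi2) I3 I2).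
    have -> := @integral_shift2 _ (t *: dir j) (EFin \o phi1) (measurable_int _ I1) I3.
    rewrite -(@integralB _ (plane R) R leb2 setT measurableT _ _ I1 I2).
    apply: eq_integral => x _ /=.
    by rewrite -EFinB; congr EFin; rewrite /psi /phi1 /phi2; ring.
  have mpsi : @measurable_fun _ _ (plane R) R setT psi.
    apply: measurable_funM => //; apply: measurable_funM => //.
    exact: measurable_funB.
  apply: (le_trans (le_abse_integral _ _ _)) => //; first exact/measurable_EFinP.
  apply: ge0_le_integral => //.
  - by apply/measurable_EFinP; exact: measurableT_comp.
    by have /measurable_int := Ih.
  move=> x _ /=; rewrite lee_fin /psi normrM.
  have [Kx|Kx] := pselect (K x); last by rewrite h0 // normr0 !mulr0.
  rewrite ler_wpM2r // normrM gtr0_norm ?invr_gt0 // ler_pdivrMl //.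
  have xd := Kd _ Kx.
  have sE : shift2 (- t *: dir j) x = x - t *: dir j by rewrite addrC -shift2E scaleNr addrC.
  have sd : disk (shift2 (- t *: dir j) x).
    by rewrite sE; apply: (@depth_shift j t a) => //; [exact: Ka|rewrite !ltW].
  rewrite /F !patchE !mem_set //; apply: (le_trans (fL _ _ sd xd)).
  by rewrite sE addrAC subrr add0r normrN norm_dir gtr0_norm // mulrC.
have E1 : (\int[leb2]_x (F x * 'D_(dir j) h x)%:E)%E =
    (\int[leb2]_(x in disk) (f x * 'D_(dir j) h x)%:E)%E.
  rewrite [RHS]integral_mkcond; apply: eq_integral => x _; rewrite /F !patchE.
  by case: ifP => //; rewrite mul0r.
have E2 : (\int[leb2]_x (L * `|h x|)%:E)%E = (\int[leb2]_(x in disk) (L * `|h x|)%:E)%E.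
  rewrite [RHS]integral_mkcond; apply: eq_integral => x _; rewrite !patchE.
  case: ifPn => // xD; rewrite hd0 ?normr0 ?mulr0 //.
  by move: xD; rewrite notin_setE.
have lf : loc_integrable f.
  split => // K' cK' Kd'; have mK' := compact_plane_measurable cK'.
  apply: (@bounded_integrable_plane _ _ _ N) => //.
  - by move=> x /Kd'; rewrite /disk /cdisk /=; exact: ltW.
  - exact: measurable_funS mf.
  - by move=> x /Kd'; exact: fN.
have If := loc_integrable_test lf (test_derive j th).
have Ihd : leb2.-integrable disk (EFin \o (fun x => `|h x|)).
  have := integrable_abse (loc_integrable_test (@loc_integrable_cst R 1) th).
  by congr (_.-integrable _ _); apply/funext => x /=; rewrite mul1r.
rewrite -RintegralZl // -lee_fin EFin_normr_Rintegral // [leRHS]fineK; last first.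
  by apply: integrable_fin_num => //; exact: (integrableZl md L Ihd).
rewrite -E1 -E2.
have cva : (`|\int[leb2]_x (F x * diffq h j n.+1%:R^-1 x)%:E| @[n --> \oo] -->
    `|\int[leb2]_x (F x * 'D_(dir j) h x)%:E|)%E by exact: cvg_abse cvF.
rewrite -(cvg_lim (@ereal_hausdorff R) cva).
by apply: lime_le => //; apply/cvg_ex; eexists; exact: cva.
Qed.

(** By the integrated bound, [g - L] and [- g - L] are nonpositive against all
    nonnegative test functions. *)
Lemma weak_partial_lipschitz j f g (L N : R) : 0 <= L ->
  (forall x, disk x -> `|f x| <= N) ->
  (forall x y, disk x -> disk y -> `|f x - f y| <= L * `|x - y|) -> weak_partial j f g ->
  {ae leb2, forall x, disk x -> `|g x| <= L}.
Proof.
move=> L0 fN fL [lf lg fg]; have [mf _] := lf.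
have lc := @loc_integrable_cst R (- L).
have hb h : test_function h -> (forall x, 0 <= h x) ->
    `|\int[leb2]_(x in disk) (g x * h x)| <= L * \int[leb2]_(x in disk) (1 * h x).
  move=> th h0; rewrite -normrN -fg //.
  apply: le_trans (lipschitz_test_bound j L0 mf fN fL th) _.
  rewrite ler_wpM2l // le_eqVlt; apply/orP; left; apply/eqP.
  by apply: eq_Rintegral => x _; rewrite mul1r ger0_norm.
have cE h : test_function h -> \int[leb2]_(x in disk) (cst (- L) x * h x) =
    - (L * \int[leb2]_(x in disk) (1 * h x)).
  move=> th; rewrite -mulNr -integral_testZ //; last exact: (@loc_integrable_cst R 1).
  by apply: eq_Rintegral => x _; rewrite mulr1.
have h1 : {ae leb2, forall x, disk x -> (g \+ cst (- L)) x <= 0}.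
  apply: test_ae_le0; first exact: loc_integrableD.
  move=> h th h0; rewrite integral_testD //.
  by have := hb h th h0; rewrite ler_norml (cE h th) subr_le0 => /andP[].
have h2 : {ae leb2, forall x, disk x -> ((fun x => - 1 * g x) \+ cst (- L)) x <= 0}.
  have lN := loc_integrableZ (- 1) lg.
  apply: test_ae_le0; first exact: loc_integrableD.
  move=> h th h0; rewrite integral_testD // integral_testZ //.
  by have := hb h th h0; rewrite ler_norml (cE h th) subr_le0 mulN1r lerNl => /andP[].
move: h1 h2; apply: ae_imp2 => x /= h1 h2 Dx; rewrite ler_norml.
by have := h1 Dx; have := h2 Dx; lra.
Qed.

Lemma bounded_on_compact f (K : set (R * R)) :
  (forall x, disk x -> {for x, continuous f}) -> compact K -> K `<=` disk ->
  exists2 M, 0 <= M & forall x, K x -> `|f x| <= M.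
Proof.
move=> cf cK sK; have : compact (f @` K).
  apply: (@continuous_compact _ _ f K) => //.
  by apply: continuous_in_subspaceT => x; rewrite inE => /sK /cf.
move=> /compact_bounded [M [_ /(_ (M + 1))]]; rewrite ltrDl ltr01 => /(_ isT) fM.
exists `|M + 1| => // x Kx; apply: le_trans (ler_norm _).
by apply: fM; exists x.
Qed.

(** Classical partial derivatives are weak ones: a compactly supported derivative
    integrates to zero because its difference quotients do. *)
Lemma weak_partial_C1 j f : (forall x, disk x -> {for x, continuous f}) ->
  (forall x, disk x -> derivable f x (dir j)) ->
  (forall x, disk x -> {for x, continuous ('D_(dir j) f)}) ->
  weak_partial j f ('D_(dir j) f).
Proof.
move=> cf df cdf.
have lf := continuous_loc_integrable cf; have ldf := continuous_loc_integrable cdf.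
split => // h th; have [sh [K [cK Kd h0]]] := th.
have md := @measurable_disk R.
pose P := (f \* h) \_ disk.
pose q x := f x * 'D_(dir j) h x + h x * 'D_(dir j) f x.
pose p := q \_ disk.
have ch := smooth_continuous sh; have cdh := smooth_continuous (@smooth_derive _ _ j sh).
have cq x : disk x -> {for x, continuous q}.
  move=> Dx; apply: continuousD; apply: continuousM.
  - exact: cf. - exact: cdh. - exact: ch. - exact: cdf.
have cfh x : disk x -> {for x, continuous (f \* h)}.
  by move=> Dx; apply: continuousM; [exact: cf|exact: ch].
have oKc : open (~` K) by apply: closed_openC; exact: compact_closed.
have h'0 x : ~ K x -> 'D_(dir j) h x = 0.
  move=> xK; have : \forall y \near x, cst 0 y = h y.
    have : nbhs x (~` K) by apply: open_nbhs_nbhs.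
    by apply: filterS => y /h0.
  by move=> /near_eq_derive <-; exact: derive_cst.
have [M M0 qM] := bounded_on_compact cq cK Kd.
have pM x : `|p x| <= M.
  rewrite /p patchE; case: ifPn => _; last by rewrite normr0.
  have [Kx|Kx] := pselect (K x); first exact: qM.
  by rewrite /q h0 // h'0 // mulr0 mul0r addr0 normr0.
have dP x : is_derive x (dir j) P (p x).
  have [Dx|Dx] := pselect (disk x).
    rewrite /p patchE mem_set //.
    have D1 : is_derive x (dir j) (f * h) (q x).
      split; first by apply: derivableM; [exact: df|exact: smooth_derivable].
      by rewrite deriveM //; [exact: df|exact: smooth_derivable].
    apply: near_eq_is_derive D1.
    have : nbhs x (disk : set (R * R)) by apply: open_nbhs_nbhs; split => //; exact: open_disk.
    by apply: filterS => y Dy; rewrite /P patchE mem_set.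
  rewrite /p patchE memNset //.
  have D1 : is_derive x (dir j) (cst 0 : R * R -> R) (0 : R) by exact: is_derive_cst.
  apply: near_eq_is_derive D1.
  have : nbhs x (~` K) by apply: open_nbhs_nbhs; split => //; apply: contra_not Dx; exact: Kd.
  apply: filterS => y /h0 hy; rewrite /P patchE /=; case: ifP => // _.
  by rewrite hy mulr0.
have P0 x : ~ disk x -> P x = 0 by move=> Dx; rewrite /P patchE memNset.
have mP : @measurable_fun _ _ (plane R) R setT P.
  apply/(measurable_restrictT _ md); apply: open_continuous_plane_measurable => //.
  exact: open_disk.
have mp : @measurable_fun _ _ (plane R) R setT p.
  apply/(measurable_restrictT _ md); apply: open_continuous_plane_measurable => //.
  exact: open_disk.
have mc : @measurable_fun _ _ (plane R) R setT (cst 1) by exact: measurable_cst.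
have := @diffq_integral_cvg _ P p (cst 1) j M 1 dP pM P0 mP mp mc.
have c1 (x : R * R) : `|cst 1 x| <= 1 :> R by rewrite normr1.
have [N N0 PN] := bounded_on_compact cfh cK Kd.
have PN' x : `|P x| <= N.
  rewrite /P patchE; case: ifPn => _; last by rewrite normr0.
  have [Kx|Kx] := pselect (K x); first exact: PN.
  by rewrite /= h0 // mulr0 normr0.
have shift0 n : (\int[leb2]_x (cst 1 x * diffq P j n.+1%:R^-1 x)%:E = 0)%E.
  set t := n.+1%:R^-1.
  have t0 : 0 < t by rewrite /t.
  have t1 : `|t| <= 1 by rewrite /t gtr0_norm // invf_le1 // ler1n.
  have Pc0 x : ~ cbox (-2) 2 (-2) 2 x -> P x = 0.
    move=> xC; apply: P0; apply: contra_not xC => /disk_sub_cbox[/=].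
    by rewrite !in_itv /= => h1 h2; split; rewrite /= in_itv /=; lra.
  pose Q x := t^-1 * P x.
  have mQ : @measurable_fun _ _ (plane R) R setT Q by apply: measurable_funM.
  have QN x : `|Q x| <= t^-1 * N by rewrite normrM gtr0_norm ?invr_gt0 // ler_pM2l ?invr_gt0.
  have I1 : leb2.-integrable setT (EFin \o Q).
    apply: (@bounded_supp_integrable _ _ (t^-1 * N)) => //.
    by move=> x /Pc0; rewrite /Q => ->; rewrite mulr0.
  have I2 : leb2.-integrable setT ((EFin \o Q) \o shift2 (t *: dir j)).
    apply: (@bounded_supp_integrable _ (Q \o shift2 (t *: dir j)) (t^-1 * N)).
    + by apply: (measurableT_comp mQ); exact: measurable_shift2.
    + by move=> x; exact: QN.
    + move=> x xC; have := @diffq_supp _ P j t x P0 t1 xC.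
      by rewrite /diffq (Pc0 x xC) subr0 shift2E.
  rewrite (_ : \int[leb2]_x _ = \int[leb2]_x ((EFin \o Q) (shift2 (t *: dir j) x) - (Q x)%:E))%E; last first.
    apply: eq_integral => x _ /=; rewrite -EFinB; congr EFin.
    by rewrite mul1r /diffq shift2E /Q mulrBr.
  rewrite (@integralB _ (plane R) R leb2 setT measurableT _ (EFin \o Q) I2 I1).
  have -> := @integral_shift2 _ (t *: dir j) (EFin \o Q) (measurable_int _ I1) I2.
  by rewrite subee //; exact: integrable_fin_num I1.
move=> /(_ c1); under eq_fun do rewrite shift0.
move=> /(cvg_unique (@ereal_hausdorff R) (cvg_cst _)) E0.
have E1 : \int[leb2]_(x in disk) (q x) = 0.
  have E2 : (\int[leb2]_x (cst 1 x * p x)%:E)%E = (\int[leb2]_(x in disk) (q x)%:E)%E.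
    rewrite [RHS]integral_mkcond; apply: eq_integral => x _ /=; rewrite mul1r /p !patchE.
    by case: ifP.
  by rewrite /Rintegral -E2 -E0.
apply/eqP; rewrite -subr_eq0 opprK -RintegralD //; first last.
- exact: loc_integrable_test.
- by apply: loc_integrable_test => //; exact: test_derive.
rewrite -E1; apply/eqP; apply: eq_Rintegral => x _.
by rewrite /q; congr (_ + _); rewrite mulrC.
Qed.

End WeakClassical.

(** * Gradient estimate for harmonic functions *)

Section MaximumPrinciple.
Context {R : realType}.

(** A positive second derivative would make the first one positive just to the right
    of [c], and the function would exceed its maximum there. *)
Lemma second_derivative_at_max (f f1 : R -> R) (c r s : R) : 0 < r ->
  (forall t, `|t - c| < r -> is_derive t 1 f (f1 t)) -> is_derive c 1 f1 s ->
  (forall t, `|t - c| < r -> f t <= f c) -> s <= 0.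
Proof.
move=> r0 df df1 fmax.
have f1c : f1 c = 0.
  have c0 : `|c - c| < r by rewrite subrr normr0.
  have [_ <-] := df c c0.
  have D : is_derive c 1 f 0.
    apply: (@derive1_at_max _ f (c - r) (c + r)).
    - lra.
    - move=> t; rewrite in_itv /= => /andP[t1 t2].
      have tr : `|t - c| < r by rewrite ltr_norml; lra.
      by have [] := df t tr.
    - by rewrite in_itv /=; lra.
    - move=> t; rewrite in_itv /= => /andP[t1 t2].
      by apply: fmax; rewrite ltr_norml; lra.
  by have [] := D.
rewrite leNgt; apply/negP => s0.
have [L LE] := df1.
have cv : (fun h : R => h^-1 *: (f1 (h *: 1 + c) - f1 c)) @ 0^' --> s by rewrite -LE; exact: L.
have : \forall h \near (0 : R)^', 0 < h^-1 *: (f1 (h *: 1 + c) - f1 c).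
  by apply: (cvgr_gt _ cv).
rewrite near_withinE => /nbhs_ballP[e /= e0 eb].
pose t := Num.min e r / 2.
have t0 : 0 < t by rewrite divr_gt0 // lt_min e0 r0.
have te : t < e by rewrite /t ltr_pdivrMr // gt_min; apply/orP; left; lra.
have tr : t < r by rewrite /t ltr_pdivrMr // gt_min; apply/orP; right; lra.
have [z zI zE] : exists2 z, z \in `]c, (c + t)[%R & f (c + t) - f c = f1 z * (c + t - c).
  apply: MVT; first lra.
    move=> z; rewrite in_itv /= => /andP[z1 z2].
    by apply: df; rewrite ltr_norml; lra.
  apply: derivable_within_continuous => z; rewrite in_itv /= => /andP[z1 z2].
  have zr : `|z - c| < r by rewrite ltr_norml; lra.
  by have [] := df z zr.
move: zI; rewrite in_itv /= => /andP[z1 z2].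
have zc0 : z - c != 0 by rewrite gt_eqF // subr_gt0.
have := eb (z - c) _ zc0.
rewrite /ball /= sub0r normrN gtr0_norm ?subr_gt0 // => /(_ _)/[!f1c] H.
have {}H : 0 < (z - c)^-1 *: (f1 ((z - c) *: 1 + c) - 0) by apply: H; lra.
move: H; rewrite [(z - c) *: 1]mulr1 subrK subr0 pmulr_rgt0 ?invr_gt0 ?subr_gt0 // => H.
have := fmax (c + t) _; rewrite addrAC subrr add0r gtr0_norm // => /(_ tr).
by rewrite -subr_le0 zE addrAC subrr add0r leNgt mulr_gt0.
Qed.

(** A strictly subharmonic function has no interior maximum, since both pure second
    derivatives are nonpositive there. *)
Lemma strict_max_principle (W : R * R -> R) (W1 W2 : 'I_2 -> R * R -> R) (a b c d : R) :
  a <= b -> c <= d -> {within cbox a b c d, continuous W} ->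
  (forall x j, obox a b c d x -> is_derive x (dir j) W (W1 j x)) ->
  (forall x j, obox a b c d x -> is_derive x (dir j) (W1 j) (W2 j x)) ->
  (forall x, obox a b c d x -> 0 < W2 ord0 x + W2 ord_max x) ->
  (forall x, cbox a b c d x -> ~ obox a b c d x -> W x <= 0) ->
  forall x, cbox a b c d x -> W x <= 0.
Proof.
move=> ab cd cW dW dW1 W2gt Wb x xC.
have [z zC zmax] : exists2 z, z \in cbox a b c d & forall t, t \in cbox a b c d -> W t <= W z.
  apply: compact_EVT_max => //; first by exists x.
  exact: compact_cbox.
rewrite inE in zC.
apply: (@le_trans _ _ (W z)); first by apply: zmax; rewrite inE.
have [zO|] := pselect (obox a b c d z); last exact: Wb.
exfalso.
have oO : open (obox a b c d).
  rewrite (_ : obox a b c d = (fst @^-1` `]a, b[%classic) `&` (snd @^-1` `]c, d[%classic)) //.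
  apply: openI; apply: open_comp; try exact: interval_open.
    by move=> y _; exact: continuous_fst2.
  by move=> y _; exact: continuous_snd2.
have /nbhs_ballP[e /= e0 eO] : nbhs z (obox a b c d) by exact: open_nbhs_nbhs.
have line j t : `|t - 0| < e -> obox a b c d (t *: dir j + z).
  rewrite subr0 => te; apply: eO; rewrite -ball_normE /=.
  by rewrite opprD addrCA subrr addr0 normrN norm_dir.
have W2le j : W2 j z <= 0.
  apply: (@second_derivative_at_max (fun t => W (t *: dir j + z))
    (fun t => W1 j (t *: dir j + z)) 0 e) => //.
  - by move=> t te; apply: is_derive_line; apply: dW; exact: line.
  - by apply: is_derive_line; rewrite scale0r add0r; exact: dW1.
  - move=> t te; rewrite scale0r add0r; apply: zmax; rewrite inE.
    by apply: sub_obox_cbox; exact: line.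
have := W2gt z zO; have := W2le ord0; have := W2le ord_max; lra.
Qed.

End MaximumPrinciple.

Section GradientBound.
Context {R : realType}.
Implicit Types (x z : R * R).

(** The factor 6 bounds the change of a square of a number of modulus at most 1 under
    a perturbation by [d <= 1], once for each coordinate. *)
Lemma depth_perturb x (p q d : R) : 0 <= depth x -> d <= 1 -> `|p| <= d -> `|q| <= d ->
  depth x - 6 * d <= depth (x.1 + p, x.2 + q).
Proof.
move=> /depth_bounded[x1 x2] d1 pd qd.
have d0 : 0 <= d by exact: le_trans (normr_ge0 p) pd.
have mulle (u v : R) : `|u| <= 1 -> `|v| <= d -> u * v <= d.
  move=> u1 vd; apply: le_trans (ler_norm _) _; rewrite normrM.
  by apply: le_trans (_ : 1 * d <= _); [exact: ler_pM|rewrite mul1r].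
have h1 := mulle _ _ x1 pd; have h2 := mulle _ _ x2 qd.
have h3 := mulle _ _ (le_trans pd d1) pd; have h4 := mulle _ _ (le_trans qd d1) qd.
rewrite /depth /=; lra.
Qed.

Lemma is_derive_affine (g : R * R -> R) (A : R * R -> R * R) z v w (c d : R) :
  (forall h, A (h *: v + z) = (h * c) *: w + A z) -> is_derive (A z) w g d ->
  is_derive z v (g \o A) (c * d).
Proof.
move=> AE gd; apply: is_derive_line0.
rewrite (_ : (fun h => _) = (fun k => g (k *: w + A z)) \o (fun h => h * c)); last first.
  by apply/funext => h /=; rewrite AE.
have D1 : is_derive (0 : R) 1 (fun h : R => h * c) c.
  by apply: is_derive_eq; rewrite /= scaler0 add0r [_ *: 1]mulr1.
rewrite mulrC; apply: is_derive1_comp.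
by apply: is_derive_line; rewrite mul0r scale0r add0r.
Qed.

(** The derivatives are carried along as functions of their own, so that harmonic
    functions can be subtracted, scaled and reflected without deriving anew. *)
Definition harmonic_grad (g : R * R -> R) (g1 : 'I_2 -> R * R -> R) : Prop :=
  exists g2 : 'I_2 -> R * R -> R, forall x, disk x ->
  [/\ {for x, continuous g}, forall j, is_derive x (dir j) g (g1 j x),
      forall j, is_derive x (dir j) (g1 j) (g2 j x) &
      g2 ord0 x + g2 ord_max x = 0].

Lemma harmonic_gradB g f g1 f1 : harmonic_grad g g1 -> harmonic_grad f f1 ->
  harmonic_grad (fun x => g x - f x) (fun j x => g1 j x - f1 j x).
Proof.
move=> [g2 hg] [f2 hf]; exists (fun j x => g2 j x - f2 j x) => x Dx.
have [cg dg dg1 Lg] := hg x Dx; have [cf df df1 Lf] := hf x Dx.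
split.
- exact: continuousB.
- by move=> j; exact: is_deriveB.
- by move=> j; exact: is_deriveB.
- by rewrite addrACA Lg -opprD Lf subrr.
Qed.

Lemma harmonic_gradZ (c : R) g g1 : harmonic_grad g g1 ->
  harmonic_grad (fun x => c * g x) (fun j x => c * g1 j x).
Proof.
move=> [g2 hg]; exists (fun j x => c * g2 j x) => x Dx.
have [cg dg dg1 Lg] := hg x Dx; split.
- by apply: continuousM => //; exact: cst_continuous.
- by move=> j; exact: is_deriveZ.
- by move=> j; exact: is_deriveZ.
- by rewrite -mulrDr Lg mulr0.
Qed.

Definition other (j : 'I_2) : 'I_2 := if j == ord0 then ord_max else ord0.

Lemma ord2P (P : 'I_2 -> Prop) : P ord0 -> P ord_max -> forall j, P j.
Proof.
move=> P0 P1 [[|[|//]] lt_j2].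
  by rewrite (_ : Ordinal _ = ord0) //; exact: val_inj.
by rewrite (_ : Ordinal _ = ord_max) //; exact: val_inj.
Qed.

(** A box of coordinates centred at [x0]: the first coordinate runs along the axis
    other than [j]; [s = 1] and [s = -1] give two maps that are mirror images in it. *)
Let A x0 j (s : R) z : R * R := x0 + z.1 *: dir (other j) + (s * z.2) *: dir j.

Let A0 x0 j s z h : A x0 j s (h *: dir ord0 + z) = (h * 1) *: dir (other j) + A x0 j s z.
Proof.
rewrite /A /= [h *: 1]mulr1 [h *: 0]mulr0 add0r mulr1 scalerDl.
by rewrite [x0 + (_ + _)]addrCA -!addrA.
Qed.

Let A1 x0 j s z h : A x0 j s (h *: dir ord_max + z) = (h * s) *: dir j + A x0 j s z.
Proof.
rewrite /A /= [h *: 1]mulr1 [h *: 0]mulr0 add0r mulrDr scalerDl [s * h]mulrC.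
by rewrite addrCA.
Qed.

Let A_disk x0 j s z a : 0 < a <= 1 -> a <= depth x0 -> `|s| = 1 ->
  `|z.1| <= a / 8 -> `|z.2| <= a / 8 -> disk (A x0 j s z).
Proof.
move=> /andP[a0 a1] ax s1 z1 z2; apply/diskE.
have sz : `|s * z.2| <= a / 8 by rewrite normrM s1 mul1r.
have h1 := @depth_perturb x0 z.1 (s * z.2) (a / 8) (le_trans (ltW a0) ax) _ z1 sz.
have h2 := @depth_perturb x0 (s * z.2) z.1 (a / 8) (le_trans (ltW a0) ax) _ sz z1.
rewrite /A /other /dir; case: (j == ord0) => /=.
  have -> : x0 + z.1 *: (0, 1) + (s * z.2) *: (1, 0) = (x0.1 + s * z.2, x0.2 + z.1).
    apply/pair_equal_spec; rewrite /= ![_ *: 1]mulr1 ![_ *: 0]mulr0 !addr0.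
    by split.
  by apply: lt_le_trans (h2 _); lra.
have -> : x0 + z.1 *: (1, 0) + (s * z.2) *: (0, 1) = (x0.1 + z.1, x0.2 + s * z.2).
  apply/pair_equal_spec; rewrite /= ![_ *: 1]mulr1 ![_ *: 0]mulr0 !addr0.
  by split.
by apply: lt_le_trans (h1 _); lra.
Qed.

#[local] Existing Instance is_derive_fst.
#[local] Existing Instance is_derive_snd.

Section Barrier.
Variables (g : R * R -> R) (g1 : 'I_2 -> R * R -> R) (M a : R) (x0 : R * R) (j : 'I_2).
Hypotheses (hg : harmonic_grad g g1) (gM : forall x, disk x -> `|g x| <= M).
Hypotheses (a01 : 0 < a <= 1) (ax0 : a <= depth x0).

Let d := a / 8.
Let K := M / d ^+ 2.

Let d0 : 0 < d. Proof. by case/andP: a01 => a0 _; rewrite divr_gt0. Qed.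

Let M0 : 0 <= M.
Proof.
apply: le_trans (gM (x := x0) _) => //; apply/diskE.
by case/andP: a01 => a0 _; exact: lt_le_trans ax0.
Qed.

Let K0 : 0 <= K. Proof. by rewrite divr_ge0 // sqr_ge0. Qed.

Let KdM : K * d ^+ 2 = M. Proof. by rewrite /K divfK // expf_neq0 // gt_eqF. Qed.

(** The barrier. Its first summand is harmonic in [z], it is at most [- M] on the sides
    of the box other than [z.2 = 0], and on the axis [z.1 = 0] it is linear in [z.2] to leading order. The
    term in [k] only serves to make the sum strictly subharmonic, and is removed at the
    end by letting [k] tend to zero. *)
Let B (k : R) z := - K * (z.1 ^+ 2 + z.2 * (2 * d - z.2)) + k * (z.1 ^+ 2 - d ^+ 2).

(** The odd part of [g] in the direction [j]: harmonic, bounded by [M], and zero on the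
    side [z.2 = 0]; at the centre its derivative in [z.2] is that of [g] in the
    direction [j]. *)
Let V z := 2^-1 * (g (A x0 j 1 z) - g (A x0 j (-1) z)).

Let cbox_disk s z : `|s| = 1 -> cbox (- d) d 0 d z -> disk (A x0 j s z).
Proof.
move=> s1 [/=]; rewrite !in_itv /= => h1 h2; have := d0 => d0'.
by apply: (A_disk j (a := a)) => //; rewrite ler_norml -/d; lra.
Qed.

Let A_continuous s : continuous (A x0 j s).
Proof.
move=> z; apply: cvgD; first apply: cvgD; first exact: cvg_cst.
  by apply: cvgZr_tmp; exact: continuous_fst2.
apply: cvgZr_tmp; apply: cvgM; first exact: cvg_cst.
exact: continuous_snd2.
Qed.

Let barrier (k : R) z : 0 < k -> cbox (- d) d 0 d z -> V z + B k z <= 0.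
Proof.
move=> k0; have [g2 h2] := hg; have := d0 => d0'.
pose j' := other j.
pose W1 (i : 'I_2) z := if i == ord0
  then 2^-1 * (1 * g1 j' (A x0 j 1 z) - 1 * g1 j' (A x0 j (-1) z)) + (- K * (2 * z.1) + k * (2 * z.1))
  else 2^-1 * (1 * g1 j (A x0 j 1 z) - (-1) * g1 j (A x0 j (-1) z)) + - K * (2 * d - 2 * z.2).
pose W2 (i : 'I_2) z := if i == ord0
  then 2^-1 * (1 * (1 * g2 j' (A x0 j 1 z)) - 1 * (1 * g2 j' (A x0 j (-1) z))) + (- K * 2 + k * 2)
  else 2^-1 * (1 * (1 * g2 j (A x0 j 1 z)) - (-1) * (-1 * g2 j (A x0 j (-1) z))) + K * 2.
have oD s y : `|s| = 1 -> obox (- d) d 0 d y -> disk (A x0 j s y).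
  by move=> s1 yO; apply: cbox_disk => //; exact: sub_obox_cbox.
have n1 : `|1 : R| = 1 by rewrite normr1.
have nN1 : `|-1 : R| = 1 by rewrite normrN1.
apply: (@strict_max_principle _ (fun z => V z + B k z) W1 W2) => //.
- lra.
- exact: ltW.
- apply: continuous_in_subspaceT => y; rewrite inE => yC.
  apply: continuousD.
    apply: continuousM; first exact: cst_continuous.
    apply: continuousB; apply: continuous_comp; do ?exact: A_continuous.
      by have [] := h2 _ (cbox_disk n1 yC).
    by have [] := h2 _ (cbox_disk nN1 yC).
  have c1 := @continuous_fst2 R y; have c2 := @continuous_snd2 R y.
  apply: cvgD; apply: cvgM; do ?exact: cvg_cst.
    apply: cvgD; first by rewrite !expr2; apply: cvgM.
    by apply: cvgM => //; apply: cvgB => //; exact: cvg_cst.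
  by apply: cvgB; [rewrite !expr2; apply: cvgM|exact: cvg_cst].
- move=> y i yO.
  have [_ dp dp1 _] := h2 _ (oD _ _ n1 yO); have [_ dm dm1 _] := h2 _ (oD _ _ nN1 yO).
  move: i; apply: ord2P.
    have D1 : is_derive y (dir ord0) (fun z => g (A x0 j 1 z)) (1 * g1 j' (A x0 j 1 y)).
      by apply: is_derive_affine (dp j') => h; exact: A0.
    have D2 : is_derive y (dir ord0) (fun z => g (A x0 j (-1) z)) (1 * g1 j' (A x0 j (-1) y)).
      by apply: is_derive_affine (dm j') => h; exact: A0.
    by apply: is_derive_eq; rewrite /W1 /= /GRing.scale /=; ring.
  have D1 : is_derive y (dir ord_max) (fun z => g (A x0 j 1 z)) (1 * g1 j (A x0 j 1 y)).
    by apply: is_derive_affine (dp j) => h; exact: A1.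
  have D2 : is_derive y (dir ord_max) (fun z => g (A x0 j (-1) z)) (-1 * g1 j (A x0 j (-1) y)).
    by apply: is_derive_affine (dm j) => h; exact: A1.
  by apply: is_derive_eq; rewrite /W1 /= /GRing.scale /=; ring.
- move=> y i yO.
  have [_ dp dp1 _] := h2 _ (oD _ _ n1 yO); have [_ dm dm1 _] := h2 _ (oD _ _ nN1 yO).
  move: i; apply: ord2P; rewrite /W1 /W2 /=.
    have D1 : is_derive y (dir ord0) (fun z => g1 j' (A x0 j 1 z)) (1 * g2 j' (A x0 j 1 y)).
      by apply: is_derive_affine (dp1 j') => h; exact: A0.
    have D2 : is_derive y (dir ord0) (fun z => g1 j' (A x0 j (-1) z)) (1 * g2 j' (A x0 j (-1) y)).
      by apply: is_derive_affine (dm1 j') => h; exact: A0.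
    by apply: is_derive_eq; rewrite /= /GRing.scale /=; ring.
  have D1 : is_derive y (dir ord_max) (fun z => g1 j (A x0 j 1 z)) (1 * g2 j (A x0 j 1 y)).
    by apply: is_derive_affine (dp1 j) => h; exact: A1.
  have D2 : is_derive y (dir ord_max) (fun z => g1 j (A x0 j (-1) z)) (-1 * g2 j (A x0 j (-1) y)).
    by apply: is_derive_affine (dm1 j) => h; exact: A1.
  by apply: is_derive_eq; rewrite /= /GRing.scale /=; ring.
- move=> y yO; rewrite /W2 /=.
  have [_ _ _ Lp] := h2 _ (oD _ _ n1 yO); have [_ _ _ Lm] := h2 _ (oD _ _ nN1 yO).
  have L (x : R * R) : g2 ord0 x + g2 ord_max x = 0 -> g2 j' x = - g2 j x.
    rewrite /j' /other => h; case: ifPn => [/eqP ->|jn0]; first by lra.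
    have -> : j = ord_max by move: jn0; clear; move: j; apply: ord2P.
    by lra.
  by rewrite (L _ Lp) (L _ Lm); lra.
- move=> y yC yO.
  have Vle : V y <= M.
    have := gM (cbox_disk n1 yC); have := gM (cbox_disk nN1 yC).
    by rewrite /V !ler_norml; lra.
  case: (yC) => /=; rewrite !in_itv /= => /andP[y1 y2] /andP[y3 y4].
  have sq1 : y.1 ^+ 2 <= d ^+ 2 by nra.
  have kle : k * (y.1 ^+ 2 - d ^+ 2) <= 0 by rewrite pmulr_rle0 // subr_le0.
  have [y20|y20] := eqVneq y.2 0.
    have -> : V y = 0 by rewrite /V /A y20 !mulr0 subrr mulr0.
    rewrite add0r /B y20 mul0r addr0; have := sqr_ge0 y.1 => h.
    by have : 0 <= K * y.1 ^+ 2 by [exact: mulr_ge0]; lra.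
  have dle : d ^+ 2 <= y.1 ^+ 2 + y.2 * (2 * d - y.2).
    have [y2d|y2d] := eqVneq y.2 d; first by rewrite y2d; have := sqr_ge0 y.1; nra.
    have [y1d|y1d] := eqVneq (y.1 ^+ 2) (d ^+ 2).
      rewrite y1d lerDl mulr_ge0 //; lra.
    exfalso; apply: yO; split; rewrite /= in_itv /= !lt_neqAle ?y1 ?y2 ?y3 ?y4 !andbT.
      apply/andP; split; apply/eqP => E; move/eqP: y1d; apply.
        by rewrite -E sqrrN.
      by rewrite E.
    by rewrite eq_sym y20 y2d.
  have := ler_wpM2l K0 dle; rewrite KdM /B; lra.
Qed.

Lemma gradient_le : g1 j x0 <= 16 * M / a.
Proof.
have [g2 h2] := hg; have d0' := d0.
have Vle t : 0 < t <= d -> 2^-1 * (g (t *: dir j + x0) - g ((- t) *: dir j + x0)) <= K * (t * (2 * d - t)).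
  move=> /andP[t0 td]; have tC : cbox (- d) d 0 d (0, t).
    by split; rewrite /= in_itv /=; apply/andP; split; lra.
  have -> : 2^-1 * (g (t *: dir j + x0) - g ((- t) *: dir j + x0)) = V (0, t).
    by rewrite /V /A /= !scale0r addr0 mul1r mulN1r ![x0 + _]addrC.
  apply/ler_addgt0Pr => e e0.
  have k0 : 0 < e / d ^+ 2 by rewrite divr_gt0 // exprn_gt0.
  have := barrier k0 tC; rewrite /B /= expr0n /= add0r sub0r mulrN divfK; first by lra.
  by rewrite expf_neq0 // gt_eqF.
have [_ /(_ j) dg _ _] : [/\ {for x0, continuous g}, forall j, is_derive x0 (dir j) g (g1 j x0),
      forall j, is_derive x0 (dir j) (g1 j) (g2 j x0) &
      g2 ord0 x0 + g2 ord_max x0 = 0].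
  by apply: h2; apply/diskE; case/andP: a01 => a0 _; exact: lt_le_trans ax0.
pose phi (t : R) := g (t *: dir j + x0) - g ((- t) *: dir j + x0).
have D1 : is_derive (0 : R) 1 (fun t : R => g (t *: dir j + x0)) (g1 j x0).
  by apply: is_derive_line; rewrite scale0r add0r.
have D2 : is_derive (0 : R) 1 (fun t : R => g ((- t) *: dir j + x0)) (g1 j x0 * - 1).
  apply: (@is_derive1_comp _ (fun t : R => g (t *: dir j + x0)) (fun t => - t)).
  by rewrite oppr0.
have D : is_derive (0 : R) 1 phi (2 * g1 j x0).
  by apply: is_derive_eq; ring.
have [L LE] := D.
have cv : (fun h : R => h^-1 *: (phi (h *: 1 + 0) - phi 0)) @ 0^' --> 2 * g1 j x0.
  by rewrite -LE; exact: L.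
move: cv => /cvgr_dnbhsP /(_ (fun n => d * n.+1%:R^-1)) cv.
have {}cv : (d * n.+1%:R^-1)^-1 *: (phi ((d * n.+1%:R^-1) *: 1 + 0) - phi 0) @[n --> \oo] --> 2 * g1 j x0.
  apply: cv; split => [n|]; first by rewrite mulf_neq0 ?invr_eq0 // gt_eqF.
  by rewrite -[X in _ --> X](mulr0 d); apply: cvgM; [exact: cvg_cst|exact: cvg_harmonic].
have : 2 * g1 j x0 <= 2 * (2 * (K * d)).
  rewrite -(cvg_lim (@norm_hausdorff _ _) cv).
  apply: limr_le; first by apply/cvg_ex; eexists; exact: cv.
  apply: nearW => n; set t := d * _.
  have n0 : 0 < n.+1%:R^-1 :> R by [].
  have n1 : n.+1%:R^-1 <= 1 :> R by rewrite invf_le1 // ler1n.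
  have t0 : 0 < t by rewrite mulr_gt0.
  have td : t <= d by rewrite /t ler_piMr // ltW.
  have tt : 0 < t <= d by rewrite t0 td.
  have := Vle t tt.
  rewrite [t *: 1]mulr1 addr0 {2}/phi oppr0 subrr subr0 [_ *: phi t]mulrC ler_pdivrMr // -/(phi t).
  have := K0; nra.
have -> : K * d = 8 * M / a.
  have an0 : a != 0 by case/andP: a01 => a0 _; rewrite gt_eqF.
  by rewrite /K /d; field.
by lra.
Qed.

End Barrier.

(** Interior gradient estimate. The constant is not sharp; what matters is that it
    depends on [M] and on the depth alone. *)
Lemma gradient_bound (g : R * R -> R) g1 (M a : R) x0 j : harmonic_grad g g1 ->
  (forall x, disk x -> `|g x| <= M) -> 0 < a <= 1 -> a <= depth x0 ->
  `|g1 j x0| <= 16 * M / a.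
Proof.
move=> hg gM a01 ax0; rewrite ler_norml; apply/andP; split; last exact: (@gradient_le g g1 M a x0 j hg gM a01 ax0).
have := @gradient_le (fun x => -1 * g x) (fun j x => -1 * g1 j x) M a x0 j
  (harmonic_gradZ (-1) hg) _ a01 ax0.
rewrite mulN1r lerNl; apply => x Dx.
by rewrite normrM normrN1 mul1r; exact: gM.
Qed.

End GradientBound.

(** * Limits of harmonic functions *)

Section Limits.
Context {R : realType}.
Implicit Types x : R * R.

(** Uniform boundedness along the sequence on compact subsets of the disk: each of them
    lies in a set of positive depth. *)
Definition loc_bounded (F_ : nat -> R * R -> R) := forall a : R, 0 < a <= 1 ->
  exists C : R, forall n x, a <= depth x -> `|F_ n x| <= C.

Lemma depth_ge_disk (a : R) : 0 < a -> [set x | a <= depth x] `<=` disk.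
Proof. by move=> a0 x /= ax; apply/diskE; exact: lt_le_trans ax. Qed.

Lemma disk_depth_ge x : disk x -> exists2 a, 0 < a <= 1 & a <= depth x.
Proof.
move=> /diskE Dx; exists (depth x) => //; rewrite Dx /= /depth lerBlDl lerDr.
by rewrite addr_ge0 // sqr_ge0.
Qed.

Lemma loc_bounded_limit (F_ : nat -> R * R -> R) (F : R * R -> R) : loc_bounded F_ ->
  (forall x, disk x -> F_ n x @[n --> \oo] --> F x) ->
  forall a : R, 0 < a <= 1 -> exists C : R, forall x, a <= depth x -> `|F x| <= C.
Proof.
move=> lb cv a a01; have [C hC] := lb a a01; exists C => x ax.
have Dx : disk x by case/andP: a01 => a0 _; exact: (depth_ge_disk a0).
have cvn : `|F_ n x| @[n --> \oo] --> `|F x| by apply: cvg_norm; exact: cv.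
rewrite -(cvg_lim (@norm_hausdorff _ _) cvn).
apply: limr_le; first by apply/cvg_ex; eexists; exact: cvn.
by apply: nearW => n; exact: hC.
Qed.

Lemma loc_bounded_loc_integrable (F : R * R -> R) : @measurable_fun _ _ (plane R) R disk F ->
  (forall a : R, 0 < a <= 1 -> exists C : R, forall x, a <= depth x -> `|F x| <= C) ->
  loc_integrable F.
Proof.
move=> mF lb; split => // K cK Kd; have [a a01 Ka] := compact_sub_depth cK Kd.
have [C hC] := lb a a01.
apply: (@bounded_integrable_plane _ _ _ C).
- exact: compact_plane_measurable.
- by move=> x /Kd; rewrite /disk /cdisk /=; exact: ltW.
- by apply: measurable_funS mF => //; exact: measurable_disk.
- by move=> x Kx; apply: hC; exact: Ka.
Qed.

Lemma measurable_disk_limit (F_ : nat -> R * R -> R) (F : R * R -> R) :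
  (forall n, @measurable_fun _ _ (plane R) R disk (F_ n)) ->
  (forall x, disk x -> F_ n x @[n --> \oo] --> F x) ->
  @measurable_fun _ _ (plane R) R disk F.
Proof.
by move=> mF cv; exact: (@measurable_fun_cvg _ (plane R) R disk F_).
Qed.

Lemma test_integral_cvg (F_ : nat -> R * R -> R) (F h : R * R -> R) :
  (forall n, @measurable_fun _ _ (plane R) R disk (F_ n)) -> loc_bounded F_ ->
  (forall x, disk x -> F_ n x @[n --> \oo] --> F x) -> test_function h ->
  \int[leb2]_(x in disk) (F_ n x * h x) @[n --> \oo] --> \int[leb2]_(x in disk) (F x * h x).
Proof.
move=> mF lb cv th; have [sh [K [cK Kd h0]]] := th.
have md := @measurable_disk R.
have mFl := measurable_disk_limit mF cv.
have [a a01 Ka] := compact_sub_depth cK Kd.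
have [C hC] := lb a a01.
have [M hM] := test_bounded th.
have mh : @measurable_fun _ _ (plane R) R disk h by exact: test_measurable.
have m1 n : @measurable_fun _ _ (plane R) _ disk (fun x => (F_ n x * h x)%:E).
  by apply/measurable_EFinP; exact: measurable_funM.
have m2 : @measurable_fun _ _ (plane R) _ disk (fun x => (F x * h x)%:E).
  by apply/measurable_EFinP; exact: measurable_funM.
have cvF : {ae leb2, forall x, disk x -> (F_ n x * h x)%:E @[n --> \oo] --> (F x * h x)%:E}.
  apply: aeW => x Dx; apply/cvg_EFin; first exact: nearW.
  by apply: cvgM; [exact: cv|exact: cvg_cst].
have ID : leb2.-integrable disk (EFin \o (fun x => `|C| * `|M|)).
  apply: (@bounded_integrable_plane _ _ _ (`|C| * `|M|)) => //.
    by move=> x; rewrite /disk /cdisk /=; exact: ltW.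
  by move=> x _; rewrite ger0_norm // mulr_ge0.
have dom : {ae leb2, forall x n, disk x -> (`|(F_ n x * h x)%:E| <= (`|C| * `|M|)%:E)%E}.
  apply: aeW => x n _; rewrite lee_fin normrM.
  have [Kx|Kx] := pselect (K x); last by rewrite h0 // normr0 mulr0 mulr_ge0.
  apply: ler_pM => //; first by apply: le_trans (ler_norm _); apply: hC; exact: Ka.
  by apply: le_trans (ler_norm _); exact: hM.
have [_ _ cvI] := @dominated_convergence _ (plane R) R leb2 disk md _ _ _ m1 m2 cvF ID dom.
apply: fine_cvg; move: cvI; rewrite /= fineK //.
have lF := loc_bounded_loc_integrable mFl (loc_bounded_limit lb cv).
by apply: integrable_fin_num => //; exact: loc_integrable_test.
Qed.

(** Test functions have compact support, so that bounds on compact subsets suffice to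
    pass to the limit in the defining identity. *)
Lemma weak_partial_limit j (f_ g_ : nat -> R * R -> R) (f g : R * R -> R) :
  (forall n, weak_partial j (f_ n) (g_ n)) -> loc_bounded f_ -> loc_bounded g_ ->
  (forall x, disk x -> f_ n x @[n --> \oo] --> f x) ->
  (forall x, disk x -> g_ n x @[n --> \oo] --> g x) -> weak_partial j f g.
Proof.
move=> wp lf lg cf cg.
have mf n : @measurable_fun _ _ (plane R) R disk (f_ n) by have [[]] := wp n.
have mg n : @measurable_fun _ _ (plane R) R disk (g_ n) by have [_ []] := wp n.
split.
- apply: loc_bounded_loc_integrable; first exact: measurable_disk_limit cf.
  exact: loc_bounded_limit lf cf.
- apply: loc_bounded_loc_integrable; first exact: measurable_disk_limit cg.
  exact: loc_bounded_limit lg cg.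
- move=> h th.
  have c1 := test_integral_cvg mf lf cf (test_derive j th).
  have c2 : (- \int[leb2]_(x in disk) (g_ n x * h x)) @[n --> \oo] -->
      - \int[leb2]_(x in disk) (g x * h x).
    by apply: cvgN; exact: test_integral_cvg.
  have E : (fun n => \int[leb2]_(x in disk) (f_ n x * 'D_(dir j) h x)) =
      (fun n => - \int[leb2]_(x in disk) (g_ n x * h x)).
    by apply/funext => n; have [_ _] := wp n; apply.
  move: c1; rewrite E => c1.
  exact: (cvg_unique (@norm_hausdorff _ _) c1 c2).
Qed.

Lemma harmonic_weak_partial j (f : R * R -> R) (f1 : 'I_2 -> R * R -> R) : harmonic_grad f f1 ->
  (forall x, disk x -> {for x, continuous (f1 j)}) -> weak_partial j f (f1 j).
Proof.
move=> [f2 hf] cf1.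
have [lf lD wf] : weak_partial j f ('D_(dir j) f).
  apply: weak_partial_C1 => x Dx.
  - by have [] := hf x Dx.
  - by have [_ /(_ j)[]] := hf x Dx.
  - have E : {near x, f1 j =1 'D_(dir j) f}.
      have : nbhs x (disk : set (R * R)) by apply: open_nbhs_nbhs; split => //; exact: open_disk.
      by apply: filterS => y Dy; have [_ /(_ j)[_ ->]] := hf y Dy.
    move=> B; rewrite -(nbhs_singleton E) => /(cf1 x Dx) H.
    suff : \forall y \near x, B ('D_(dir j) f y) by [].
    have {}H : \forall y \near x, B (f1 j y) by exact: H.
    by move: E H; apply: filterS2 => y /= ->.
have E x : disk x -> 'D_(dir j) f x = f1 j x.
  by move=> Dx; have [_ /(_ j)[_ ->]] := hf x Dx.
split => //; first exact: continuous_loc_integrable.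
move=> h th; rewrite wf //; congr (- _); apply: eq_Rintegral => x.
by rewrite inE => /E ->.
Qed.

(** The gradient estimate, applied to differences, turns a uniform Cauchy sequence of
    harmonic functions into a Cauchy sequence of gradients. *)
Lemma harmonic_limit_grad (f_ : nat -> R * R -> R) (f1_ : nat -> 'I_2 -> R * R -> R) (f : R * R -> R) (M : R) :
  (forall n, harmonic_grad (f_ n) (f1_ n)) ->
  (forall n x, disk x -> `|f_ n x| <= M) ->
  (forall e, 0 < e -> \forall n \near \oo, forall x, disk x -> `|f_ n x - f x| <= e) ->
  forall j x, disk x -> cvgn (fun n => f1_ n j x).
Proof.
move=> hf fM uc j x Dx; have [a a01 ax] := disk_depth_ge Dx.
apply: cauchy_cvg; apply: cauchy_exP => e e0.
have a0 : 0 < a by case/andP: a01.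
pose d := e * a / 64.
have d0 : 0 < d by rewrite divr_gt0 // mulr_gt0.
have [N _ hN] := uc d d0.
exists (f1_ N j x); exists N => // n /= Nn; rewrite -ball_normE /=.
have B : forall y, disk y -> `|f_ N y - f_ n y| <= 2 * d.
  move=> y Dy; have := hN N (leqnn N) y Dy; have := hN n Nn y Dy.
  by rewrite !ler_norml; lra.
have := gradient_bound j (harmonic_gradB (hf N) (hf n)) B a01 ax.
move/le_lt_trans; apply; rewrite /d ltr_pdivrMr //.
by have : 0 < e * a by [exact: mulr_gt0]; lra.
Qed.

End Limits.

(** * Jacobian, energy density and area *)

Section Jacobian.
Context {R : realType}.
Implicit Types A B : 'M[R]_(4, 2).

Definition sqcol A j : R := \sum_i A i j ^+ 2.
Definition dotcols A : R := \sum_i A i ord0 * A i ord_max.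
Definition sqnorm A : R := sqcol A ord0 + sqcol A ord_max.

Lemma det2 (B : 'M[R]_2) :
  \det B = B ord0 ord0 * B ord_max ord_max - B ord0 ord_max * B ord_max ord0.
Proof.
rewrite (expand_det_row _ ord0) !big_ord_recl big_ord0 addr0 /cofactor !det_mx11 !mxE /=.
have -> : lift ord0 ord0 = ord_max :> 'I_2 by exact: val_inj.
have -> : lift ord_max ord0 = ord0 :> 'I_2 by exact: val_inj.
by rewrite expr0 mul1r expr1 mulN1r mulrN.
Qed.

Lemma jacobianE A : jac A = Num.sqrt (sqcol A ord0 * sqcol A ord_max - dotcols A ^+ 2).
Proof.
have E (i j : 'I_2) : (A^T *m A : 'M[R]_2) i j = \sum_k A k i * A k j.
  by rewrite !mxE; apply: eq_bigr => k _; rewrite !mxE.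
rewrite /Defs.jacobian det2 !E /sqcol /dotcols expr2; congr (Num.sqrt (_ * _ - _ * _)).
- by apply: eq_bigr => i _; rewrite mulrC.
Qed.

Lemma sqcol_ge0 A j : 0 <= sqcol A j.
Proof. by apply: sumr_ge0 => i _; exact: sqr_ge0. Qed.

Lemma sqnorm_ge0 A : 0 <= sqnorm A.
Proof. by rewrite addr_ge0 // sqcol_ge0. Qed.

Lemma jacobian_ge0 A : 0 <= jac A.
Proof. exact: sqrtr_ge0. Qed.

(** Hadamard's inequality and the inequality between the geometric and the arithmetic
    mean; both are equalities for orthogonal columns of the same length, which is the
    case of a conformal map. *)
Lemma jacobian_le A : jac A <= 2^-1 * sqnorm A.
Proof.
rewrite jacobianE /sqnorm.
have := sqcol_ge0 A ord0; have := sqcol_ge0 A ord_max.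
move: (sqcol A ord0) (sqcol A ord_max) (dotcols A) => p q r q0 p0.
rewrite -[leRHS]ger0_norm ?mulr_ge0 ?addr_ge0 // -sqrtr_sqr ler_wsqrtr //.
have := sqr_ge0 r; have := sqr_ge0 (p - q); nra.
Qed.

Lemma jacobian_conformal A : sqcol A ord0 = sqcol A ord_max -> dotcols A = 0 ->
  jac A = 2^-1 * sqnorm A.
Proof.
move=> E d0; rewrite jacobianE /sqnorm d0 E expr0n subr0 -expr2 sqrtr_sqr.
by rewrite ger0_norm ?sqcol_ge0 //; lra.
Qed.

Lemma measurable_sqnorm (D : set (R * R)) (M : R * R -> 'M[R]_(4, 2)) :
  (forall i j, @measurable_fun _ _ (plane R) R D (fun x => M x i j)) ->
  @measurable_fun _ _ (plane R) R D (fun x => sqnorm (M x)).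
Proof.
move=> mM; apply: measurable_funD; apply: measurable_sum => i;
  by apply: measurable_funX.
Qed.

Lemma measurable_jacobian (D : set (R * R)) (M : R * R -> 'M[R]_(4, 2)) :
  (forall i j, @measurable_fun _ _ (plane R) R D (fun x => M x i j)) ->
  @measurable_fun _ _ (plane R) R D (fun x => jac (M x)).
Proof.
move=> mM; under eq_fun do rewrite jacobianE.
have ms : measurable_fun setT (Num.sqrt : R -> R).
  by apply: continuous_measurable_fun; exact: sqrt_continuous.
apply: (measurableT_comp ms).
apply: measurable_funB; first by apply: measurable_funM; apply: measurable_sum => i; exact: measurable_funX.
apply: measurable_funX; apply: measurable_sum => i; exact: measurable_funM.
Qed.

Lemma cvgn_sum n (F_ : nat -> 'I_n -> R) (F : 'I_n -> R) :
  (forall i, F_ k i @[k --> \oo] --> F i) ->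
  \sum_i F_ k i @[k --> \oo] --> \sum_i F i.
Proof.
elim: n F_ F => [|n IH] F_ F cF.
  by under eq_fun do rewrite big_ord0; rewrite big_ord0; exact: cvg_cst.
under eq_fun do rewrite big_ord_recl; rewrite big_ord_recl.
by apply: cvgD => //; exact: IH.
Qed.

Lemma cvg_jacobian (A_ : nat -> 'M[R]_(4, 2)) A :
  (forall i j, A_ n i j @[n --> \oo] --> A i j) -> jac (A_ n) @[n --> \oo] --> jac A.
Proof.
move=> cA; under eq_fun do rewrite jacobianE; rewrite jacobianE.
apply: (@continuous_cvg _ _ _ _ _ _ Num.sqrt); first exact: sqrt_continuous.
have cs j : sqcol (A_ n) j @[n --> \oo] --> sqcol A j.
  by apply: cvgn_sum => i; rewrite !expr2; apply: cvgM.
apply: cvgB; first exact: cvgM.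
by rewrite expr2; apply: cvgM; apply: cvgn_sum => i; exact: cvgM.
Qed.

Lemma cvg_sqnorm (A_ : nat -> 'M[R]_(4, 2)) A :
  (forall i j, A_ n i j @[n --> \oo] --> A i j) -> sqnorm (A_ n) @[n --> \oo] --> sqnorm A.
Proof.
move=> cA; have cs j : sqcol (A_ n) j @[n --> \oo] --> sqcol A j.
  by apply: cvgn_sum => i; rewrite !expr2; apply: cvgM.
exact: cvgD.
Qed.

Lemma weak_differential_unique (v : R * R -> 'rV[R]_4) Dv Dv' :
  weak_differential v Dv -> weak_differential v Dv' ->
  {ae leb2, forall x, disk x -> Dv x = Dv' x}.
Proof.
move=> wD wD'.
have : {ae leb2, forall x, forall ij : 'I_4 * 'I_2, disk x -> Dv x ij.1 ij.2 = Dv' x ij.1 ij.2}.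
  by apply: ae_forall_countable => -[i j]; exact: weak_partial_unique (wD i j) (wD' i j).
by apply: ae_imp => x E Dx; apply/matrixP => i j; exact: (E (i, j) Dx).
Qed.

Lemma measurable_weak_differential (v : R * R -> 'rV[R]_4) Dv i j :
  weak_differential v Dv -> @measurable_fun _ _ (plane R) R disk (fun x => Dv x i j).
Proof. by move=> /(_ i j)[_ []]. Qed.

(** The area may be computed with any weak differential, since two of them agree
    almost everywhere. *)
Lemma area_weakE (v : R * R -> 'rV[R]_4) Dv : weak_differential v Dv ->
  area v = (\int[leb2]_(x in disk) (jac (Dv x))%:E)%E.
Proof.
move=> wD; rewrite /area; case: asboolP => [eD|]; last by case; exists Dv.
have wG := getPex eD.
apply: ge0_ae_eq_integral.
- exact: measurable_disk.
- by apply/measurable_EFinP; apply: measurable_jacobian => i j; exact: measurable_weak_differential wG.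
- by apply/measurable_EFinP; apply: measurable_jacobian => i j; exact: measurable_weak_differential wD.
- by move=> x _; rewrite lee_fin jacobian_ge0.
- by move=> x _; rewrite lee_fin jacobian_ge0.
- by have := weak_differential_unique wG wD; apply: ae_imp => x E Dx; rewrite (E Dx).
Qed.

End Jacobian.

(** * Cutoff functions along the circle *)

Section Cutoff.
Context {R : realType}.
Implicit Types x : R * R.

Let flat1' : R -> R := flat (flat_deriv 1).

Let flat1'_bounds s : 0 <= flat1' s <= 2.
Proof.
rewrite /flat1' /flat; case: ifP => s0; last by rewrite lexx /=.
have y0 : 0 < s^-1 by rewrite invr_gt0.
have d1 : deriv (1 : {poly R}) = 0 by rewrite -polyC1 derivC.
rewrite /flat_deriv d1 subr0 mul1r hornerXn expRN mulr_ge0 ?sqr_ge0 ?invr_ge0 ?expR_ge0 //=.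
rewrite ler_pdivrMr ?expR_gt0 //.
have := @expR_ge1Dxn R s^-1 1 (ltW y0); rewrite (_ : 2`!%:R = 2) // => h.
by rewrite mulrC -ler_pdivrMr //; lra.
Qed.

Let flat1'_le0 s : s <= 0 -> flat1' s = 0.
Proof. by rewrite /flat1' /flat leNgt => /negbTE ->. Qed.

Let flat1_ge s : 2^-1 <= s -> expR (- 2) <= flat1 s :> R.
Proof.
move=> s1; have s0 : 0 < s by lra.
rewrite /flat1 /flat s0 hornerE mul1r ler_expR lerN2 -[leRHS]invrK lef_pV2 ?posrE //; lra.
Qed.

Lemma derive_depth j x : disk x -> `|'D_(dir j) depth x| <= 2.
Proof.
move=> /diskE /ltW /depth_bounded[x1 x2].
have D : is_derive x (dir j) depth (- (2 * x.1 * (dir j).1 + 2 * x.2 * (dir j).2)).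
  have d1 := @is_derive_fst R x (dir j); have d2 := @is_derive_snd R x (dir j).
  by apply: is_derive_eq; rewrite /GRing.scale /=; ring.
have [_ ->] := D; rewrite normrN /dir; case: ifP => _ /=.
  by rewrite !mulr1 mulr0 addr0 normrM ger0_norm //; lra.
by rewrite !mulr1 mulr0 add0r normrM ger0_norm //; lra.
Qed.

(** With [n] and [p] flat functions of [2 - depth / d] and [depth / d - 1], the cutoff is
    [n / (n + p)]. At each point one of the two arguments is at least 1/2, which keeps
    the denominator away from zero by a bound that does not depend on [d]; each
    derivative of [depth / d] costs one factor [1 / d]. *)
Lemma cutoff_exists : exists2 C : R, 0 < C & forall d, 0 < d ->
  exists lam : R * R -> R, [/\ smooth lam,
    forall x, 0 <= lam x <= 1,
    forall x, depth x <= d -> lam x = 1 /\ forall j, 'D_(dir j) lam x = 0,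
    forall x, 2 * d <= depth x -> lam x = 0 /\ forall j, 'D_(dir j) lam x = 0 &
    forall j x, disk x -> `|'D_(dir j) lam x| <= C / d].
Proof.
exists (8 * (expR (- 2))^-1) => [|d d0]; first by rewrite mulr_gt0 // invr_gt0 expR_gt0.
pose q1 x := 2 + - (d^-1 * depth x); pose q2 x := d^-1 * depth x + - 1.
pose n x := flat1 (q1 x); pose p x := flat1 (q2 x).
have sq0 : smooth (fun x => d^-1 * depth x).
  by apply: smoothM; [exact: smooth_cst|exact: smooth_depth].
have sq1 : smooth q1 by apply: smoothD; [exact: smooth_cst|exact: smoothN].
have sq2 : smooth q2 by apply: smoothD => //; exact: smooth_cst.
have sn : smooth n by exact: smooth_flat.
have sp : smooth p by exact: smooth_flat.
have m0 : 0 < expR (- 2) :> R by exact: expR_gt0.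
have np_ge x : expR (- 2) <= n x + p x.
  have [h|h] := leP (d^-1 * depth x) (3 / 2).
    apply: (le_trans (@flat1_ge (q1 x) _)); first by rewrite /q1; lra.
    by rewrite lerDl flat1_ge0.
  apply: (le_trans (@flat1_ge (q2 x) _)); first by rewrite /q2; lra.
  by rewrite lerDr flat1_ge0.
have np0 x : 0 < n x + p x by exact: lt_le_trans (np_ge x).
have npn0 x : n x + p x != 0 by rewrite gt_eqF.
have snp : smooth (n \+ p) by exact: smoothD.
pose lam x := n x * (n x + p x)^-1.
have slam : smooth lam by apply: smoothM => //; exact: smoothV.
have n0 x : 0 <= n x by exact: flat1_ge0.
have p0 x : 0 <= p x by exact: flat1_ge0.
have lam01 x : 0 <= lam x <= 1.
  rewrite /lam divr_ge0 ?addr_ge0 //= ler_pdivrMr // mul1r lerDl //.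
have Dq0 j x : 'D_(dir j) (fun x => d^-1 * depth x) x = d^-1 * 'D_(dir j) depth x.
  by rewrite deriveMl //; exact: smooth_derivable smooth_depth.
have Dq1 j x : is_derive x (dir j) q1 (- (d^-1 * 'D_(dir j) depth x)).
  have := smooth_is_derive x j sq0; rewrite Dq0 => D0.
  by apply: is_derive_eq; rewrite add0r.
have Dq2 j x : is_derive x (dir j) q2 (d^-1 * 'D_(dir j) depth x).
  have := smooth_is_derive x j sq0; rewrite Dq0 => D0.
  by apply: is_derive_eq; rewrite ?oppr0 ?addr0.
have Dn j x : 'D_(dir j) n x = flat1' (q1 x) * - (d^-1 * 'D_(dir j) depth x).
  by have [_ <-] := is_derive_comp1 (Dq1 j x) (is_derive_flat 1 (q1 x)).
have Dp j x : 'D_(dir j) p x = flat1' (q2 x) * (d^-1 * 'D_(dir j) depth x).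
  by have [_ <-] := is_derive_comp1 (Dq2 j x) (is_derive_flat 1 (q2 x)).
have Dlam j x : 'D_(dir j) lam x =
    ((1 - lam x) * 'D_(dir j) n x - lam x * 'D_(dir j) p x) / (n x + p x).
  have E : n = lam \* (n \+ p) by apply/funext => y; rewrite /lam /= divfK.
  have : 'D_(dir j) n x = lam x *: 'D_(dir j) (n \+ p) x + (n x + p x) *: 'D_(dir j) lam x.
    rewrite {1}E; apply: deriveM; exact: smooth_derivable.
  have -> : 'D_(dir j) (n \+ p) x = 'D_(dir j) n x + 'D_(dir j) p x.
    by apply: deriveD; exact: smooth_derivable.
  rewrite /GRing.scale /= => H; apply: (mulIf (npn0 x)); rewrite divfK //.
  by rewrite mulrBl mul1r {1}H; ring.
exists lam; split => //.
- move=> x xd; have r1 : d^-1 * depth x <= 1 by rewrite mulrC ler_pdivrMr // mul1r.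
  have px : p x = 0 by rewrite /p flat1_le0 // /q2; lra.
  have l1 : lam x = 1 by rewrite /lam px addr0 divff //; have := npn0 x; rewrite px addr0.
  by split => // j; rewrite Dlam l1 subrr mul0r Dp flat1'_le0 ?mul0r ?mulr0 ?subrr ?mul0r // /q2; lra.
- move=> x xd; have r1 : 2 <= d^-1 * depth x by rewrite mulrC ler_pdivlMr.
  have nx : n x = 0 by rewrite /n flat1_le0 // /q1; lra.
  have l1 : lam x = 0 by rewrite /lam nx mul0r.
  by split => // j; rewrite Dlam l1 mul0r Dn flat1'_le0 ?mul0r ?mulr0 ?subrr ?mul0r // /q1; lra.
- move=> j x Dx; rewrite Dlam normrM normfV (gtr0_norm (np0 x)).
  have dd : `|d^-1 * 'D_(dir j) depth x| <= 2 / d.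
    rewrite normrM gtr0_norm ?invr_gt0 // mulrC ler_pM2r ?invr_gt0 //.
    exact: derive_depth.
  have D2 : 0 <= 2 / d by rewrite divr_ge0 // ltW.
  have hn : `|'D_(dir j) n x| <= 2 * (2 / d).
    rewrite Dn normrM normrN; apply: ler_pM => //.
    by have /andP[a0 a1] := flat1'_bounds (q1 x); rewrite ger0_norm.
  have hp : `|'D_(dir j) p x| <= 2 * (2 / d).
    rewrite Dp normrM; apply: ler_pM => //.
    by have /andP[a0 a1] := flat1'_bounds (q2 x); rewrite ger0_norm.
  have /andP[] := lam01 x; move: (lam x) => l l0 l1.
  rewrite mulrAC; apply: ler_pM => //.
  + by rewrite invr_ge0 ltW.
  + apply: (le_trans (ler_normB _ _)); rewrite !normrM.
    rewrite (ger0_norm l0) ger0_norm ?subr_ge0 //.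
    have E8 : 8 / d = 2 * (2 * (2 / d)) by field; rewrite gt_eqF.
    rewrite E8; apply: (@le_trans _ _ ((1 - l) * (2 * (2 / d)) + l * (2 * (2 / d)))).
      by apply: lerD; apply: ler_wpM2l => //; rewrite subr_ge0.
    by rewrite -mulrDl subrK mul1r; lra.
  + by rewrite lef_pV2 ?posrE.
Qed.

End Cutoff.

(** * Gluing two maps by a cutoff *)

Section SquareIntegrable.
Context {R : realType}.
Implicit Types f g phi : R * R -> R.

Lemma square_integrableP f : @measurable_fun _ _ (plane R) R disk f ->
  square_integrable f <-> leb2.-integrable disk (EFin \o (fun x => f x ^+ 2)).
Proof.
move=> mf; split => [[_ If]|/integrableP[_ If]].
  apply/integrableP; split; first by apply/measurable_EFinP; exact: measurable_funX.
  move: If; congr (_ < _)%E; apply: eq_integral => x _ /=.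
  by rewrite ger0_norm // sqr_ge0.
split => //; move: If; congr (_ < _)%E; apply: eq_integral => x _ /=.
by rewrite ger0_norm // sqr_ge0.
Qed.

Lemma square_integrableD f g : square_integrable f -> square_integrable g ->
  square_integrable (f \+ g).
Proof.
move=> sf sg; have mf := sf.1; have mg := sg.1; have md := @measurable_disk R.
have mfg : @measurable_fun _ _ (plane R) R disk (f \+ g) by exact: measurable_funD.
apply/square_integrableP => //.
have If := (square_integrableP mf).1 sf; have Ig := (square_integrableP mg).1 sg.
have I2 := integrableD md (integrableZl md 2 If) (integrableZl md 2 Ig).
apply: le_integrable I2 => //.
  by apply/measurable_EFinP; exact: measurable_funX.
move=> x _ /=; rewrite lee_fin [leLHS]ger0_norm ?sqr_ge0 //.
apply: le_trans (ler_norm _); have := sqr_ge0 (f x - g x); nra.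
Qed.

Lemma square_integrableM f phi (M : R) : square_integrable f ->
  @measurable_fun _ _ (plane R) R disk phi -> (forall x, disk x -> `|phi x| <= M) ->
  square_integrable (f \* phi).
Proof.
move=> sf mphi pM; have mf := sf.1; have md := @measurable_disk R.
have mfp : @measurable_fun _ _ (plane R) R disk (f \* phi) by exact: measurable_funM.
apply/square_integrableP => //.
have If := (square_integrableP mf).1 sf.
apply: le_integrable (integrableZl md (M ^+ 2) If) => //.
  by apply/measurable_EFinP; exact: measurable_funX.
move=> x Dx /=; rewrite lee_fin [leLHS]ger0_norm ?sqr_ge0 //.
apply: le_trans (ler_norm _); rewrite exprMn mulrC ler_wpM2r ?sqr_ge0 //.
rewrite -real_normK ?num_real // ler_pXn2r ?nnegrE //; first exact: pM.
exact: le_trans (pM x Dx).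
Qed.

Lemma square_integrable_bounded f (M : R) : @measurable_fun _ _ (plane R) R disk f ->
  (forall x, disk x -> `|f x| <= M) -> square_integrable f.
Proof.
move=> mf fM; apply/square_integrableP => //.
apply: (@bounded_integrable_plane _ _ _ (M ^+ 2)).
- exact: measurable_disk.
- by move=> x; rewrite /disk /cdisk /=; exact: ltW.
- exact: measurable_funX.
- move=> x Dx; rewrite normrX ler_pXn2r ?nnegrE //; first exact: fM.
  exact: le_trans (fM x Dx).
Qed.

Lemma ae_bounded_square_integrable f (M : R) : @measurable_fun _ _ (plane R) R disk f ->
  {ae leb2, forall x, disk x -> `|f x| <= M} -> square_integrable f.
Proof.
move=> mf fM; split => //; have md := @measurable_disk R.
apply: (@le_lt_trans _ _ (\int[leb2]_(x in disk) (M ^+ 2)%:E)%E).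
  apply: ae_ge0_le_integral => //.
  - by move=> x _; rewrite lee_fin sqr_ge0.
  - by apply/measurable_EFinP; exact: measurable_funX.
  - by move=> x _; rewrite lee_fin sqr_ge0.
  move: fM; apply: ae_imp => x fM Dx; rewrite lee_fin -real_normK ?num_real //.
  by rewrite ler_pXn2r ?nnegrE //; [exact: fM|exact: le_trans (fM Dx)].
rewrite integral_cst //; apply: lte_mul_pinfty => //; first by rewrite lee_fin sqr_ge0.
by apply: leb2_cdisk_lty => // x; rewrite /disk /cdisk /=; exact: ltW.
Qed.

Lemma smooth_bounded_disk phi : smooth phi ->
  exists M : R, forall x, disk x -> `|phi x| <= M.
Proof.
move=> sphi; have : compact (phi @` [set x | 0 <= depth x]).
  apply: (@continuous_compact _ _ phi); last exact: compact_depth_ge.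
  by apply: continuous_subspaceT; exact: smooth_continuous.
move=> /compact_bounded [M [_ /(_ (M + 1))]]; rewrite ltrDl ltr01 => /(_ isT) hM.
by exists (M + 1) => x Dx; apply: hM; exists x => //=; exact/ltW/diskE.
Qed.

Lemma smooth_measurable_disk phi : smooth phi -> @measurable_fun _ _ (plane R) R disk phi.
Proof.
by move=> /smooth_continuous cp; apply: continuous_plane_measurable => //; exact: measurable_disk.
Qed.

Lemma square_integrable_smooth f phi : square_integrable f -> smooth phi ->
  square_integrable (f \* phi).
Proof.
move=> sf sphi; have [M hM] := smooth_bounded_disk sphi.
by apply: (@square_integrableM _ _ M) => //; exact: smooth_measurable_disk.
Qed.

End SquareIntegrable.

Section Blend.
Context {R : realType}.
Implicit Types (u v : R * R -> 'rV[R]_4) (Du Dv : R * R -> 'M[R]_(4, 2)) (lam : R * R -> R).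

Definition blend lam u v x : 'rV[R]_4 := lam x *: u x + (1 - lam x) *: v x.

Definition blend_diff lam u v Du Dv (x : R * R) : 'M[R]_(4, 2) :=
  \matrix_(i, j) (lam x * Du x i j + (1 - lam x) * Dv x i j +
    (u x ord0 i - v x ord0 i) * 'D_(dir j) lam x).

Let blend_component lam u v i : component (blend lam u v) i =
  (component u i \* lam) \+ (component v i \* (fun x => 1 + - lam x)).
Proof. by apply/funext => x; rewrite /component /blend !mxE /= mulrC [_ * v _ _ _]mulrC. Qed.

Let smooth_compl lam : smooth lam -> smooth (fun x => 1 + - lam x).
Proof. by move=> sl; apply: smoothD; [exact: smooth_cst|exact: smoothN]. Qed.

Let derive_compl lam j x : smooth lam ->
  'D_(dir j) (fun x => 1 + - lam x) x = - 'D_(dir j) lam x.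
Proof.
move=> sl; have D := smooth_is_derive x j sl.
have [_ ->] : is_derive x (dir j) (fun x => 1 + - lam x) (- 'D_(dir j) lam x).
  by apply: is_derive_eq; rewrite add0r.
by [].
Qed.

Lemma weak_differential_blend lam u v Du Dv : smooth lam ->
  weak_differential u Du -> weak_differential v Dv ->
  weak_differential (blend lam u v) (blend_diff lam u v Du Dv).
Proof.
move=> sl wu wv i j; rewrite blend_component.
have := weak_partialD (weak_partialM sl (wu i j)) (weak_partialM (smooth_compl sl) (wv i j)).
congr weak_partial; apply/funext => x; rewrite !mxE /= derive_compl // /component.
ring.
Qed.

Lemma W12_blend lam u v : smooth lam -> W12 u -> W12 v -> W12 (blend lam u v).
Proof.
move=> sl [su [Du wu sDu]] [sv [Dv wv sDv]]; have sc := smooth_compl sl; split.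
  by move=> i; rewrite blend_component; apply: square_integrableD; exact: square_integrable_smooth.
exists (blend_diff lam u v Du Dv); first exact: weak_differential_blend.
move=> i j; rewrite (_ : (fun x => _) =
  ((fun x => Du x i j) \* lam \+ (fun x => Dv x i j) \* (fun x => 1 + - lam x)) \+
  (component u i \* 'D_(dir j) lam \+ component v i \* \- 'D_(dir j) lam)).
  have sdl := @smooth_derive _ _ j sl.
  by apply: square_integrableD; apply: square_integrableD; apply: square_integrable_smooth => //;
    exact: smoothN.
apply/funext => x; rewrite !mxE /= /component.
ring.
Qed.

(** Only the values on the circle enter the spanning condition, so the monotone
    parametrization of [u] serves for the glued map. *)
Lemma spans_blend g lam u v : smooth lam -> (forall x, circle x -> lam x = 1) ->
  spans g u -> {within cdisk, continuous v} -> W12 v -> spans g (blend lam u v).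
Proof.
move=> sl l1 [cu wu [phi [cphi sphi mphi uphi]]] cv wv; split.
- have c1 : {within cdisk, continuous lam}.
    by apply: continuous_subspaceT; exact: smooth_continuous.
  have c2 : {within cdisk, continuous (fun x => 1 + - lam x)}.
    by apply: continuous_subspaceT; exact/smooth_continuous/smooth_compl.
  by rewrite /blend => x; apply: cvgD; apply: cvgZ; [exact: c1|exact: cu|exact: c2|exact: cv].
- exact: W12_blend.
- exists phi; split => // x Cx.
  by rewrite /blend l1 // subrr scale0r addr0 scale1r uphi.
Qed.

Lemma sqnorm_blend_le lam u v Du Dv (C : R) x : 0 <= lam x <= 1 ->
  (forall j, `|'D_(dir j) lam x| <= C) ->
  sqnorm (blend_diff lam u v Du Dv x) <=
  3 * (sqnorm (Dv x) + sqnorm (Du x) + 2 * C ^+ 2 * \sum_i (u x ord0 i - v x ord0 i) ^+ 2).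
Proof.
move=> /andP[l0 l1] lC.
have C2 j : 'D_(dir j) lam x ^+ 2 <= C ^+ 2.
  have C0 : 0 <= C by apply: le_trans (lC ord0).
  by rewrite -real_normK ?num_real // ler_pXn2r ?nnegrE.
have col j : sqcol (blend_diff lam u v Du Dv x) j <=
    3 * (sqcol (Dv x) j + sqcol (Du x) j + C ^+ 2 * \sum_i (u x ord0 i - v x ord0 i) ^+ 2).
  rewrite /sqcol mulr_sumr -!big_split /= mulr_sumr; apply: ler_sum => i _.
  rewrite mxE; have := C2 j; move: ('D_(dir j) lam x) (u x ord0 i - v x ord0 i) (Du x i j) (Dv x i j) => D w a b D2.
  have h1 : (lam x * a) ^+ 2 <= a ^+ 2.
    by rewrite exprMn ler_piMl ?sqr_ge0 // exprn_ile1.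
  have h2 : ((1 - lam x) * b) ^+ 2 <= b ^+ 2.
    by rewrite exprMn ler_piMl ?sqr_ge0 // exprn_ile1 //; lra.
  have h3 : (w * D) ^+ 2 <= C ^+ 2 * w ^+ 2.
    by rewrite exprMn mulrC ler_wpM2r ?sqr_ge0.
  move: h1 h2 h3; move: (lam x * a) ((1 - lam x) * b) (w * D) (C ^+ 2 * w ^+ 2) => p q r s.
  have := sqr_ge0 (p - q); have := sqr_ge0 (p - r); have := sqr_ge0 (q - r); nra.
have := col ord0; have := col ord_max; rewrite /sqnorm; lra.
Qed.

End Blend.

(** * Comparing areas across a boundary layer *)

Section Comparison.
Context {R : realType}.
Implicit Types (u v : R * R -> 'rV[R]_4) (Du Dv : R * R -> 'M[R]_(4, 2)) (lam : R * R -> R).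

(** The cutoff of width [d] is 0 on [core d] and 1 on [rim d]; it varies in [layer d]. *)
Definition core (d : R) : set (R * R) := [set x | 2 * d <= depth x].
Definition layer (d : R) : set (R * R) := [set x | d < depth x < 2 * d].
Definition rim (d : R) : set (R * R) := [set x | 0 < depth x <= d].

Lemma measurable_core d : @measurable _ (plane R) (core d).
Proof. exact: measurable_depth_ge. Qed.

Lemma measurable_depth_itv (i : interval R) : @measurable _ (plane R) [set x | depth x \in i].
Proof.
have := @measurable_depth R setT measurableT measurableT [set` i] (measurable_itv i).
by rewrite setTI.
Qed.

Lemma measurable_layer d : @measurable _ (plane R) (layer d).
Proof.
rewrite (_ : layer d = [set x | depth x \in `]d, (2 * d)[%R]); first exact: measurable_depth_itv.
by apply/seteqP; split => x; rewrite /layer /= in_itv.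
Qed.

Lemma measurable_rim d : @measurable _ (plane R) (rim d).
Proof.
rewrite (_ : rim d = [set x | depth x \in `]0, d]%R]); first exact: measurable_depth_itv.
by apply/seteqP; split => x; rewrite /rim /= in_itv.
Qed.

Lemma disk_core_layer_rim d : 0 < d -> disk = core d `|` layer d `|` rim d.
Proof.
move=> d0; apply/seteqP; split => [x /diskE Dx|x].
  have [h|h] := leP (depth x) d; first by right; rewrite /rim /= Dx h.
  have [h'|h'] := leP (2 * d) (depth x); first by left; left.
  by left; right; rewrite /layer /= h h'.
move=> [[|]|]; rewrite /core /layer /rim /= => h; apply/diskE.
- by apply: lt_le_trans h; rewrite mulr_gt0.
- by case/andP: h => h _; exact: lt_trans h.
- by case/andP: h.
Qed.

Lemma core_disk d : 0 < d -> core d `<=` disk.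
Proof. by move=> d0 x cx; rewrite (disk_core_layer_rim d0); left; left. Qed.
Lemma layer_disk d : 0 < d -> layer d `<=` disk.
Proof. by move=> d0 x cx; rewrite (disk_core_layer_rim d0); left; right. Qed.
Lemma rim_disk d : 0 < d -> rim d `<=` disk.
Proof. by move=> d0 x cx; rewrite (disk_core_layer_rim d0); right. Qed.

Lemma integral_disk_split d (F : R * R -> \bar R) : 0 < d ->
  @measurable_fun _ _ (plane R) _ disk F -> (forall x, disk x -> 0 <= F x)%E ->
  (\int[leb2]_(x in disk) F x =
   \int[leb2]_(x in core d) F x + \int[leb2]_(x in layer d) F x + \int[leb2]_(x in rim d) F x)%E.
Proof.
move=> d0 mF F0; have mc := @measurable_core d; have ml := @measurable_layer d.
have mr := @measurable_rim d; have E := disk_core_layer_rim d0.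
have md := @measurable_disk R.
rewrite {1}E ge0_integral_setU //; last 4 first.
- exact: measurableU.
- by rewrite -E.
- by rewrite -E.
- apply/disj_setPS => x [[|]]; rewrite /core /layer /rim /= => h /andP[_ h'].
    by move: d0; rewrite ltNge; lra.
  by case/andP: h => h _; rewrite ltNge h' in h.
congr (_ + _)%E; rewrite ge0_integral_setU //.
- by apply: measurable_funS mF => // x; rewrite E; left.
- by move=> x h; apply: F0; rewrite E; left.
- apply/disj_setPS => x [] /[swap]; rewrite /core /layer /= => /andP[_ h] h'.
  by rewrite ltNge h' in h.
Qed.

(** The glued map agrees with [v] in the core and with [u] in the rim. The area of [u]
    over the rim occurs on both sides of the minimality inequality and cancels, which is
    where its finiteness is used. *)
Lemma layer_comparison g u v Du Dv lam (d C : R) : 0 < d ->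
  smooth lam -> (forall x, 0 <= lam x <= 1) ->
  (forall x, depth x <= d -> lam x = 1 /\ forall j, 'D_(dir j) lam x = 0) ->
  (forall x, 2 * d <= depth x -> lam x = 0 /\ forall j, 'D_(dir j) lam x = 0) ->
  (forall j x, disk x -> `|'D_(dir j) lam x| <= C / d) ->
  spans g u -> (forall w, spans g w -> (area u <= area w)%E) ->
  {within cdisk, continuous v} -> W12 v ->
  weak_differential u Du -> weak_differential v Dv -> (area u < +oo)%E ->
  (\int[leb2]_(x in core d) (jac (Du x))%:E <=
   area v + \int[leb2]_(x in layer d)
     (2^-1 * (3 * (sqnorm (Dv x) + sqnorm (Du x) +
       2 * (C / d) ^+ 2 * \sum_i (u x ord0 i - v x ord0 i) ^+ 2)))%:E)%E.
Proof.
move=> d0 sl l01 lr lc lC su umin cv wv wDu wDv ufin.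
pose w := blend lam u v; pose Dw := blend_diff lam u v Du Dv.
have sw : spans g w.
  apply: spans_blend => // x /circleE x0; have [] := lr x _ => //.
  by rewrite x0 ltW.
have wDw : weak_differential w Dw by exact: weak_differential_blend.
have := umin w sw.
have mj u' Du' : weak_differential u' Du' -> @measurable_fun _ _ (plane R) _ disk (fun x => (jac (Du' x))%:E).
  move=> wD; apply/measurable_EFinP; apply: measurable_jacobian => i j.
  exact: measurable_weak_differential wD.
have j0 (Du' : R * R -> 'M[R]_(4, 2)) x : (0 <= (jac (Du' x))%:E)%E by rewrite lee_fin jacobian_ge0.
rewrite (area_weakE wDu) (area_weakE wDw) => cmp.
have mc := @measurable_core d; have ml := @measurable_layer d; have mr := @measurable_rim d.
have md := @measurable_disk R.
have rfin : (\int[leb2]_(x in rim d) (jac (Du x))%:E)%E \is a fin_num.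
  rewrite ge0_fin_numE; last exact: integral_ge0.
  apply: le_lt_trans ufin; rewrite (area_weakE wDu); apply: ge0_subset_integral => //.
    exact: mj.
  exact: rim_disk.
have Ecore : (\int[leb2]_(x in core d) (jac (Dw x))%:E = \int[leb2]_(x in core d) (jac (Dv x))%:E)%E.
  apply: eq_integral => x; rewrite inE => /lc[l0 Dl0]; congr (jac _)%:E.
  by apply/matrixP => i j; rewrite mxE l0 Dl0 mul0r add0r subr0 mul1r mulr0 addr0.
have Erim : (\int[leb2]_(x in rim d) (jac (Dw x))%:E = \int[leb2]_(x in rim d) (jac (Du x))%:E)%E.
  apply: eq_integral => x; rewrite inE => /andP[_ /lr[l0 Dl0]]; congr (jac _)%:E.
  by apply/matrixP => i j; rewrite mxE l0 Dl0 subrr mul0r mul1r mulr0 !addr0.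
have cmp2 : (\int[leb2]_(x in core d) (jac (Du x))%:E + \int[leb2]_(x in rim d) (jac (Du x))%:E <=
   \int[leb2]_(x in core d) (jac (Dv x))%:E + \int[leb2]_(x in layer d) (jac (Dw x))%:E +
   \int[leb2]_(x in rim d) (jac (Du x))%:E)%E.
  rewrite -{2}Erim -Ecore -integral_disk_split //; last exact: mj.
  apply: le_trans cmp; rewrite (@integral_disk_split d) //; last exact: mj.
  by apply: leeD => //; rewrite leeDl //; exact: integral_ge0.
move: cmp2; rewrite leeD2rE // => cmp2.
apply: (le_trans cmp2); apply: leeD.
  rewrite (area_weakE wDv); apply: ge0_subset_integral => //; first exact: mj.
  exact: core_disk.
apply: ge0_le_integral => //.
- by apply: measurable_funS (mj _ _ wDw) => //; exact: layer_disk.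
- have mu' i : @measurable_fun _ _ (plane R) R (layer d) (fun x => u x ord0 i).
    have [[+ _] _ _] := wDu i ord0; move=> h.
    by apply: (@measurable_funS _ _ (plane R) R disk) => //; exact: layer_disk.
  have mv' i : @measurable_fun _ _ (plane R) R (layer d) (fun x => v x ord0 i).
    have [[+ _] _ _] := wDv i ord0; move=> h.
    by apply: (@measurable_funS _ _ (plane R) R disk) => //; exact: layer_disk.
  have mD u' Du' : weak_differential u' Du' -> @measurable_fun _ _ (plane R) R (layer d) (fun x => sqnorm (Du' x)).
    move=> wD; apply: (@measurable_funS _ _ (plane R) R disk) => //; first exact: layer_disk.
    by apply: measurable_sqnorm => i j; exact: measurable_weak_differential wD.
  apply/measurable_EFinP; apply: measurable_funM => //; apply: measurable_funM => //.
  apply: measurable_funD.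
    by apply: measurable_funD; [exact: mD wDv|exact: mD wDu].
  apply: measurable_funM => //; apply: measurable_sum => i; apply: measurable_funX.
  exact: measurable_funB.
- move=> x lx; rewrite lee_fin; apply: (le_trans (jacobian_le _)).
  rewrite ler_pM2l ?invr_gt0 //; apply: sqnorm_blend_le => // j.
  by apply: lC; exact: layer_disk lx.
Qed.

Lemma W12_lipschitz v Dv (L N : R) : 0 <= L -> weak_differential v Dv ->
  (forall i x, disk x -> `|v x ord0 i| <= N) ->
  (forall i x y, disk x -> disk y -> `|v x ord0 i - v y ord0 i| <= L * `|x - y|) ->
  W12 v.
Proof.
move=> L0 wD vN vL; split.
  move=> i; have [[mv _] _ _] := wD i ord0.
  by apply: (@square_integrable_bounded _ _ N) => // x Dx; exact: vN.
exists Dv => // i j; apply: (@ae_bounded_square_integrable _ _ L).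
  exact: measurable_weak_differential wD.
exact: weak_partial_lipschitz L0 (vN i) (vL i) (wD i j).
Qed.

End Comparison.

(** * Hardy inequality in the boundary layer *)

Section LineOscillation.
Context {R : realType}.
Local Notation mu := (@lebesgue_measure R).

(** The inequality of Cauchy and Schwarz: expand the integral of the squared deviation
    of the derivative from its mean. *)
Lemma osc_sqr_le (phi gam : R -> R) (y z : R) : y < z ->
  (forall t, y <= t <= z -> is_derive t 1 phi (gam t)) ->
  (forall t, y <= t <= z -> {for t, continuous gam}) ->
  (phi z - phi y) ^+ 2 <= (z - y) * \int[mu]_(t in `[y, z]) (gam t ^+ 2).
Proof.
move=> yz dphi cgam.
have cg : {within `[y, z], continuous gam}.
  by apply: continuous_in_subspaceT => t; rewrite inE /= in_itv /=; exact: cgam.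
have cphi t : y <= t <= z -> {for t, continuous phi}.
  by move=> /dphi[+ _] => /derivable1_diffP/differentiable_continuous.
have Ig : mu.-integrable `[y, z] (EFin \o gam).
  by apply: continuous_compact_integrable => //; exact: segment_compact.
have Ig2 : mu.-integrable `[y, z] (EFin \o (fun t => gam t ^+ 2)).
  apply: continuous_compact_integrable; first exact: segment_compact.
  apply: continuous_in_subspaceT => t; rewrite inE /= in_itv /= => /cgam ct.
  by rewrite /prop_for /continuous_at expr2; under eq_fun do rewrite expr2; apply: cvgM.
have FTC : \int[mu]_(t in `[y, z]) gam t = phi z - phi y.
  rewrite /Rintegral (@continuous_FTC2 _ gam phi y z yz cg) //.
    split.
    - by move=> t; rewrite in_itv /= => /andP[t1 t2]; have [] := dphi t _; first by rewrite !ltW.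
    - by apply: cvg_at_right_filter; apply: cphi; rewrite lexx ltW.
    - by apply: cvg_at_left_filter; apply: cphi; rewrite lexx ltW.
  move=> t; rewrite in_itv /= => /andP[t1 t2]; rewrite derive1E.
  by have [] := dphi t _; first by rewrite !ltW.
have l0 : 0 < z - y by rewrite subr_gt0.
pose k := (phi z - phi y) / (z - y).
have mI : measurable (`[y, z]%classic : set (measurableTypeR R)) by exact: measurable_itv.
have Ic (c : R) : mu.-integrable `[y, z] (EFin \o cst c).
  by apply: continuous_compact_integrable; [exact: segment_compact|move=> t; exact: cst_continuous].
have : 0 <= \int[mu]_(t in `[y, z]) ((gam t - k) ^+ 2).
  by apply: Rintegral_ge0 => t _; exact: sqr_ge0.
have -> : \int[mu]_(t in `[y, z]) ((gam t - k) ^+ 2) =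
    \int[mu]_(t in `[y, z]) (gam t ^+ 2) + \int[mu]_(t in `[y, z]) ((- 2 * k) * gam t)
    + \int[mu]_(t in `[y, z]) (k ^+ 2).
  have IZ : mu.-integrable `[y, z] (EFin \o (fun t => (- 2 * k) * gam t)).
    exact: (integrableZl mI (- 2 * k) Ig).
  rewrite -RintegralD // -RintegralD //.
    by apply: eq_Rintegral => t _ /=; ring.
    exact: (integrableD mI Ig2 IZ).
  exact: Ic.
have muI : mu `[y, z]%classic = (z - y)%:E by rewrite lebesgue_measure_itv /= lte_fin yz.
have -> : \int[mu]_(t in `[y, z]) (- 2 * k * gam t) = - 2 * k * (phi z - phi y).
  by rewrite -FTC; exact: RintegralZl.
have -> : \int[mu]_(t in `[y, z]) (k ^+ 2) = k ^+ 2 * (z - y).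
  have := @Rintegral_cst _ _ R mu `[y, z]%classic mI (k ^+ 2).
  have -> : fine (mu `[y, z]%classic) = z - y by rewrite lebesgue_measure_itv /= lte_fin yz.
  by [].
move: (\int[mu]_(t in _) _) => I.
rewrite /k => H; rewrite -ler_pdivrMl //.
have -> : (z - y)^-1 * (phi z - phi y) ^+ 2 =
   - ((- 2 * ((phi z - phi y) / (z - y))) * (phi z - phi y) + ((phi z - phi y) / (z - y)) ^+ 2 * (z - y)).
  by field; rewrite gt_eqF.
by rewrite -subr_ge0 opprK addrA.
Qed.

Lemma pair_line (c t : R) : t *: dir ord_max + (c, 0) = (c, t).
Proof. by apply/pair_equal_spec; rewrite /= [t *: 0]mulr0 [t *: 1]mulr1 add0r addr0. Qed.

Variables (f_ g_ : nat -> R * R -> R) (f g : R * R -> R).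
Hypotheses (df : forall n x, disk x -> is_derive x (dir ord_max) (f_ n) (g_ n x))
  (cg : forall n x, disk x -> {for x, continuous (g_ n)})
  (lg : loc_bounded g_)
  (ff : forall x, disk x -> f_ n x @[n --> \oo] --> f x)
  (gg : forall x, disk x -> g_ n x @[n --> \oo] --> g x).

(** The derivatives of [f_ n] are bounded on the segment, which stays at depth at least
    [a]; the inequality for [f_ n] therefore passes to the limit. *)
Lemma line_osc_sqr_le c y z (a : R) : y < z -> 0 < a <= 1 ->
  (forall t, y <= t <= z -> a <= depth (c, t)) ->
  (f (c, z) - f (c, y)) ^+ 2 <= (z - y) * \int[mu]_(t in `[y, z]) (g (c, t) ^+ 2) /\
  mu.-integrable `[y, z] (EFin \o (fun t => g (c, t) ^+ 2)).
Proof.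
move=> yz a01 seg; have [a0 a1] := andP a01.
have segD t : y <= t <= z -> disk (c, t) by move=> /seg ht; exact: (depth_ge_disk a0).
have [M hM] := lg a01.
have cg1 n t : y <= t <= z -> {for t, continuous (fun t => g_ n (c, t))}.
  move=> ht; apply: (@continuous_comp _ _ _ (fun t => (c, t)) (g_ n)).
    exact: (cvg_pair (cvg_cst _) cvg_id).
  exact: cg (segD _ ht).
have line n : (f_ n (c, z) - f_ n (c, y)) ^+ 2 <= (z - y) * \int[mu]_(t in `[y, z]) (g_ n (c, t) ^+ 2).
  apply: (@osc_sqr_le (fun t => f_ n (c, t)) (fun t => g_ n (c, t))) => // t ht.
    have := @is_derive_line _ (f_ n) (c, 0) (dir ord_max) t (g_ n (c, t)).
    rewrite pair_line => /(_ (df n (segD _ ht))).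
    by under eq_fun do rewrite pair_line.
  exact: cg1.
have mI : measurable (`[y, z]%classic : set (measurableTypeR R)) by exact: measurable_itv.
have Ic (d : R) : mu.-integrable `[y, z] (EFin \o cst d).
  by apply: continuous_compact_integrable; [exact: segment_compact|move=> t; exact: cst_continuous].
have m1 n : measurable_fun `[y, z] (fun t => (g_ n (c, t) ^+ 2)%:E).
  apply/measurable_EFinP; apply: measurable_funX.
  apply: subspace_continuous_measurable_fun => //.
  by apply: continuous_in_subspaceT => t; rewrite inE /= in_itv /= => /(cg1 n).
have cv : {ae mu, forall t, `[y, z]%classic t -> (g_ n (c, t) ^+ 2)%:E @[n --> \oo] --> (g (c, t) ^+ 2)%:E}.
  apply: aeW => t /=; rewrite in_itv /= => ht; apply/cvg_EFin; first exact: nearW.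
  by rewrite expr2; under eq_fun do rewrite expr2; apply: cvgM; exact: gg (segD _ ht).
have m2 : measurable_fun `[y, z] (fun t => (g (c, t) ^+ 2)%:E).
  apply/measurable_EFinP; apply: (@measurable_fun_cvg _ _ R _ (fun n t => g_ n (c, t) ^+ 2)).
    by move=> n; apply/measurable_EFinP; exact: m1.
  move=> t /=; rewrite in_itv /= => ht.
  by rewrite expr2; under eq_fun do rewrite expr2; apply: cvgM; exact: gg (segD _ ht).
have dom : {ae mu, forall t n, `[y, z]%classic t -> (`|(g_ n (c, t) ^+ 2)%:E| <= (M ^+ 2)%:E)%E}.
  apply: aeW => t n /=; rewrite in_itv /= => ht; rewrite lee_fin normrX.
  by have h := hM n _ (seg _ ht); rewrite ler_pXn2r ?nnegrE // (le_trans _ h).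
have [I2 _ cvI] := @dominated_convergence _ _ R mu _ mI _ _ _ m1 m2 cv (Ic (M ^+ 2)) dom.
split => //.
have cvR : \int[mu]_(t in `[y, z]) (g_ n (c, t) ^+ 2) @[n --> \oo] -->
    \int[mu]_(t in `[y, z]) (g (c, t) ^+ 2).
  by apply: fine_cvg; move: cvI; rewrite /= fineK //; exact: integrable_fin_num I2.
have c1 : (z - y) * \int[mu]_(t in `[y, z]) (g_ n (c, t) ^+ 2) @[n --> \oo] -->
   (z - y) * \int[mu]_(t in `[y, z]) (g (c, t) ^+ 2) by apply: cvgM => //; exact: cvg_cst.
have c2 : (f_ n (c, z) - f_ n (c, y)) ^+ 2 @[n --> \oo] --> (f (c, z) - f (c, y)) ^+ 2.
  have c3 : f_ n (c, z) - f_ n (c, y) @[n --> \oo] --> f (c, z) - f (c, y).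
    by apply: cvgB; apply: ff; apply: segD; rewrite lexx ltW.
  by rewrite expr2; under eq_fun do rewrite expr2; exact: cvgM.
rewrite -(cvg_lim (@norm_hausdorff _ _) c1) -(cvg_lim (@norm_hausdorff _ _) c2).
apply: ler_lim.
- by apply/cvg_ex; eexists; exact: c2.
- by apply/cvg_ex; eexists; exact: c1.
- by apply: nearW.
Qed.

End LineOscillation.

Section HardyCap.
Context {R : realType}.
Local Notation mu := (@lebesgue_measure R).
Variables (f_ g_ : nat -> R * R -> R) (f g phi : R * R -> R) (L d : R).
Hypotheses (df : forall n x, disk x -> is_derive x (dir ord_max) (f_ n) (g_ n x))
  (cg : forall n x, disk x -> {for x, continuous (g_ n)})
  (lg : loc_bounded g_)
  (ff : forall x, disk x -> f_ n x @[n --> \oo] --> f x)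
  (gg : forall x, disk x -> g_ n x @[n --> \oo] --> g x)
  (cf : {within cdisk, continuous f})
  (L0 : 0 <= L)
  (phiL : forall x y, cdisk x -> cdisk y -> `|phi x - phi y| <= L * `|x - y|)
  (fphi : forall x, circle x -> f x = phi x) (d0 : 0 < d).

Definition cap (d : R) : set (R * R) := [set x | 0 < depth x < 2 * d /\ 2^-1 <= x.2].

Lemma measurable_cap e : @measurable _ (plane R) (cap e).
Proof.
rewrite (_ : cap e = [set x | depth x \in `]0, (2 * e)[%R] `&` (snd @^-1` `[2^-1, +oo[%classic)).
  apply: measurableI; first exact: measurable_depth_itv.
  have := @measurable_snd _ _ (measurableTypeR R) (measurableTypeR R) measurableT `[2^-1, +oo[%classic (measurable_itv _).
  by rewrite setTI.
by apply/seteqP; split => x; rewrite /cap /= !in_itv /= andbT.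
Qed.

Lemma cap_disk e : cap e `<=` disk.
Proof. by move=> x [/andP[h _] _]; exact/diskE. Qed.

Let mg : @measurable_fun _ _ (plane R) R disk g.
Proof.
apply: (@measurable_disk_limit _ g_) => // n.
by apply: open_continuous_plane_measurable; [exact: open_disk|exact: cg].
Qed.

Let g2 : R * R -> \bar R := (fun x => (g x ^+ 2)%:E) \_ (cap d).

Let g2_ge0 x : (0 <= g2 x)%E.
Proof. by rewrite /g2 patchE; case: ifP => // _; rewrite lee_fin sqr_ge0. Qed.

Let mg2 : @measurable_fun _ _ (plane R) _ setT g2.
Proof.
apply/(measurable_restrictT _ (measurable_cap d)).
apply/measurable_EFinP; apply: measurable_funX.
apply: measurable_funS mg; first exact: measurable_disk.
exact: cap_disk.
Qed.

Let Q (c : R) : \bar R := (\int[mu]_t g2 (c, t))%E.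

Let Q_ge0 c : (0 <= Q c)%E. Proof. exact: integral_ge0. Qed.

(** Go from [(c, y)] upwards to the point [(c, Y)] of the circle, where [f = phi]. Since
    [y] is at least 1/2, the length [Y - y] is at most the depth, hence at most [2 * d].
    The oscillation of [f] on this segment is bounded by the integral of its derivative,
    that of [phi] by the Lipschitz constant. *)
Let cap_pointwise c y : cap d (c, y) ->
  (((f (c, y) - phi (c, y)) ^+ 2)%:E <= (4 * d)%:E * Q c + (8 * L ^+ 2 * d ^+ 2)%:E)%E.
Proof.
move=> cy; have [/andP[D0 D2] y12] := cy; rewrite /= in y12.
pose Y := Num.sqrt (1 - c ^+ 2).
have dE t : depth (c, t) = 1 - c ^+ 2 - t ^+ 2 by rewrite /depth /= opprD addrA.
have c1 : 0 <= 1 - c ^+ 2 by move: D0; rewrite dE; have := sqr_ge0 y; lra.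
have Y2 : Y ^+ 2 = 1 - c ^+ 2 by rewrite sqr_sqrtr.
have Y0 : 0 <= Y by exact: sqrtr_ge0.
have dY t : depth (c, t) = (Y - t) * (Y + t) by rewrite dE -Y2; ring.
have yY : y < Y by move: D0; rewrite dY pmulr_lgt0 ?subr_gt0 //; lra.
have Yy : Y - y <= 2 * d.
  have := D2; rewrite dY => h; have : (Y - y) * 1 <= (Y - y) * (Y + y) by rewrite ler_pM2l ?subr_gt0 //; lra.
  by rewrite mulr1; lra.
have [Qoo|Qfin] := eqVneq (Q c) +oo%E.
  by rewrite Qoo gt0_muley ?lte_fin ?mulr_gt0 // addye ?leey.
have /fineK : Q c \is a fin_num by rewrite ge0_fin_numE // ltey.
move=> <-; set q := fine (Q c); rewrite -EFinM -EFinD lee_fin.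
have osc z : y < z -> z < Y -> (f (c, z) - f (c, y)) ^+ 2 <= 2 * d * q.
  move=> yz zY.
  have z0 : 0 < depth (c, z) by rewrite dY mulr_gt0 // ?subr_gt0 //; lra.
  have seg t : y <= t <= z -> depth (c, z) <= depth (c, t).
    move=> /andP[t1 t2]; rewrite !dE lerD2l lerN2 ler_pXn2r ?nnegrE //; lra.
  have z1 : depth (c, z) <= 1 by rewrite /depth lerBlDl lerDr addr_ge0 // sqr_ge0.
  have z01 : 0 < depth (c, z) <= 1 by rewrite z0 z1.
  have [osc I2] := line_osc_sqr_le df cg lg ff gg yz z01 seg.
  apply: (le_trans osc).
  have Rq : \int[mu]_(t in `[y, z]) (g (c, t) ^+ 2) <= q.
    rewrite -lee_fin fineK; last by apply: integrable_fin_num => //; exact: measurable_itv.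
    rewrite fineK ?ge0_fin_numE ?ltey //.
    have -> : (\int[mu]_(t in `[y, z]) (EFin \o (fun t => (g (c, t) ^+ 2)%R)) t =
        \int[mu]_(t in `[y, z]) g2 (c, t))%E.
      apply: eq_integral => t; rewrite inE /= in_itv /= => ht; rewrite /g2 patchE mem_set //.
      split => /=; last by case/andP: ht => h _; exact: le_trans h.
      rewrite (lt_le_trans z0 (seg t ht)) /=; apply: le_lt_trans D2.
      by case/andP: ht => t1 t2; rewrite !dE lerD2l lerN2 ler_pXn2r ?nnegrE //; lra.
    apply: ge0_subset_integral => //.
    by apply: (measurableT_comp mg2); exact: pair1_measurable.
  have q0 : 0 <= q by rewrite fine_ge0.
  apply: ler_pM => //; last by lra.
  - by rewrite subr_ge0 ltW.
  - by apply: Rintegral_ge0 => t _; exact: sqr_ge0.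
(* The segment may be followed inside the disk only; its endpoint on the circle is
   reached by continuity of [f] on the closed disk. *)
have oscY : (f (c, Y) - f (c, y)) ^+ 2 <= 2 * d * q.
  pose z (n : nat) := Y - (Y - y) * n.+2%:R^-1.
  have n0 (n : nat) : 0 < n.+2%:R^-1 :> R by [].
  have n1 (n : nat) : n.+2%:R^-1 < 1 :> R by rewrite invf_lt1 // ltr1n.
  have zlt n : z n < Y by rewrite /z ltrBlDr ltrDl mulr_gt0 // subr_gt0.
  have ylt n : y < z n.
    by rewrite /z ltrBrDr -ltrBrDl gtr_pMr // subr_gt0.
  have zY : z n @[n --> \oo] --> Y.
    rewrite -[X in _ --> X]subr0; apply: cvgB; first exact: cvg_cst.
    rewrite -(mulr0 (Y - y)); apply: cvgM; first exact: cvg_cst.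
    by have := @cvg_harmonic R; rewrite -(cvg_shiftS (@harmonic R)).
  have cdY : cdisk (c, Y) by apply/cdiskE; rewrite dY subrr mul0r.
  have cvf : f (c, z n) @[n --> \oo] --> f (c, Y).
    move/subspace_continuousP : cf => /(_ _ cdY) cY.
    apply: (cvg_comp _ _ _ cY) => A wA.
    have cz : (c, z n) @[n --> \oo] --> (c, Y).
      exact: (cvg_pair (cvg_cst _) zY).
    have cA : \forall n \near \oo, cdisk (c, z n) -> A (c, z n) by exact: cz _ wA.
    apply: filterS cA => n; apply; apply/cdiskE.
    by rewrite (dY (z n)) mulr_ge0 // ?subr_ge0 ?ltW //; have := ylt n; lra.
  have cv : (f (c, z n) - f (c, y)) ^+ 2 @[n --> \oo] --> (f (c, Y) - f (c, y)) ^+ 2.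
    have c3 : f (c, z n) - f (c, y) @[n --> \oo] --> f (c, Y) - f (c, y).
      by apply: cvgB => //; exact: cvg_cst.
    by rewrite expr2; under eq_fun do rewrite expr2; exact: cvgM.
  rewrite -(cvg_lim (@norm_hausdorff _ _) cv).
  apply: limr_le; first by apply/cvg_ex; eexists; exact: cv.
  by apply: nearW => n; exact: osc.
have fY : f (c, Y) = phi (c, Y) by apply: fphi; apply/circleE; rewrite dY subrr mul0r.
have lip : (phi (c, Y) - phi (c, y)) ^+ 2 <= 4 * L ^+ 2 * d ^+ 2.
  rewrite (_ : 4 * L ^+ 2 * d ^+ 2 = (L * (2 * d)) ^+ 2); last by ring.
  rewrite -real_normK ?num_real // ler_pXn2r ?nnegrE //; last by rewrite mulr_ge0 // mulr_ge0 // ltW.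
  apply: (le_trans (phiL _ _)).
  - by apply/cdiskE; rewrite dY subrr mul0r.
  - by apply/cdiskE; exact: ltW.
  - rewrite ler_wpM2l // (_ : (c, Y) - (c, y) = (Y - y) *: dir ord_max).
      by rewrite norm_dir ger0_norm // subr_ge0 ltW.
    apply/pair_equal_spec; rewrite /= subrr [_ *: 0]mulr0 [_ *: 1]mulr1.
    by split.
rewrite fY in oscY; have := sqr_ge0 (phi (c, Y) - phi (c, y) + (phi (c, Y) - f (c, y))); nra.
Qed.

Let F : R * R -> R := fun x => (f x - phi x) ^+ 2.

(** The pointwise bound does not depend on the height of the point in its slice, so the
    integral over a slice gains its length, at most [2 * d], as a factor. *)
Lemma hardy_cap : @measurable_fun _ _ (plane R) R disk F ->
  (\int[leb2]_(x in cap d) (F x)%:E <=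
   (8 * d ^+ 2)%:E * \int[leb2]_(x in cap d) (g x ^+ 2)%:E + (32 * L ^+ 2 * d ^+ 3)%:E)%E.
Proof.
move=> mF.
have mc := measurable_cap d.
pose F1 : R * R -> \bar R := (fun x => (F x)%:E) \_ (cap d).
have F10 x : (0 <= F1 x)%E.
  by rewrite /F1 patchE; case: ifP => // _; rewrite lee_fin sqr_ge0.
have mF1 : @measurable_fun _ _ (plane R) _ setT F1.
  apply/(measurable_restrictT _ mc); apply/measurable_EFinP.
  by apply: measurable_funS mF; [exact: measurable_disk|exact: cap_disk].
have -> : (\int[leb2]_(x in cap d) (F x)%:E = \int[mu]_c \int[mu]_t F1 (c, t))%E.
  by rewrite integral_mkcond -fubini_tonelli1.
have -> : (\int[leb2]_(x in cap d) (g x ^+ 2)%:E = \int[mu]_c Q c)%E.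
  by rewrite integral_mkcond -fubini_tonelli1.
have mQ : @measurable_fun _ _ (measurableTypeR R) _ setT Q by exact: measurable_fun_fubini_tonelli_F.
pose k := 16 * L ^+ 2 * d ^+ 3.
have k0 : 0 <= k.
  by apply: mulr_ge0; [apply: mulr_ge0 => //; exact: sqr_ge0|rewrite exprn_ge0 // ltW].
have d2 : 0 <= 8 * d ^+ 2 by apply: mulr_ge0 => //; exact: sqr_ge0.
have slice c : (\int[mu]_t F1 (c, t) <= (8 * d ^+ 2)%:E * Q c + (k * \1_(`[(-1 : R), 1]%classic) c)%:E)%E.
  have [c1|c1] := pselect (`[(-1 : R), 1]%classic c); last first.
    rewrite integral0_eq; last first.
      move=> t _; rewrite /F1 patchE; case: ifPn => //; rewrite inE => -[/andP[h _] _].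
      exfalso; apply: c1; have /depth_bounded[] := ltW h.
      by rewrite ler_norml /= in_itv.
    by rewrite adde_ge0 // ?mule_ge0 // lee_fin mulr_ge0 // indicE.
  pose Y := Num.sqrt (1 - c ^+ 2).
  have c2 : 0 <= 1 - c ^+ 2 by move: c1; rewrite /= in_itv /= => /andP[]; nra.
  have Y2 : Y ^+ 2 = 1 - c ^+ 2 by rewrite sqr_sqrtr.
  have Y0 : 0 <= Y by exact: sqrtr_ge0.
  pose K : \bar R := ((4 * d)%:E * Q c + (8 * L ^+ 2 * d ^+ 2)%:E)%E.
  have K0 : (0 <= K)%E.
    rewrite adde_ge0 ?mule_ge0 // lee_fin; first by rewrite mulr_ge0 // ltW.
    by rewrite mulr_ge0 ?sqr_ge0 // mulr_ge0 // sqr_ge0.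
  have mI : measurable (`[Y - 2 * d, Y]%classic : set (measurableTypeR R)) by exact: measurable_itv.
  apply: (@le_trans _ _ (\int[mu]_(t in `[(Y - 2 * d)%R, Y]) cst K t)%E).
    rewrite [leRHS]integral_mkcond; apply: ge0_le_integral => //.
    - by apply: (measurableT_comp mF1); exact: pair1_measurable.
    - by apply/(measurable_restrictT _ mI); exact: measurable_cst.
    - move=> t _; rewrite /F1 !patchE; case: ifPn => [|_]; last by case: ifP.
      rewrite inE => ct; rewrite mem_set; first exact: cap_pointwise.
      have [/andP[D0 D2] t2] := ct; rewrite /= in t2.
      have dY : depth (c, t) = (Y - t) * (Y + t) by rewrite /depth /= opprD addrA -Y2; ring.
      have tY : 0 < Y - t by move: D0; rewrite dY pmulr_lgt0 //; lra.
      have : (Y - t) * 1 <= (Y - t) * (Y + t) by rewrite ler_pM2l //; lra.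
      by rewrite mulr1 -dY /= in_itv /= => h; apply/andP; split; lra.
  rewrite integral_cst //= lebesgue_measure_itv /= lte_fin ifT; last by rewrite ltrBlDr ltrDl mulr_gt0.
  rewrite -EFinD (_ : Y - (Y - 2 * d) = 2 * d); last by rewrite opprB addrC subrK.
  rewrite indicE mem_set // mulr1 muleDl //; last by rewrite ge0_adde_def // inE ?mule_ge0 ?lee_fin // ?mulr_ge0 ?sqr_ge0 // ltW.
  rewrite muleAC -EFinM -EFinM; apply: leeD.
    by rewrite muleC [leRHS]muleC lee_wpmul2l // lee_fin; nra.
  by rewrite lee_fin /k; nra.
have mF2 : @measurable_fun _ _ (measurableTypeR R) _ setT (fun c => \int[mu]_t F1 (c, t))%E.
  exact: measurable_fun_fubini_tonelli_F.
have m1 : measurable_fun setT (fun c : measurableTypeR R => (8 * d ^+ 2)%:E * Q c)%E.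
  by apply: measurable_funeM.
have mI1 : measurable (`[(-1), 1]%classic : set (measurableTypeR R)) by exact: measurable_itv.
have m2 : measurable_fun setT (fun c : measurableTypeR R => (k * \1_(`[(-1 : R), 1]%classic) c)%:E).
  by apply/measurable_EFinP; apply: measurable_funM => //; exact: measurable_indic.
apply: (@le_trans _ _ (\int[mu]_c ((8 * d ^+ 2)%:E * Q c + (k * \1_(`[(-1 : R), 1]%classic) c)%:E))%E).
  apply: ge0_le_integral => //.
  - by move=> c _; exact: integral_ge0.
  - exact: (@emeasurable_funD _ (measurableTypeR R) R setT _ _ m1 m2).
rewrite ge0_integralD //; last 2 first.
- by move=> c _; rewrite mule_ge0.
- by move=> c _; rewrite lee_fin mulr_ge0 // indicE.
rewrite ge0_integralZl //; apply: leeD => //.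
under eq_integral do rewrite EFinM.
rewrite ge0_integralZl //; last first.
  by apply/measurable_EFinP; exact: measurable_indic.
rewrite integral_indic // setIT.
have mu2 : mu `[(-1 : R), 1]%classic = 2%:E.
  rewrite lebesgue_measure_itv /= lte_fin ifT; last by rewrite -subr_gt0 opprK addr_gt0.
  by rewrite -EFinD opprK.
rewrite [X in (_ * X)%E](mu2) -EFinM lee_fin (_ : k * 2 = 32 * L ^+ 2 * d ^+ 3) // /k.
by ring.
Qed.

End HardyCap.

Section HardyLayer.
Context {R : realType}.
Local Notation mu := (@lebesgue_measure R).

(** The cap around the top of the circle is carried to the four caps around the axes by
    reflections and an exchange of coordinates, which preserve measure and depth. *)
Definition sym (p : 'I_2 * bool) (x : R * R) : R * R :=
  if p.1 == ord_max then (x.1, (-1) ^+ p.2 * x.2) else ((-1) ^+ p.2 * x.2, x.1).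

Definition sidecap (p : 'I_2 * bool) (d : R) : set (R * R) :=
  [set x | 0 < depth x < 2 * d /\
     2^-1 <= (-1) ^+ p.2 * (if p.1 == ord_max then x.2 else x.1)].

Definition collar (d : R) : set (R * R) := [set x | 0 < depth x < 2 * d].

Lemma measurable_collar d : @measurable _ (plane R) (collar d).
Proof.
rewrite (_ : collar d = [set x | depth x \in `]0, (2 * d)[%R]); first exact: measurable_depth_itv.
by apply/seteqP; split => x; rewrite /collar /= in_itv.
Qed.

Lemma collar_disk d : collar d `<=` disk.
Proof. by move=> x /andP[h _]; exact/diskE. Qed.

Lemma depth_sym p x : depth (sym p x) = depth x.
Proof.
rewrite /depth /sym; case: ifP => _ /=; rewrite exprMn sqrr_sign mul1r //.
by rewrite [X in 1 - X]addrC.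
Qed.

Lemma sidecap_sym p d : sym p @^-1` sidecap p d = cap d.
Proof.
have E x : (-1) ^+ p.2 * (if p.1 == ord_max then (sym p x).2 else (sym p x).1) = x.2.
  by rewrite /sym; case: (p.1 == ord_max) => /=; rewrite signrMK.
by apply/seteqP; split => x; rewrite /sidecap /cap /= depth_sym E.
Qed.

Lemma measurable_sign (b : bool) :
  @measurable_fun _ _ (measurableTypeR R) (measurableTypeR R) setT (fun t : R => (-1) ^+ b * t).
Proof. by apply: measurable_funM. Qed.

Lemma measurable_sym p : @measurable_fun _ _ (plane R) (plane R) setT (sym p).
Proof.
case: p => j b; have m2 : @measurable_fun _ _ (plane R) (measurableTypeR R) setT
    (fun x : R * R => (-1) ^+ b * x.2).
  by apply: measurable_funM => //; exact: measurable_snd.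
have m1 : @measurable_fun _ _ (plane R) (measurableTypeR R) setT (fun x : R * R => x.1).
  exact: measurable_fst.
rewrite /sym /=; case: (j == ord_max); apply/measurable_fun_pairP; split; [exact: m1|exact: m2|exact: m2|exact: m1].
Qed.

Let lebesgue_sign (b : bool) (A : set (measurableTypeR R)) : measurable A ->
  mu [set t : R | A ((-1) ^+ b * t)] = mu A.
Proof.
move=> mA; case: b; last by congr (mu _); apply/seteqP; split => t /=; rewrite mul1r.
rewrite -(lebesgue_measureN mA) /pushforward; congr (mu _).
by apply/seteqP; split => t /=; rewrite mulN1r.
Qed.

Let measurable_sign_set (b : bool) (A : set (measurableTypeR R)) : measurable A ->
  measurable ([set t : R | A ((-1) ^+ b * t)] : set (measurableTypeR R)).
Proof. by move=> mA; have := measurable_sign b measurableT mA; rewrite setTI. Qed.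

Lemma leb2_sym p (A : set (R * R)) : @measurable _ (plane R) A ->
  pushforward leb2 (sym p : plane R -> plane R) A = leb2 A.
Proof.
move=> mA; have ms := measurable_sym p; apply/esym/product_measure_unique => // B C mB mC.
transitivity (leb2 (sym p @^-1` (B `*` C))); first by [].
rewrite /sym; case: (p.1 == ord_max).
  rewrite (_ : _ @^-1` _ = B `*` [set t | C ((-1) ^+ p.2 * t)]) //.
  rewrite leb2X //; last exact: measurable_sign_set.
  by congr (_ * _)%E; exact: lebesgue_sign.
rewrite (_ : _ @^-1` _ = C `*` [set t | B ((-1) ^+ p.2 * t)]); last first.
  by apply/seteqP; split => x /= [].
rewrite leb2X //; last exact: measurable_sign_set.
by rewrite muleC; congr (_ * _)%E; exact: lebesgue_sign.
Qed.

Lemma integral_sym p (D : set (R * R)) (F : R * R -> \bar R) :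
  @measurable _ (plane R) D -> @measurable_fun _ _ (plane R) _ D F ->
  (forall x, D x -> 0 <= F x)%E ->
  (\int[leb2]_(x in sym p @^-1` D) F (sym p x) = \int[leb2]_(x in D) F x)%E.
Proof.
move=> mD mF F0; have ms := measurable_sym p.
have F0' : {in D, forall y, (0 <= F y)%E} by move=> y /set_mem; exact: F0.
have := @ge0_integral_pushforward _ _ (plane R) (plane R) R _ ms leb2 D F mD mF F0'.
move=> <-; apply: eq_measure_integral => A mA _.
exact: leb2_sym.
Qed.

Lemma measurable_sidecap p d : @measurable _ (plane R) (sidecap p d).
Proof.
pose q (x : R * R) := if p.1 == ord_max then x.2 else x.1.
have mq : @measurable_fun _ _ (plane R) (measurableTypeR R) setT (fun x => (-1) ^+ p.2 * q x).
  apply: measurable_funM => //; rewrite /q; case: (p.1 == ord_max); [exact: measurable_snd|exact: measurable_fst].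
rewrite (_ : sidecap p d = collar d `&` ((fun x => (-1) ^+ p.2 * q x) @^-1` `[2^-1, +oo[%classic)).
  apply: measurableI; first exact: measurable_collar.
  by have := mq measurableT _ (measurable_itv `[2^-1, +oo[); rewrite setTI.
by apply/seteqP; split => x; rewrite /sidecap /collar /q /= in_itv /= andbT.
Qed.

Lemma sidecap_collar p d : sidecap p d `<=` collar d.
Proof. by move=> x []. Qed.

(** At depth less than 1/2 one coordinate has a square of at least 1/4. *)
Lemma layer_sidecap d x : d <= 4^-1 -> layer d x -> 0 < d -> exists p, sidecap p d x.
Proof.
move=> d4 /andP[h1 h2] d0; have Dx : 0 < depth x by exact: lt_trans h1.
have sqr_half (t : R) : 4^-1 <= t ^+ 2 -> exists b : bool, 2^-1 <= (-1) ^+ b * t.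
  move=> ht; have [t0|t0] := leP 0 t.
    by exists false; rewrite mul1r; nra.
  by exists true; rewrite mulN1r; nra.
have [hx|hx] := leP 4^-1 (x.2 ^+ 2).
  have [b hb] := sqr_half _ hx; exists (ord_max, b); split => //=.
  by rewrite Dx h2.
have [b hb] : exists b : bool, 2^-1 <= (-1) ^+ b * x.1.
  by apply: sqr_half; move: h2; rewrite /depth; lra.
by exists (ord0, b); split => //=; rewrite Dx h2.
Qed.

Variables (f_ : nat -> R * R -> R) (g_ : 'I_2 -> nat -> R * R -> R)
  (f : R * R -> R) (g : 'I_2 -> R * R -> R) (phi : R * R -> R) (L d : R).
Hypotheses (df : forall n j x, disk x -> is_derive x (dir j) (f_ n) (g_ j n x))
  (cg : forall n j x, disk x -> {for x, continuous (g_ j n)})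
  (lg : forall j, loc_bounded (g_ j))
  (ff : forall x, disk x -> f_ n x @[n --> \oo] --> f x)
  (gg : forall j x, disk x -> g_ j n x @[n --> \oo] --> g j x)
  (cf : {within cdisk, continuous f})
  (L0 : 0 <= L)
  (phiL : forall x y, cdisk x -> cdisk y -> `|phi x - phi y| <= L * `|x - y|)
  (fphi : forall x, circle x -> f x = phi x) (d0 : 0 < d) (d4 : d <= 4^-1).

Let disk_sym p x : disk (sym p x) <-> disk x.
Proof. by rewrite !diskE depth_sym. Qed.

Let continuous_sym p : continuous (sym p).
Proof.
move=> x; have c2 : {for x, continuous (fun x : R * R => (-1) ^+ p.2 * x.2)}.
  by apply: cvgM; [exact: cvg_cst|exact: (@continuous_snd2 R x)].
have c1 : {for x, continuous (fun x : R * R => x.1)} by exact: (@continuous_fst2 R x).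
rewrite /sym; case: (p.1 == ord_max).
  exact: (cvg_pair (f := fun y : R * R => y.1) (g := fun y : R * R => (-1) ^+ p.2 * y.2) c1 c2).
exact: (cvg_pair (f := fun y : R * R => (-1) ^+ p.2 * y.2) (g := fun y : R * R => y.1) c2 c1).
Qed.

Let norm_sym p x y : `|sym p x - sym p y| = `|x - y|.
Proof.
rewrite /sym; case: (p.1 == ord_max); rewrite !prod_normE /= -mulrBr normrM normr_sign mul1r //.
by rewrite maxC.
Qed.

Let mg j : @measurable_fun _ _ (plane R) R disk (g j).
Proof.
apply: (@measurable_disk_limit _ (g_ j)) => // n.
  by apply: open_continuous_plane_measurable; [exact: open_disk|exact: cg].
exact: gg.
Qed.

Let F : R * R -> R := fun x => (f x - phi x) ^+ 2.

Let hardy_sidecap p : @measurable_fun _ _ (plane R) R disk F ->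
  (\int[leb2]_(x in sidecap p d) (F x)%:E <=
   (8 * d ^+ 2)%:E * \int[leb2]_(x in collar d) (g p.1 x ^+ 2)%:E + (32 * L ^+ 2 * d ^+ 3)%:E)%E.
Proof.
move=> mF; have sd : sidecap p d `<=` disk by move=> x /sidecap_collar /collar_disk.
have ms := measurable_sidecap p d.
have mFs : @measurable_fun _ _ (plane R) R (sidecap p d) F.
  by apply: measurable_funS mF => //; exact: measurable_disk.
have mgs : @measurable_fun _ _ (plane R) R (sidecap p d) (fun x => g p.1 x ^+ 2).
  apply: measurable_funX; apply: measurable_funS (mg p.1) => //; exact: measurable_disk.
pose e : R := (-1) ^+ p.2.
have e2 : e ^+ 2 = 1 by rewrite sqrr_sign.
have msd : @measurable_fun _ _ (plane R) (plane R) disk (sym p).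
  by apply: measurable_funTS; exact: measurable_sym.
have mFp : @measurable_fun _ _ (plane R) R disk (F \o sym p).
  apply: (@measurable_comp _ _ _ (plane R) (plane R) R disk F disk (sym p)) => //.
    exact: measurable_disk.
  by move=> _ [x Dx <-]; apply/disk_sym.
have := @hardy_cap R (fun n => f_ n \o sym p) (fun n x => e * g_ p.1 n (sym p x)) (f \o sym p)
  (fun x => e * g p.1 (sym p x)) (phi \o sym p) L d.
move=> hc; have {hc} : (\int[leb2]_(x in cap d) (((f \o sym p) x - (phi \o sym p) x) ^+ 2)%:E <=
   (8 * d ^+ 2)%:E * \int[leb2]_(x in cap d) ((e * g p.1 (sym p x)) ^+ 2)%:E + (32 * L ^+ 2 * d ^+ 3)%:E)%E.
  apply: hc => //.
  - move=> n x Dx; apply: (is_derive_affine (w := dir p.1)).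
      move=> h; rewrite /sym /dir /e; case: (p) => j b /=.
      have [->|j0] := eqVneq j ord_max.
        by apply/pair_equal_spec; split; rewrite /= /GRing.scale /=; ring.
      have -> : j == ord0 by move: j j0; apply: ord2P.
      by apply/pair_equal_spec; split; rewrite /= /GRing.scale /=; ring.
    by apply: df; apply/disk_sym.
  - move=> n x Dx; apply: cvgM; first exact: cvg_cst.
    apply: (cvg_comp _ _ (@continuous_sym p x)).
    by apply: cg; apply/disk_sym.
  - move=> a a01; have [C hC] := lg p.1 a01; exists C => n x ax.
    by rewrite normrM normr_sign mul1r; apply: hC; rewrite depth_sym.
  - by move=> x Dx; apply: ff; apply/disk_sym.
  - move=> x Dx; apply: cvgM; first exact: cvg_cst.
    by apply: gg; apply/disk_sym.
  - apply/subspace_continuousP => x cx; move/subspace_continuousP : cf => cf'.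
    have cs : cdisk (sym p x) by apply/cdiskE; rewrite depth_sym; exact/cdiskE.
    apply: (cvg_comp _ _ _ (cf' _ cs)) => A wA.
    have cA : \forall y \near x, cdisk (sym p y) -> A (sym p y).
      by exact: (@continuous_sym p x _ wA).
    change (\forall y \near x, cdisk y -> A (sym p y)).
    by apply: filterS cA => y hy cy; apply: hy; apply/cdiskE; rewrite depth_sym; exact/cdiskE.
  - move=> x y /cdiskE cx /cdiskE cy; rewrite -(norm_sym p); apply: phiL; apply/cdiskE;
      by rewrite depth_sym.
  - by move=> x /circleE cx; apply: fphi; apply/circleE; rewrite depth_sym.
rewrite -(sidecap_sym p) (@integral_sym p _ (fun x => (F x)%:E)) //; last 2 first.
- exact/measurable_EFinP.
- by move=> x _; rewrite lee_fin sqr_ge0.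
under [X in (_ * X + _)%E]eq_integral do rewrite exprMn e2 mul1r.
rewrite (@integral_sym p _ (fun x => (g p.1 x ^+ 2)%:E)) //; last 2 first.
- exact/measurable_EFinP.
- by move=> x _; rewrite lee_fin sqr_ge0.
move/le_trans; apply; apply: leeD => //; apply: lee_wpmul2l.
  by rewrite lee_fin mulr_ge0 // sqr_ge0.
apply: ge0_subset_integral => //.
- exact: measurable_collar.
- apply/measurable_EFinP; apply: measurable_funX; apply: measurable_funS (mg p.1).
    exact: measurable_disk.
  exact: collar_disk.
- by move=> x _; rewrite lee_fin sqr_ge0.
- exact: sidecap_collar.
Qed.

(** The width [d] of the layer appears squared, as in Hardy's inequality for functions
    that vanish on the boundary; the last term accounts for the values of [phi]. *)
Lemma hardy_layer : @measurable_fun _ _ (plane R) R disk F ->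
  (\int[leb2]_(x in layer d) (F x)%:E <= \sum_(p : 'I_2 * bool)
   ((8 * d ^+ 2)%:E * \int[leb2]_(x in collar d) (g p.1 x ^+ 2)%:E + (32 * L ^+ 2 * d ^+ 3)%:E))%E.
Proof.
move=> mF.
pose F1 p : R * R -> \bar R := (fun x => (F x)%:E) \_ (sidecap p d).
have F10 p x : (0 <= F1 p x)%E.
  by rewrite /F1 patchE; case: ifP => // _; rewrite lee_fin sqr_ge0.
have mF1 p : @measurable_fun _ _ (plane R) _ setT (F1 p).
  apply/(measurable_restrictT _ (measurable_sidecap p d)); apply/measurable_EFinP.
  by apply: measurable_funS mF; [exact: measurable_disk|move=> x /sidecap_collar /collar_disk].
apply: (@le_trans _ _ (\int[leb2]_x (\sum_(p : 'I_2 * bool) F1 p x))%E); last first.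
  rewrite ge0_integral_sum //; apply: lee_sum => p _.
  by rewrite /F1 -integral_mkcond; exact: hardy_sidecap.
rewrite integral_mkcond; apply: ge0_le_integral => //.
- by move=> x _; apply: erestrict_ge0 => y _; rewrite lee_fin sqr_ge0.
- apply/(measurable_restrictT _ (measurable_layer d)); apply/measurable_EFinP.
  by apply: measurable_funS mF; [exact: measurable_disk|exact: layer_disk].
- exact: emeasurable_sum.
- move=> x _; rewrite patchE; case: ifPn => [|_]; last exact: sume_ge0.
  rewrite inE => lx; have [p px] := layer_sidecap d4 lx d0.
  rewrite (bigD1 p) //= {1}/F1 patchE mem_set //.
  by rewrite leeDl //; exact: sume_ge0.
Qed.

End HardyLayer.

(** * Passage to the limit *)

Section LocBounded.
Context {R : realType}.

Lemma loc_bounded_sum (I : finType) (F_ : I -> nat -> R * R -> R) :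
  (forall i, loc_bounded (F_ i)) -> loc_bounded (fun n x => \sum_i F_ i n x).
Proof.
move=> lb a a01; have /choice[C hC] i := lb i a a01.
exists (\sum_i C i) => n x ax; apply: (le_trans (ler_norm_sum _ _ _)).
by apply: ler_sum => i _; exact: hC.
Qed.

Lemma loc_boundedX2 (F_ : nat -> R * R -> R) :
  loc_bounded F_ -> loc_bounded (fun n x => F_ n x ^+ 2).
Proof.
move=> lb a a01; have [C hC] := lb a a01; exists (C ^+ 2) => n x ax.
by rewrite normrX ler_pXn2r ?nnegrE //; [exact: hC|exact: le_trans (hC n x ax)].
Qed.

Lemma loc_boundedD (F_ H_ : nat -> R * R -> R) : loc_bounded F_ -> loc_bounded H_ ->
  loc_bounded (fun n x => F_ n x + H_ n x).
Proof.
move=> lF lH a a01; have [C hC] := lF a a01; have [C' hC'] := lH a a01.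
by exists (C + C') => n x ax; apply: (le_trans (ler_normD _ _)); rewrite lerD // ?hC ?hC'.
Qed.

Lemma loc_boundedZ (c : R) (F_ : nat -> R * R -> R) : loc_bounded F_ ->
  loc_bounded (fun n x => c * F_ n x).
Proof.
move=> lF a a01; have [C hC] := lF a a01.
by exists (`|c| * C) => n x ax; rewrite normrM ler_wpM2l // hC.
Qed.

Lemma loc_bounded_cst (c : R) : loc_bounded (fun _ _ => c).
Proof. by move=> a _; exists `|c|. Qed.

(** On a set of depth at least [a] the sequence is bounded by a constant, which is
    integrable there. *)
Lemma loc_integral_cvg D (a : R) (F_ : nat -> R * R -> R) (F : R * R -> R) :
  0 < a <= 1 -> @measurable _ (plane R) D -> D `<=` [set x | a <= depth x] ->
  (forall n, @measurable_fun _ _ (plane R) R disk (F_ n)) -> loc_bounded F_ ->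
  (forall x, disk x -> F_ n x @[n --> \oo] --> F x) ->
  (\int[leb2]_(x in D) (F_ n x)%:E @[n --> \oo] --> \int[leb2]_(x in D) (F x)%:E)%E /\
  leb2.-integrable D (EFin \o F).
Proof.
move=> a01 mD Da mF lb cv.
have a0 : 0 < a by case/andP: a01.
have Dd : D `<=` disk by move=> x /Da; exact: (depth_ge_disk a0).
have mFl := measurable_disk_limit mF cv.
have [C hC] := lb a a01.
have m1 n : @measurable_fun _ _ (plane R) _ D (fun x => (F_ n x)%:E).
  by apply/measurable_EFinP; apply: measurable_funS (mF n) => //; exact: measurable_disk.
have m2 : @measurable_fun _ _ (plane R) _ D (fun x => (F x)%:E).
  by apply/measurable_EFinP; apply: measurable_funS mFl => //; exact: measurable_disk.
have cvF : {ae leb2, forall x, D x -> (F_ n x)%:E @[n --> \oo] --> (F x)%:E}.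
  by apply: aeW => x Dx; apply/cvg_EFin; [exact: nearW|exact: cv (Dd _ Dx)].
have ID : leb2.-integrable D (EFin \o (fun=> C)).
  apply: (@bounded_integrable_plane _ _ _ `|C|) => //.
  by move=> x /Dd; rewrite /disk /cdisk /=; exact: ltW.
have dom : {ae leb2, forall x n, D x -> (`|(F_ n x)%:E| <= C%:E)%E}.
  by apply: aeW => x n Dx; rewrite lee_fin; apply: hC; exact: Da.
by have [I2 _ cvI] := @dominated_convergence _ (plane R) R leb2 D mD _ _ _ m1 m2 cvF ID dom.
Qed.

End LocBounded.

Section LimitComparison.
Context {R : realType}.
Variables (u_ : nat -> R * R -> 'rV[R]_4) (D_ : nat -> R * R -> 'M[R]_(4, 2))
  (u0 v : R * R -> 'rV[R]_4) (Dv : R * R -> 'M[R]_(4, 2)) (av : \bar R) (L C M E : R).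
Hypotheses
  (hD : forall n i, harmonic_grad (component (u_ n) i) (fun j x => D_ n x i j))
  (cD : forall n i j x, disk x -> {for x, continuous (fun x => D_ n x i j)})
  (uM : forall n i x, disk x -> `|u_ n x ord0 i| <= M)
  (u_unif : forall i e, 0 < e -> \forall n \near \oo, forall x, disk x ->
     `|u_ n x ord0 i - u0 x ord0 i| <= e)
  (cu0 : {within cdisk, continuous u0})
  (L0 : 0 <= L)
  (vL : forall i x y, cdisk x -> cdisk y -> `|v x ord0 i - v y ord0 i| <= L * `|x - y|)
  (vu0 : forall x, circle x -> v x = u0 x)
  (wDv : weak_differential v Dv)
  (DvL : {ae leb2, forall x, disk x -> forall i j, `|Dv x i j| <= L})
  (av0 : (0 <= av)%E)
  (cmp : forall n d, 0 < d -> (\int[leb2]_(x in core d) (jac (D_ n x))%:E <=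
   av + \int[leb2]_(x in layer d)
     (2^-1 * (3 * (sqnorm (Dv x) + sqnorm (D_ n x) +
       2 * (C / d) ^+ 2 * \sum_i (u_ n x ord0 i - v x ord0 i) ^+ 2)))%:E)%E)
  (energy : forall n, (\int[leb2]_(x in disk) (sqnorm (D_ n x))%:E <= E%:E)%E).

(** The differential of the limit, as the pointwise limit of the differentials. *)
Let G (x : R * R) : 'M[R]_(4, 2) := \matrix_(i, j) lim (D_ n x i j @[n --> \oo]).

Let cvg_G i j x : disk x -> D_ n x i j @[n --> \oo] --> G x i j.
Proof.
move=> Dx; rewrite mxE.
exact: (@harmonic_limit_grad _ (fun n => component (u_ n) i) (fun n j x => D_ n x i j)
  (component u0 i) M (fun n => hD n i) (fun n x Dx => uM n i Dx) (u_unif i) j x Dx).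
Qed.

Let cvg_u i x : disk x -> u_ n x ord0 i @[n --> \oo] --> u0 x ord0 i.
Proof.
move=> Dx; apply/cvgrPdist_le => e e0.
by have := u_unif i e0; apply: filterS => n h; rewrite distrC; exact: h.
Qed.

Let lbD i j : loc_bounded (fun n x => D_ n x i j).
Proof.
move=> a a01; exists (16 * M / a) => n x ax.
exact: (gradient_bound j (hD n i) (fun y Dy => uM n i Dy) a01 ax).
Qed.

Let lbu i : loc_bounded (fun n x => u_ n x ord0 i).
Proof.
move=> a /andP[a0 _]; exists M => n x ax; apply: uM; exact: (depth_ge_disk a0).
Qed.

Let mD n i j : @measurable_fun _ _ (plane R) R disk (fun x => D_ n x i j).
Proof. by apply: open_continuous_plane_measurable; [exact: open_disk|exact: cD]. Qed.

Let mu_ n i : @measurable_fun _ _ (plane R) R disk (fun x => u_ n x ord0 i).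
Proof.
apply: open_continuous_plane_measurable; first exact: open_disk.
by move=> x Dx; have [g2 /(_ x Dx)[]] := hD n i.
Qed.

Let mv i : @measurable_fun _ _ (plane R) R disk (fun x => v x ord0 i).
Proof. by have [[]] := wDv i ord0. Qed.

Let mG i j : @measurable_fun _ _ (plane R) R disk (fun x => G x i j).
Proof.
by apply: (@measurable_disk_limit _ (fun n x => D_ n x i j)) => [n|x]; [exact: mD|exact: cvg_G].
Qed.

Let mu0 i : @measurable_fun _ _ (plane R) R disk (fun x => u0 x ord0 i).
Proof.
by apply: (@measurable_disk_limit _ (fun n x => u_ n x ord0 i)) => [n|x]; [exact: mu_|exact: cvg_u].
Qed.

Let weak_G : weak_differential u0 G.
Proof.
move=> i j; apply: (@weak_partial_limit _ j (fun n => component (u_ n) i) (fun n x => D_ n x i j)).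
- by move=> n; apply: harmonic_weak_partial (hD n i) _ => x Dx; exact: cD.
- exact: lbu.
- exact: lbD.
- by move=> x Dx; exact: cvg_u.
- by move=> x Dx; exact: cvg_G.
Qed.

Let lb_sqnorm : loc_bounded (fun n x => sqnorm (D_ n x)).
Proof.
by apply: loc_boundedD; apply: loc_bounded_sum => i; apply: loc_boundedX2; exact: lbD.
Qed.

Let lb_jac : loc_bounded (fun n x => jac (D_ n x)).
Proof.
move=> a a01; have [K hK] := lb_sqnorm a01; exists (2^-1 * K) => n x ax.
rewrite ger0_norm ?jacobian_ge0 //; apply: (le_trans (jacobian_le _)).
by rewrite ler_pM2l ?invr_gt0 //; apply: le_trans (hK n x ax); exact: ler_norm.
Qed.

Let vN i x : disk x -> `|v x ord0 i| <= `|v (0, 0) ord0 i| + L * 2.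
Proof.
move=> Dx; have c0 : cdisk ((0, 0) : R * R) by rewrite /cdisk /= !expr0n addr0.
have cx : cdisk x by exact: ltW.
have := vL i cx c0; rewrite subr0.
have nx : `|x| <= 2.
  have /cdiskE /depth_bounded[x1 x2] := cx.
  by rewrite prod_normE ge_max (le_trans x1) ?(le_trans x2) // ler1n.
have : L * `|x| <= L * 2 by rewrite ler_wpM2l.
have := ler_normB (v x ord0 i - v (0, 0) ord0 i) (- v (0, 0) ord0 i).
by rewrite opprK subrK normrN; lra.
Qed.

(** The integrand of the comparison inequality after the squared norm of [Dv] has been
    replaced by its bound [8 * L ^+ 2], one [L ^+ 2] for each of the 8 entries. *)
Let h d (A : 'M[R]_(4, 2)) (w z : 'rV[R]_4) : R :=
  2^-1 * (3 * (8 * L ^+ 2 + sqnorm A + 2 * (C / d) ^+ 2 * \sum_i (w ord0 i - z ord0 i) ^+ 2)).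

Let sum_sqr_ge0 (w z : 'rV[R]_4) : 0 <= \sum_i (w ord0 i - z ord0 i) ^+ 2.
Proof. by apply: sumr_ge0 => i _; exact: sqr_ge0. Qed.

Let h_ge0 d A w z : 0 <= h d A w z.
Proof.
rewrite /h; have := sqnorm_ge0 A; have := sum_sqr_ge0 w z; have := sqr_ge0 (C / d).
have := sqr_ge0 L; move: (L ^+ 2) ((C / d) ^+ 2) (\sum_i _) (sqnorm A) => p q r s p0 q0 r0 s0.
by have := mulr_ge0 q0 r0; nra.
Qed.

Let limit_comparison d : 0 < d <= 1 ->
  (\int[leb2]_(x in core d) (jac (G x))%:E <=
   av + \int[leb2]_(x in layer d) (h d (G x) (u0 x) (v x))%:E)%E.
Proof.
move=> d01; have d0 : 0 < d by case/andP: d01.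
have [->|avoo] := eqVneq av +oo%E.
  by rewrite addye ?leey // gt_eqF // (lt_le_trans (ltNyr 0)) // integral_ge0 // => x _; rewrite lee_fin.
have avf : av \is a fin_num by rewrite ge0_fin_numE // ltey.
have md := @measurable_disk R.
have lbh : loc_bounded (fun n x => h d (D_ n x) (u_ n x) (v x)).
  apply: loc_boundedZ; apply: loc_boundedZ; apply: loc_boundedD.
    by apply: loc_boundedD => //; exact: loc_bounded_cst.
  apply: loc_boundedZ; apply: loc_bounded_sum => i; apply: loc_boundedX2.
  apply: loc_boundedD => //.
  move=> a /andP[a0 _]; exists (`|v (0, 0) ord0 i| + L * 2) => n x ax.
  by rewrite normrN; apply: vN; exact: (depth_ge_disk a0).
have mh n : @measurable_fun _ _ (plane R) R disk (fun x => h d (D_ n x) (u_ n x) (v x)).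
  apply: measurable_funM => //; apply: measurable_funM => //; apply: measurable_funD.
    by apply: measurable_funD => //; apply: measurable_sqnorm.
  apply: measurable_funM => //; apply: measurable_sum => i; apply: measurable_funX.
  exact: measurable_funB.
have ch x : disk x -> h d (D_ n x) (u_ n x) (v x) @[n --> \oo] --> h d (G x) (u0 x) (v x).
  move=> Dx; apply: cvgM; first exact: cvg_cst.
  apply: cvgM; first exact: cvg_cst.
  apply: cvgD.
    by apply: cvgD; [exact: cvg_cst|apply: cvg_sqnorm => i j; exact: cvg_G].
  apply: cvgM; first exact: cvg_cst.
  apply: cvgn_sum => i; rewrite !expr2; under eq_fun do rewrite expr2.
  have ci : u_ n x ord0 i - v x ord0 i @[n --> \oo] --> u0 x ord0 i - v x ord0 i.
    by apply: cvgB; [exact: cvg_u|exact: cvg_cst].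
  exact: cvgM.
have ml := @measurable_layer R d.
have ld : layer d `<=` [set x | d <= depth x] by move=> x /andP[/ltW].
have [cvh Ih] := loc_integral_cvg d01 ml ld mh lbh ch.
have [cvj _] : (\int[leb2]_(x in core d) (jac (D_ n x))%:E @[n --> \oo] -->
    \int[leb2]_(x in core d) (jac (G x))%:E)%E /\ leb2.-integrable (core d) (EFin \o (fun x => jac (G x))).
  apply: (loc_integral_cvg d01 (@measurable_core R d) _ _ lb_jac).
  - by move=> x; rewrite /core /= => h2; apply: le_trans h2; lra.
  - by move=> n; apply: measurable_jacobian.
  - by move=> x Dx; apply: cvg_jacobian => i j; exact: cvg_G.
have cvr : (av + \int[leb2]_(x in layer d) (h d (D_ n x) (u_ n x) (v x))%:E @[n --> \oo] -->
    av + \int[leb2]_(x in layer d) (h d (G x) (u0 x) (v x))%:E)%E.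
  apply: cvgeD => //; last exact: cvg_cst.
  by rewrite fin_num_adde_defr.
apply: (lee_cvg_to cvj cvr); apply: nearW => n.
apply: (le_trans (cmp n d0)); rewrite leeD2l //.
have msub (F : R * R -> R) : @measurable_fun _ _ (plane R) R disk F ->
    @measurable_fun _ _ (plane R) _ (layer d) (fun x => (F x)%:E).
  by move=> mF; apply/measurable_EFinP; apply: measurable_funS mF => //; exact: layer_disk.
apply: ae_ge0_le_integral => //.
- move=> x _; rewrite lee_fin mulr_ge0 // mulr_ge0 // addr_ge0 //.
    by rewrite addr_ge0 // sqnorm_ge0.
  by rewrite mulr_ge0 // mulr_ge0 // sqr_ge0.
- apply: msub; apply: measurable_funM => //; apply: measurable_funM => //; apply: measurable_funD.
    apply: measurable_funD; apply: measurable_sqnorm => // i j; exact: measurable_weak_differential wDv.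
  apply: measurable_funM => //; apply: measurable_sum => i; apply: measurable_funX.
  exact: measurable_funB.
- by move=> x _; rewrite lee_fin.
- exact: msub.
move: DvL; apply: ae_imp => x Dvx lx; have {}Dvx := Dvx (layer_disk d0 lx).
rewrite lee_fin /h ler_pM2l ?invr_gt0 // ler_pM2l // lerD2r lerD2r.
have colL j : sqcol (Dv x) j <= 4 * L ^+ 2.
  apply: (@le_trans _ _ (\sum_(i < 4) L ^+ 2)); last by rewrite sumr_const card_ord mulr_natl.
  apply: ler_sum => i _; rewrite -real_normK ?num_real // ler_pXn2r ?nnegrE //; exact: Dvx.
by have := colL ord0; have := colL ord_max; rewrite /sqnorm; lra.
Qed.

Let component_continuous (w : R * R -> 'rV[R]_4) i :
  {within cdisk, continuous w} -> {within cdisk, continuous (component w i)}.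
Proof.
move=> /subspace_continuousP cw; apply/subspace_continuousP => x cx.
apply: (@continuous_cvg _ _ _ _ _ _ (fun z : 'rV[R]_4 => z ord0 i)); last exact: cw.
exact: coord_continuous.
Qed.

Let energy_G : (\int[leb2]_(x in disk) (sqnorm (G x))%:E <= E%:E)%E.
Proof.
have md := @measurable_disk R.
have cv x : disk x -> ((sqnorm (D_ n x))%:E @[n --> \oo] --> (sqnorm (G x))%:E)%E.
  by move=> Dx; apply/cvg_EFin; [exact: nearW|apply: cvg_sqnorm => i j; exact: cvg_G].
have ms n : @measurable_fun _ _ (plane R) _ disk (fun x => (sqnorm (D_ n x))%:E).
  by apply/measurable_EFinP; apply: measurable_sqnorm.
have := @fatou _ (plane R) R leb2 disk md (fun n x => (sqnorm (D_ n x))%:E) ms.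
move=> /(_ (fun n x _ => sqnorm_ge0 _)) F.
have -> : (\int[leb2]_(x in disk) (sqnorm (G x))%:E =
    \int[leb2]_(x in disk) limn_einf (fun n => (sqnorm (D_ n x))%:E))%E.
  by apply: eq_integral => x; rewrite inE => Dx; have [-> _] := cvg_limn_einf_sup (cv x Dx).
apply: (le_trans F); rewrite limn_einf_lim; apply: lime_le; first exact: is_cvg_einfs.
apply: nearW => n; apply: le_trans (energy n); apply: ereal_inf_lbound.
by exists n => /=.
Qed.

Let msG : @measurable_fun _ _ (plane R) R disk (fun x => sqnorm (G x)).
Proof. exact: measurable_sqnorm. Qed.

Let integrable_sqnorm_G : leb2.-integrable disk (EFin \o (fun x => sqnorm (G x))).
Proof.
apply/integrableP; split; first exact/measurable_EFinP.
apply: le_lt_trans (ltry E); apply: le_trans energy_G.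
rewrite le_eqVlt; apply/orP; left; apply/eqP/eq_integral => x _ /=.
by rewrite ger0_norm // sqnorm_ge0.
Qed.

Let entry_sqnorm (A : 'M[R]_(4, 2)) i j : A i j ^+ 2 <= sqnorm A.
Proof.
have col k : A i k ^+ 2 <= sqcol A k.
  by rewrite /sqcol (bigD1 i) //= lerDl sumr_ge0 // => l _; exact: sqr_ge0.
apply: (le_trans (col j)); rewrite /sqnorm; move: j; apply: ord2P.
  by rewrite lerDl sqcol_ge0.
by rewrite lerDr sqcol_ge0.
Qed.

(** The constants collect 4 components, 4 caps and the factor of Hardy's inequality:
    [384 = 3 * 4 * 32] and [1536 = 3 * 4 * 128]. *)
Let Q (x : R * R) : R := 12 * L ^+ 2 + (3 / 2 + 384 * C ^+ 2) * sqnorm (G x).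

Let layer_gap d i : 0 < d <= 4^-1 ->
  (\int[leb2]_(x in layer d) ((u0 x ord0 i - v x ord0 i) ^+ 2)%:E <=
   (32 * d ^+ 2)%:E * \int[leb2]_(x in collar d) (sqnorm (G x))%:E + (128 * L ^+ 2 * d ^+ 3)%:E)%E.
Proof.
move=> /andP[d0 d4].
have mgap : @measurable_fun _ _ (plane R) R disk (fun x => (u0 x ord0 i - v x ord0 i) ^+ 2).
  by apply: measurable_funX; exact: measurable_funB.
have := @hardy_layer R (fun n => component (u_ n) i) (fun j n x => D_ n x i j)
  (component u0 i) (fun j x => G x i j) (component v i) L d.
move=> H; have {H} : (\int[leb2]_(x in layer d) ((u0 x ord0 i - v x ord0 i) ^+ 2)%:E <=
   \sum_(p : 'I_2 * bool) ((8 * d ^+ 2)%:E * \int[leb2]_(x in collar d) (G x i p.1 ^+ 2)%:E +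
     (32 * L ^+ 2 * d ^+ 3)%:E))%E.
  apply: H => //.
  - by move=> n j x Dx; have [g2 /(_ x Dx)[_ + _ _]] := hD n i; apply.
  - by move=> n j x Dx; exact: cD.
  - by move=> x Dx; exact: cvg_u.
  - by move=> j x Dx; exact: cvg_G.
  - exact: component_continuous.
  - by move=> x y cx cy; exact: vL.
  - by move=> x cx; rewrite /component vu0.
move/le_trans; apply.
have mc := @measurable_collar R d; have cd := @collar_disk R d.
apply: (@le_trans _ _ (\sum_(p : 'I_2 * bool) ((8 * d ^+ 2)%:E *
    \int[leb2]_(x in collar d) (sqnorm (G x))%:E + (32 * L ^+ 2 * d ^+ 3)%:E))%E).
  have d8 : (0 <= (8 * d ^+ 2)%:E)%E by rewrite lee_fin mulr_ge0 // sqr_ge0.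
  apply: lee_sum => p _; rewrite leeD2r // lee_wpmul2l //.
  apply: ge0_le_integral => //.
  - by move=> x _; rewrite lee_fin sqr_ge0.
  - by apply/measurable_EFinP; apply: measurable_funX; apply: measurable_funS (mG i p.1) => //; exact: measurable_disk.
  - by apply/measurable_EFinP; apply: measurable_funS msG => //; exact: measurable_disk.
  - by move=> x _; rewrite lee_fin.
have S4 (y : \bar R) : (\sum_(p : 'I_2 * bool) y = 4%:E * y)%E.
  by rewrite sumr_const card_prod card_ord card_bool; exact/esym/(mule_natl y 4).
have s0 : (0 <= (8 * d ^+ 2)%:E * \int[leb2]_(x in collar d) (sqnorm (G x))%:E)%E.
  apply: mule_ge0; first by rewrite lee_fin mulr_ge0 // sqr_ge0.
  by apply: integral_ge0 => x _; rewrite lee_fin sqnorm_ge0.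
have c0 : (0 <= (32 * L ^+ 2 * d ^+ 3)%:E)%E.
  by rewrite lee_fin; apply: mulr_ge0; [rewrite mulr_ge0 // sqr_ge0|rewrite exprn_ge0 // ltW].
rewrite S4 ge0_muleDr // muleA -!EFinM.
by apply: leeD; rewrite le_eqVlt; apply/orP; left; apply/eqP; [congr (_%:E * _)%E|congr (_%:E)]; ring.
Qed.

(** The factor [d ^+ 2] of Hardy's inequality cancels the [(C / d) ^+ 2] that the gradient
    of the cutoff contributes. *)
Let layer_error d : 0 < d <= 4^-1 ->
  (\int[leb2]_(x in layer d) (h d (G x) (u0 x) (v x))%:E <=
   \int[leb2]_(x in collar d) (Q x)%:E + (1536 * C ^+ 2 * L ^+ 2 * d)%:E)%E.
Proof.
move=> d04; have /andP[d0 d4] := d04.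
have mc := @measurable_collar R d; have cd := @collar_disk R d.
have ml := @measurable_layer R d; have ld := @layer_disk R d d0.
have lc : layer d `<=` collar d.
  by move=> x /andP[h1 h2]; rewrite /collar /= h2 andbT; exact: lt_trans h1.
pose q x := 12 * L ^+ 2 + 3 / 2 * sqnorm (G x).
have q0 x : 0 <= q x by rewrite addr_ge0 // mulr_ge0 ?sqr_ge0 ?sqnorm_ge0 ?divr_ge0.
have mq : @measurable_fun _ _ (plane R) R disk q.
  by apply: measurable_funD => //; apply: measurable_funM.
have mS (D : set (R * R)) (F : R * R -> R) : @measurable _ (plane R) D -> D `<=` disk ->
    @measurable_fun _ _ (plane R) R disk F -> @measurable_fun _ _ (plane R) _ D (fun x => (F x)%:E).
  move=> mDD Dd mF; apply/measurable_EFinP; apply: measurable_funS mF => //; exact: measurable_disk.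
have mgap i : @measurable_fun _ _ (plane R) R disk (fun x => (u0 x ord0 i - v x ord0 i) ^+ 2).
  by apply: measurable_funX; exact: measurable_funB.
have [s0 Es] : exists2 s : R, 0 <= s & (\int[leb2]_(x in collar d) (sqnorm (G x))%:E)%E = s%:E.
  have Is : leb2.-integrable (collar d) (EFin \o (fun x => sqnorm (G x))).
    by apply: integrableS integrable_sqnorm_G => //; exact: measurable_disk.
  exists (fine (\int[leb2]_(x in collar d) (sqnorm (G x))%:E)%E).
    by rewrite fine_ge0 // integral_ge0 // => x _; rewrite lee_fin sqnorm_ge0.
  by rewrite fineK //; exact: integrable_fin_num Is.
move=> Es'; pose c := 3 * (C / d) ^+ 2.
have c0 : 0 <= c by rewrite mulr_ge0 // sqr_ge0.
have -> : (\int[leb2]_(x in layer d) (h d (G x) (u0 x) (v x))%:E =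
    \int[leb2]_(x in layer d) (q x)%:E + c%:E * \sum_(i < 4)
      \int[leb2]_(x in layer d) ((u0 x ord0 i - v x ord0 i) ^+ 2)%:E)%E.
  rewrite -ge0_integral_sum //; last 2 first.
  - by move=> i; apply: mS.
  - by move=> i x _; rewrite lee_fin sqr_ge0.
  rewrite -ge0_integralZl //; last 2 first.
  - by apply: emeasurable_sum => i; apply: mS.
  - by move=> x _; apply: sume_ge0 => i _; rewrite lee_fin sqr_ge0.
  rewrite -ge0_integralD //; last 4 first.
  - by move=> x _; rewrite lee_fin.
  - exact: mS.
  - by move=> x _; rewrite mule_ge0 // sume_ge0 // => i _; rewrite lee_fin sqr_ge0.
  - by apply: measurable_funeM; apply: emeasurable_sum => i; apply: mS.
  apply: eq_integral => x _; rewrite sumEFin -EFinM -EFinD /h /q /c; congr (_%:E).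
  by move: (C / d) (\sum_i _) (sqnorm _) => p r t; field.
have -> : (\int[leb2]_(x in collar d) (Q x)%:E =
    \int[leb2]_(x in collar d) (q x)%:E + (384 * C ^+ 2 * s0)%:E)%E.
  rewrite EFinM -Es' -ge0_integralZl //; last 3 first.
  - exact: mS.
  - by move=> x _; rewrite lee_fin sqnorm_ge0.
  - by rewrite lee_fin mulr_ge0 // sqr_ge0.
  rewrite -ge0_integralD //; last 4 first.
  - by move=> x _; rewrite lee_fin.
  - exact: mS.
  - by move=> x _; rewrite mule_ge0 // lee_fin ?sqnorm_ge0 // mulr_ge0 // sqr_ge0.
  - by apply: measurable_funeM; apply: mS.
  by apply: eq_integral => x _; rewrite -EFinM -EFinD /Q /q; congr (_%:E); ring.
rewrite -addeA; apply: leeD.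
  by apply: ge0_subset_integral => //; [exact: mS|move=> x _; rewrite lee_fin].
apply: (@le_trans _ _ (c%:E * \sum_(i < 4) ((32 * d ^+ 2 * s0) + 128 * L ^+ 2 * d ^+ 3)%:E)%E).
  rewrite lee_wpmul2l ?lee_fin //; apply: lee_sum => i _.
  by apply: (le_trans (layer_gap i d04)); rewrite Es' -EFinM -EFinD.
rewrite sumEFin sumr_const card_ord -EFinM -EFinD lee_fin le_eqVlt; apply/orP; left; apply/eqP.
by rewrite /c -mulr_natl; field; rewrite gt_eqF.
Qed.

Let exhaust (A_ : nat -> set (R * R)) (B : set (R * R)) (F : R * R -> R) :
  (forall n, @measurable _ (plane R) (A_ n)) -> @measurable _ (plane R) B ->
  (forall n, A_ n `<=` disk) -> B `<=` disk ->
  leb2.-integrable disk (EFin \o F) ->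
  (forall x, disk x -> \forall n \near \oo, A_ n x <-> B x) ->
  (\int[leb2]_(x in A_ n) (F x)%:E @[n --> \oo] --> \int[leb2]_(x in B) (F x)%:E)%E.
Proof.
move=> mA mB Ad Bd IF cA; have md := @measurable_disk R.
have E' D : D `<=` disk -> (\int[leb2]_(x in D) (F x)%:E =
    \int[leb2]_(x in disk) ((EFin \o F) \_ D) x)%E.
  by move=> Dd; rewrite -integral_mkcondr setIidr.
under eq_fun do rewrite E' //; rewrite E' //.
have mF := measurable_int leb2 IF.
have mr D : @measurable _ (plane R) D -> @measurable_fun _ _ (plane R) _ disk ((EFin \o F) \_ D).
  move=> mDD; apply/measurable_restrict => //; apply: measurable_funS mF => //.
have cvF : {ae leb2, forall x, disk x -> ((EFin \o F) \_ (A_ n)) x @[n --> \oo] --> ((EFin \o F) \_ B) x}.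
  apply: aeW => x Dx; apply: cvg_near_cst; have := cA x Dx; apply: filterS => n e.
  by rewrite !patchE; congr (if _ then _ else _); apply/idP/idP; rewrite !inE => /e.
have IFn : leb2.-integrable disk (EFin \o (fun x => `|F x|)) by exact: integrable_norm IF.
have dom : {ae leb2, forall x n, disk x -> (`|((EFin \o F) \_ (A_ n)) x| <= (`|F x|)%:E)%E}.
  apply: aeW => x n _; rewrite patchE.
  by case: ifP => _ /=; rewrite lee_fin ?normr0.
have [_ _ cvI] := @dominated_convergence _ (plane R) R leb2 disk md _ _ _ (fun n => mr _ (mA n))
  (mr _ mB) cvF IFn dom.
exact: cvI.
Qed.

(** Along [d n -> 0] the cores exhaust the disk, while the collars shrink to the empty
    set; the integrals follow by dominated convergence, the squared differential of the
    limit being integrable. *)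
Lemma area_limit_le : (area u0 <= av)%E.
Proof.
rewrite (area_weakE weak_G).
pose d (n : nat) : R := n.+4%:R^-1.
have d0 n : 0 < d n by rewrite invr_gt0 ltr0n.
have d4 n : d n <= 4^-1 by rewrite lef_pV2 ?posrE ?ltr0n // ler_nat.
have d1 n : d n <= 1 by apply: (le_trans (d4 n)); rewrite invf_le1 // ler1n.
have cd : d n @[n --> \oo] --> (0 : R).
  have := @cvg_harmonic R; rewrite -(cvg_shiftS (@harmonic R)).
  rewrite -(cvg_shiftS (fun n => @harmonic R n.+1)).
  by rewrite -(cvg_shiftS (fun n => @harmonic R n.+2)).
have small x : disk x -> \forall n \near \oo, 2 * d n < depth x.
  move=> /diskE Dx; have D2 : 0 < depth x / 2 by rewrite divr_gt0.
  move/cvgrPdist_lt : cd => /(_ _ D2); apply: filterS => n.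
  by rewrite sub0r normrN ger0_norm ?(ltW (d0 n)) //; lra.
have IJ : leb2.-integrable disk (EFin \o (fun x => jac (G x))).
  apply: le_integrable integrable_sqnorm_G; first exact: measurable_disk.
    by apply/measurable_EFinP; exact: measurable_jacobian.
  move=> x _ /=; rewrite lee_fin !ger0_norm ?jacobian_ge0 ?sqnorm_ge0 //.
  by apply: (le_trans (jacobian_le _)); have := sqnorm_ge0 (G x); lra.
have IQ : leb2.-integrable disk (EFin \o Q).
  have I1 : leb2.-integrable disk (EFin \o (fun=> 12 * L ^+ 2)).
    apply: (@bounded_integrable_plane _ _ _ `|12 * L ^+ 2|) => //; first exact: measurable_disk.
    by move=> x; rewrite /disk /cdisk /=; exact: ltW.
  exact: (integrableD (@measurable_disk R) I1 (integrableZl (@measurable_disk R) _ integrable_sqnorm_G)).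
have c1 : (\int[leb2]_(x in core (d n)) (jac (G x))%:E @[n --> \oo] -->
    \int[leb2]_(x in disk) (jac (G x))%:E)%E.
  apply: exhaust => //.
  - by move=> n; exact: measurable_core.
  - exact: measurable_disk.
  - by move=> n; exact: core_disk.
  - by move=> x Dx; have := small x Dx; apply: filterS => n /ltW.
have c2 : (\int[leb2]_(x in collar (d n)) (Q x)%:E @[n --> \oo] --> 0)%E.
  rewrite -(integral_set0 leb2 (fun x => (Q x)%:E)).
  apply: exhaust => //.
  - by move=> n; exact: measurable_collar.
  - by move=> n; exact: collar_disk.
  - move=> x Dx; have := small x Dx; apply: filterS => n H; split => // /andP[_].
    by rewrite ltNge (ltW H).
have c3 : ((1536 * C ^+ 2 * L ^+ 2 * d n)%:E @[n --> \oo] --> 0)%E.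
  apply/cvg_EFin; first exact: nearW.
  by rewrite -(mulr0 (1536 * C ^+ 2 * L ^+ 2)); apply: cvgM => //; exact: cvg_cst.
have c4 : (av + (\int[leb2]_(x in collar (d n)) (Q x)%:E + (1536 * C ^+ 2 * L ^+ 2 * d n)%:E)
    @[n --> \oo] --> av)%E.
  rewrite -[X in _ --> X]adde0 -[X in (_ + X)%E]adde0; apply: cvgeD; last 2 first.
  - exact: cvg_cst.
  - by apply: cvgeD.
  by rewrite adde0 fin_num_adde_defl.
apply: (lee_cvg_to c1 c4); apply: nearW => n.
have dn1 : 0 < d n <= 1 by rewrite d0 d1.
have dn4 : 0 < d n <= 4^-1 by rewrite d0 d4.
by apply: (le_trans (limit_comparison dn1)); rewrite leeD2l // layer_error.
Qed.

End LimitComparison.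

(** * Uniform energy bound for Douglas minimizers *)

Section RowVectors.
Context {R : realType}.
Implicit Types w z : 'rV[R]_4.

Lemma coord_le_norm w i : `|w ord0 i| <= `|w|.
Proof.
rewrite [leRHS]/Num.norm /= mx_normrE.
exact: (le_bigmax _ (fun ij : 'I_1 * 'I_4 => `|w ij.1 ij.2|) (ord0, i)).
Qed.

Lemma norm_le_coord w (c : R) : 0 <= c -> (forall i, `|w ord0 i| <= c) -> `|w| <= c.
Proof.
move=> c0 wc; rewrite [leLHS]/Num.norm /= mx_normrE; apply: bigmax_le => // -[i j] _ /=.
by rewrite (ord1 i).
Qed.

(** Carries [lift_curve gamma 1] to [lift_curve gamma eps]. *)
Definition squeeze (eps : R) w : 'rV[R]_4 := \row_i ((if (i < 2)%N then 1 else eps) * w ord0 i).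

Lemma squeeze_continuous (eps : R) : 0 < eps <= 1 -> continuous (squeeze eps).
Proof.
move=> /andP[e0 e1] w A /nbhs_ballP[t /= t0 tA]; apply/nbhs_ballP; exists t => // z.
rewrite -ball_normE /= => wz; apply: tA; rewrite -ball_normE /=; apply: le_lt_trans wz.
apply: norm_le_coord => // i.
rewrite !mxE -mulrBr normrM; apply: (@le_trans _ _ (1 * `|(w - z) ord0 i|)).
  by rewrite !mxE ler_wpM2r //; case: ifP => _; rewrite ?normr1 // ger0_norm // ltW.
by rewrite mul1r coord_le_norm.
Qed.

Lemma spans_squeeze (gamma : R * R -> 'rV[R]_2) (eps : R) (u : R * R -> 'rV[R]_4) : 0 < eps <= 1 ->
  spans (lift_curve gamma 1) u -> spans (lift_curve gamma eps) (squeeze eps \o u).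
Proof.
move=> e01 [cu [su [Du wu sDu]] [phi [cphi sphi mphi uphi]]].
pose c (i : 'I_4) : R := if (i < 2)%N then 1 else eps.
have cE i : component (squeeze eps \o u) i = fun x => c i * component u i x.
  by apply/funext => x; rewrite /component /= mxE.
have sqZ (k : R) f : square_integrable f -> square_integrable (fun x => k * f x).
  move=> sf; rewrite (_ : (fun x => _) = f \* (fun=> k)); last by apply/funext => x /=; rewrite mulrC.
  by apply: square_integrable_smooth => //; exact: smooth_cst.
split.
- move=> x; apply: (@continuous_cvg _ _ _ _ _ _ (squeeze eps)); last exact: cu.
  exact: squeeze_continuous.
- split; first by move=> i; rewrite cE; exact: sqZ.
  exists (fun x => \matrix_(i, j) (c i * Du x i j)).
    move=> i j; rewrite cE; have := weak_partialZ (c i) (wu i j).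
    by congr weak_partial; apply/funext => x; rewrite mxE.
  move=> i j; rewrite (_ : (fun x => _) = (fun x => c i * Du x i j)); first exact: sqZ.
  by apply/funext => x; rewrite mxE.
- exists phi; split => // x Cx; apply/rowP => i; rewrite /= mxE uphi // /lift_curve.
  case: (@split_ordP 2 2 i) => k ->.
    by rewrite mul1r [LHS](row_mxEl _ _ ord0 k) [RHS](row_mxEl _ _ ord0 k).
  by rewrite [X in _ * X](row_mxEr _ _ ord0 k) [RHS](row_mxEr _ _ ord0 k) !mxE mul1r.
Qed.

Lemma sqnorm_squeeze_le (c : 'I_4 -> R) (A : 'M[R]_(4, 2)) : (forall i, 0 <= c i <= 1) ->
  sqnorm (\matrix_(i, j) (c i * A i j)) <= sqnorm A.
Proof.
move=> c01; have col j : sqcol (\matrix_(i, j) (c i * A i j)) j <= sqcol A j.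
  apply: ler_sum => i _; rewrite mxE exprMn -[leRHS]mul1r ler_wpM2r ?sqr_ge0 //.
  by have /andP[c0 c1] := c01 i; rewrite expr_le1.
by rewrite /sqnorm lerD.
Qed.

End RowVectors.

Section DouglasMinimizers.
Context {R : realType}.
Implicit Types (w : R * R -> 'rV[R]_4).

Definition differential w (x : R * R) : 'M[R]_(4, 2) :=
  \matrix_(i, j) 'D_(dir j) (component w i) x.

Lemma harmonic_component w i : Defs.harmonic w ->
  harmonic_grad (component w i) (fun j x => differential w x i j).
Proof.
move=> /(_ i)[[c0 d0] hw].
exists (fun j => 'D_(dir j) ('D_(dir j) (component w i))) => x Dx.
have E j : (fun x => differential w x i j) = 'D_(dir j) (component w i).
  by apply/funext => y; rewrite mxE.
split.
- exact: c0.
- by move=> j; rewrite mxE; apply: derivableP; exact: (d0 j).1.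
- by move=> j; rewrite E; apply: derivableP; exact: ((d0 j).2.2 j).1.
- have sum2 (F : 'I_2 -> R) : \sum_(j < 2) F j = F ord0 + F ord_max.
    by rewrite !big_ord_recl big_ord0 addr0; congr (_ + F _); exact: val_inj.
  by rewrite -[RHS](hw x Dx) sum2.
Qed.

Lemma harmonic_continuous w i j x : Defs.harmonic w -> disk x ->
  {for x, continuous (fun x => differential w x i j)}.
Proof.
move=> /(_ i)[[c0 d0] _] Dx.
rewrite (_ : (fun x => _) = 'D_(dir j) (component w i)); first exact: (d0 j).2.1.
by apply/funext => y; rewrite mxE.
Qed.

Lemma weak_differential_harmonic w : Defs.harmonic w -> weak_differential w (differential w).
Proof.
move=> hw i j; apply: (harmonic_weak_partial (harmonic_component i hw)) => x Dx.
exact: harmonic_continuous.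
Qed.

Lemma area_conformal w : Defs.harmonic w -> weakly_conformal w ->
  area w = (\int[leb2]_(x in disk) (2^-1 * sqnorm (differential w x))%:E)%E.
Proof.
move=> hw cw; rewrite (area_weakE (weak_differential_harmonic hw)).
apply: eq_integral => x; rewrite inE => Dx; have [E1 E2] := cw x Dx.
rewrite jacobian_conformal; first by [].
  by rewrite /sqcol; under eq_bigr do rewrite mxE; rewrite E1; apply: eq_bigr => i _; rewrite mxE.
by rewrite /dotcols -[RHS]E2; apply: eq_bigr => i _; rewrite !mxE.
Qed.

Lemma energy_lty w : Defs.harmonic w -> W12 w ->
  (\int[leb2]_(x in disk) (sqnorm (differential w x))%:E < +oo)%E.
Proof.
move=> hw [_ [Dw wD sD]]; have md := @measurable_disk R.
have mDw : @measurable_fun _ _ (plane R) R disk (fun x => sqnorm (Dw x)).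
  by apply: measurable_sqnorm => i j; exact: measurable_weak_differential wD.
have mdw : @measurable_fun _ _ (plane R) R disk (fun x => sqnorm (differential w x)).
  by apply: measurable_sqnorm => i j; exact: measurable_weak_differential (weak_differential_harmonic hw).
rewrite (_ : \int[leb2]_(x in disk) _ = \int[leb2]_(x in disk) (sqnorm (Dw x))%:E)%E; last first.
  apply: ge0_ae_eq_integral => //.
  - exact/measurable_EFinP.
  - exact/measurable_EFinP.
  - by move=> x _; rewrite lee_fin sqnorm_ge0.
  - by move=> x _; rewrite lee_fin sqnorm_ge0.
  - have := weak_differential_unique (weak_differential_harmonic hw) wD.
    by apply: ae_imp => x + Dx => ->.
have Icol j : leb2.-integrable disk (EFin \o (fun x => sqcol (Dw x) j)).
  rewrite (_ : EFin \o _ = (fun x => \sum_(i < 4) (Dw x i j ^+ 2)%:E)%E); last first.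
    by apply/funext => x /=; rewrite sumEFin.
  apply: (@integrable_sum _ (plane R) R leb2 disk md) => i _.
  exact/(square_integrableP (sD i j).1).
have IDw : leb2.-integrable disk (EFin \o (fun x => sqnorm (Dw x))).
  exact: (integrableD md (Icol ord0) (Icol ord_max)).
by have /integrable_fin_num/fin_numPlt/andP[] := IDw.
Qed.

(** Squeezing [u1] gives a competitor for [u]. Its area is at most its energy, and
    squeezing decreases the energy; for the conformal maps [u] and [u1] area and energy
    coincide. *)
Lemma energy_le (gamma : R * R -> 'rV[R]_2) (eps : R) (u1 u : R * R -> 'rV[R]_4) : 0 < eps <= 1 ->
  douglas_minimizer (lift_curve gamma 1) u1 -> douglas_minimizer (lift_curve gamma eps) u ->
  (\int[leb2]_(x in disk) (sqnorm (differential u x))%:E <=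
   \int[leb2]_(x in disk) (sqnorm (differential u1 x))%:E)%E.
Proof.
move=> e01 [sp1 h1 c1 _] [sp h c min].
pose k (i : 'I_4) : R := if (i < 2)%N then 1 else eps.
have k01 i : 0 <= k i <= 1 by rewrite /k; case: ifP => _; rewrite ?ler01 ?lexx //; case/andP: e01 => /ltW -> ->.
have wk : weak_differential (squeeze eps \o u1) (fun x => \matrix_(i, j) (k i * differential u1 x i j)).
  move=> i j; have := weak_partialZ (k i) (weak_differential_harmonic h1 i j).
  by congr weak_partial; apply/funext => x; rewrite /component /= mxE.
have mdif w : Defs.harmonic w -> forall i j, @measurable_fun _ _ (plane R) R disk (fun x => differential w x i j).
  by move=> hw i j; exact: measurable_weak_differential (weak_differential_harmonic hw).
have H : (\int[leb2]_(x in disk) (2^-1 * sqnorm (differential u x))%:E <=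
    \int[leb2]_(x in disk) (2^-1 * sqnorm (differential u1 x))%:E)%E.
  rewrite -area_conformal //; apply: (le_trans (min _ (spans_squeeze e01 sp1))).
  rewrite (area_weakE wk); apply: ge0_le_integral.
  - exact: measurable_disk.
  - by move=> x _; rewrite lee_fin jacobian_ge0.
  - apply/measurable_EFinP; apply: measurable_jacobian => i j; exact: measurable_weak_differential wk.
  - by apply/measurable_EFinP; apply: measurable_funM => //; apply: measurable_sqnorm; exact: mdif.
  - move=> x _; rewrite lee_fin; apply: (le_trans (jacobian_le _)).
    by rewrite ler_pM2l ?invr_gt0 // sqnorm_squeeze_le.
have half w : Defs.harmonic w -> (\int[leb2]_(x in disk) (2^-1 * sqnorm (differential w x))%:E =
    2^-1%:E * \int[leb2]_(x in disk) (sqnorm (differential w x))%:E)%E.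
  move=> hw; under eq_integral do rewrite EFinM.
  rewrite ge0_integralZl //; first exact: measurable_disk.
    by apply/measurable_EFinP; apply: measurable_sqnorm; exact: mdif.
  by move=> x _; rewrite lee_fin sqnorm_ge0.
move: H; rewrite (half _ h) (half _ h1).
by move: (\int[leb2]_(x in disk) _)%E (\int[leb2]_(x in disk) _)%E => p q; rewrite lee_pmul2l // lte_fin invr_gt0.
Qed.

End DouglasMinimizers.

(** * Minimality of the limit *)

Section BoundaryData.
Context {R : realType}.

Lemma lipschitz_cdisk (v : R * R -> 'rV[R]_4) : [lipschitz v x | x in cdisk] ->
  exists2 L : R, 0 <= L & forall x y, cdisk x -> cdisk y -> `|v x - v y| <= L * `|x - y|.
Proof.
move=> [M [_ hM]]; exists (Num.max M 0 + 1); first by rewrite addr_ge0 // le_max lexx orbT.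
move=> x y cx cy; apply: (hM (Num.max M 0 + 1) _ (x, y)); last by split.
by rewrite ltr_pwDr // le_max lexx.
Qed.

Lemma lipschitz_within_continuous (v : R * R -> 'rV[R]_4) (L : R) : 0 <= L ->
  (forall x y, cdisk x -> cdisk y -> `|v x - v y| <= L * `|x - y|) ->
  {within cdisk, continuous v}.
Proof.
move=> L0 vL; apply/subspace_continuousP => x cx A /nbhs_ballP[t /= t0 tA].
have L1 : 0 < L + 1 by lra.
change (\forall y \near x, cdisk y -> A (v y)).
apply/nbhs_ballP; exists (t / (L + 1)) => /=; first by rewrite divr_gt0.
move=> y; rewrite -ball_normE /= => xy cy; apply: tA; rewrite -ball_normE /=.
apply: (le_lt_trans (vL _ _ cx cy)); move: xy; rewrite ltr_pdivlMr // => xy.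
by apply: le_lt_trans xy; rewrite mulrC ler_wpM2l //; lra.
Qed.

Lemma uniform_cdisk (u_ : nat -> R * R -> 'rV[R]_4) (u0 : R * R -> 'rV[R]_4) :
  {uniform cdisk, u_ @ \oo --> u0} -> forall t : R, 0 < t ->
  \forall n \near \oo, forall x, cdisk x -> `|u0 x - u_ n x| <= t.
Proof.
move=> hu t t0.
have : nbhs (u0 : {uniform` cdisk -> 'rV[R]_4})
    [set w : R * R -> 'rV[R]_4 | forall x, cdisk x -> `|u0 x - w x| <= t].
  apply/uniform_nbhs; exists [set xy : 'rV[R]_4 * 'rV[R]_4 | ball xy.1 t xy.2]; split.
    exact: (entourage_ball _ (PosNum t0)).
  by move=> w /= H x cx; have := H x cx; rewrite -ball_normE /= => /ltW.
by move=> /hu.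
Qed.

End BoundaryData.

Theorem proposition3p2 (R : realType)
  (gamma : R * R -> 'rV[R]_2) (hgamma : C1_closed_curve gamma)
  (u : R -> R * R -> 'rV[R]_4)
  (hu : forall eps, 0 < eps <= 1 ->
     douglas_minimizer (lift_curve gamma eps) (u eps))
  (a1 a2 a3 p1 p2 p3 : R * R)
  (hcyclic : same_cyclic_order a1 a2 a3 p1 p2 p3)
  (hp12 : gamma p1 <> gamma p2) (hp13 : gamma p1 <> gamma p3)
  (hp23 : gamma p2 <> gamma p3)
  (hthree : forall eps, 0 < eps <= 1 ->
     [/\ u eps a1 = lift_curve gamma eps p1,
         u eps a2 = lift_curve gamma eps p2 &
         u eps a3 = lift_curve gamma eps p3])
  (e : nat -> R) (he : forall j, 0 < e j <= 1)
  (hdecr : nonincreasing_seq e) (he0 : e @ \oo --> (0 : R))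
  (u0 : R * R -> 'rV[R]_4) (hu0 : {within cdisk, continuous u0})
  (hcvg : {uniform cdisk, (fun j => u (e j)) @ \oo --> u0})
  (v : R * R -> 'rV[R]_4) (hv : [lipschitz v x | x in cdisk])
  (hbd : forall x, circle x -> v x = u0 x) :
  (area u0 <= area v)%E.
Proof.
have [[Dv wDv]|nD] := pselect (exists Dv, weak_differential v Dv); last first.
  by rewrite [leRHS]/area; case: asboolP => // _; exact: leey.
have [L L0 vL] := lipschitz_cdisk hv.
have cv := lipschitz_within_continuous L0 vL.
have dc (x : R * R) : disk x -> cdisk x by exact: ltW.
have vLi i (x y : R * R) : cdisk x -> cdisk y -> `|v x ord0 i - v y ord0 i| <= L * `|x - y|.
  move=> cx cy; apply: le_trans (vL x y cx cy).
  by have := coord_le_norm (v x - v y) i; rewrite !mxE.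
have bounded (w : R * R -> 'rV[R]_4) : {within cdisk, continuous w} ->
    exists N : R, forall i x, cdisk x -> `|w x ord0 i| <= N.
  move=> cw; have : compact (w @` cdisk).
    apply: continuous_compact; first exact: cw.
    rewrite (_ : cdisk = [set x | 0 <= depth x]); first exact: compact_depth_ge.
    by apply/seteqP; split => x /cdiskE.
  move=> /compact_bounded[N [_ hN]]; exists (`|N| + 1).
  move=> i x cx; apply: (le_trans (coord_le_norm _ _)); apply: hN; last by exists x.
  by rewrite (le_lt_trans (ler_norm N)) // ltrDl.
have [Nv vN] := bounded v cv; have [N0 u0N] := bounded u0 hu0.
have wv : W12 v.
  apply: (W12_lipschitz L0 wDv (N := Nv)).
    by move=> i x Dx; apply: vN; exact: dc.
  by move=> i x y Dx Dy; apply: vLi; exact: dc.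
have DvL : {ae leb2, forall x, disk x -> forall i j, `|Dv x i j| <= L}.
  have : {ae leb2, forall x, forall ij : 'I_4 * 'I_2, disk x -> `|Dv x ij.1 ij.2| <= L}.
    apply: ae_forall_countable => -[i j].
    apply: (weak_partial_lipschitz L0 (f := component v i) (N := Nv)).
    - by move=> x Dx; apply: vN; exact: dc.
    - by move=> x y Dx Dy; apply: vLi; exact: dc.
    - exact: wDv.
  by apply: ae_imp => x H Dx i j; exact: (H (i, j)).
have unif := uniform_cdisk hcvg.
(* The first [n0] maps are dropped, so that the others are within distance 1 of [u0],
   hence uniformly bounded. *)
have [n0 _ hn0] := unif 1 ltr01.
have coordB (w z : 'rV[R]_4) i : `|w ord0 i - z ord0 i| <= `|z - w|.
  by rewrite distrC; have := coord_le_norm (z - w) i; rewrite !mxE.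
have [C C0 cutoff] := @cutoff_exists R.
pose w (n : nat) := u (e (n + n0)%N).
have e1 : 0 < (1 : R) <= 1 by rewrite ltr01 lexx.
have hw n : douglas_minimizer (lift_curve gamma (e (n + n0)%N)) (w n) by exact: hu.
have harm n : Defs.harmonic (w n) by have [] := hw n.
have [sp1 h1 _ _] := hu 1 e1; have [_ W1 _] := sp1.
have E1 := energy_lty h1 W1.
set E := (\int[leb2]_(x in disk) (sqnorm (differential (u 1) x))%:E)%E in E1.
have EE : E = (fine E)%:E.
  by rewrite fineK // ge0_fin_numE // integral_ge0 // => x _; rewrite lee_fin sqnorm_ge0.
have en n : (\int[leb2]_(x in disk) (sqnorm (differential (w n) x))%:E <= (fine E)%:E)%E.
  by rewrite -EE; exact: energy_le (he (n + n0)%N) (hu 1 e1) (hw n).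
have finite n : (area (w n) < +oo)%E.
  have [_ _ cf _] := hw n; rewrite (area_conformal (harm n) cf).
  apply: le_lt_trans (ltry (fine E)); apply: le_trans (en n); apply: ge0_le_integral.
  - exact: measurable_disk.
  - by move=> x _; rewrite lee_fin mulr_ge0 // sqnorm_ge0.
  - apply/measurable_EFinP; apply: measurable_funM => //; apply: measurable_sqnorm => i j.
    exact: measurable_weak_differential (weak_differential_harmonic (harm n)).
  - apply/measurable_EFinP; apply: measurable_sqnorm => i j.
    exact: measurable_weak_differential (weak_differential_harmonic (harm n)).
  - by move=> x _; rewrite lee_fin; have := sqnorm_ge0 (differential (w n) x); lra.
apply: (@area_limit_le R w (fun n => differential (w n)) u0 v Dv (area v) L C (N0 + 1) (fine E)).
- by move=> n i; exact: harmonic_component (harm n).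
- by move=> n i j x Dx; exact: harmonic_continuous (harm n) Dx.
- move=> n i x Dx; have := hn0 (n + n0)%N (leq_addl _ _) x (dc x Dx).
  have := coordB (w n x) (u0 x) i; have := u0N i x (dc x Dx).
  have := ler_normD (w n x ord0 i - u0 x ord0 i) (u0 x ord0 i).
  by rewrite subrK /w; lra.
- move=> i t t0; have [m _ hm] := unif t t0; exists m => // n /= mn x Dx.
  apply: (le_trans (coordB _ _ _)); apply: hm; last exact: dc.
  exact: (leq_trans mn (leq_addr _ _)).
- exact: hu0.
- exact: L0.
- exact: vLi.
- exact: hbd.
- exact: wDv.
- exact: DvL.
- by rewrite (area_weakE wDv) integral_ge0 // => x _; rewrite lee_fin jacobian_ge0.
- move=> n d d0; have [lam [sl l01 lr lc lC]] := cutoff d d0.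
  have [sp _ _ min] := hw n.
  exact: (layer_comparison d0 sl l01 lr lc lC sp min cv wv (weak_differential_harmonic (harm n)) wDv (finite n)).
- exact: en.
Qed.
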